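(* For each $0<\epsilon<\epsilon_0$, the word map $\kappa\mapsto \mathrm{w}(\kappa)$ determines a one-to-one correspondence between words of chords with boundary on $\Lambda^0\subset(\mathbb{R}^3,\xi_{std})$ and Reeb chords of $\Lambda^0\subset(\mathbb{R}^3_{\Lambda^\pm},\xi_{\Lambda^\pm})$ determined by the contact form $\alpha_\epsilon$. For each such word $w$, the associated chord $\kappa_w$ is non-degenerate for all $\epsilon<\epsilon_0$.
   Context: Surgery setup. $I_\epsilon=[-\epsilon,\epsilon]$, $S^1=\mathbb{R}/\mathbb{Z}$, $\alpha_{std}=dz-y\,dx$, $\xi_{std}=\ker\alpha_{std}$ on $\mathbb{R}^3$, $\pi_{xy}$ the projection to the $xy$-plane. $\Lambda=\Lambda^+\cup\Lambda^0\cup\Lambda^-\subset(\mathbb{R}^3,\xi_{std})$ is an oriented Legendrian link with components $\Lambda_i$; $c_i\in\{+1,0,-1\}$ means $\Lambda_i\subset\Lambda^{c_i}$; $\Lambda^\pm=\Lambda^+\cup\Lambda^-$. The chords $r_j$ of $\Lambda$ are the $\partial_z$-directed segments with both endpoints on $\Lambda$; $r_j$ begins on $\Lambda_{l_j^-}$ and ends on $\Lambda_{l_j^+}$. Standing assumptions: chords are non-degenerate (double points of $\pi_{xy}(\Lambda)$ are transverse) and pairwise disjoint; each component has length $1$ for the metric on $\xi_{std}$ making $\partial_x+y\partial_z,\partial_y$ orthonormal; good position: near each double point $(x_0,y_0)$ of $\pi_{xy}(\Lambda)$ the upper strand projects to $\{(x_0+s,y_0-s)\}$ and the lower one to $\{(x_0+s,y_0+s)\}$.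 For small $\epsilon_0>0$ fix disjoint embeddings $\Phi_i:I_{\epsilon_0}\times I_{\epsilon_0}\times S^1\to\mathbb{R}^3$, coordinates $(z,p,q)$, with $\Phi_i^*\alpha_{std}=dz+p\,dq$, $\Phi_i(z,p,q)=\Phi_i(0,p,q)+(0,0,z)$, $\Phi_i(0,0,q)$ an oriented unit-speed parameterization of $\Lambda_i$, and near a chord endpoint with parameter $q_0$ over the double point $(x_0,y_0)$: $\pi_{xy}\Phi_i(z,p,q)=(x_0,y_0)+(q-q_0)v-p\,J_0v$, $v$ the unit tangent of $\pi_{xy}(\Lambda_i)$ there and $J_0$ rotation by $\pi/2$. $N_{\epsilon,i}=\Phi_i(I_\epsilon\times I_\epsilon\times S^1)$, $N_\epsilon=\bigcup_iN_{\epsilon,i}$; $\epsilon_0$ is small enough that the projections of the strands of $N_\epsilon$ to the $xy$-plane overlap only in one rectangle $\mathcal{D}_j$ around the double point of each $r_j$. Fix smooth $f:\mathbb{R}\to S^1$ with $f=0$ for $p\le-1$, $f'$ even, $0\le f'\le1$, $\mathrm{supp} f'\subset[-1,1]$, $\int f'=1$, and $f'=1$ on $I_{(1-\delta)/2}$, where $\delta=\delta(\epsilon)>0$ is small enough that every point lying over a rectangle $\mathcal D_j$ in the bottom of a surgery handle and flowing vertically through the handle to a point over a rectangle $\mathcal D_{j'}$, $j'\ne j$, in its top has $p$ in the interval where $f_\epsilon(p)=f(p/\epsilon)$ is affine. Let $H_\epsilon(p)=\int_{-\infty}^pPf_\epsilon'(P)\,dP$. For $\epsilon<\epsilon_0$,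 $(\mathbb{R}^3_{\Lambda^\pm},\xi_{\Lambda^\pm})$ with contact form $\alpha_\epsilon$ is obtained by removing $N_{\epsilon,i}$ for each $\Lambda_i\subset\Lambda^\pm$ and regluing a copy of it with the form $dz+p\,dq$, where inside coordinates are sent to outside coordinates by $(z,p,q)\mapsto(z-c_iH_\epsilon(p),p,q+c_if_\epsilon(p))$ near the top $\{z=\epsilon\}$ and by the identity near the sides $\{|p|=\epsilon\}$ and bottom $\{z=-\epsilon\}$; $\alpha_\epsilon=\alpha_{std}$ elsewhere. $R_\epsilon$ is the Reeb field. $\Lambda^0$ is considered as a Legendrian link in the surgered manifold. Words. $(r_a,r_b)$ is composable if $l_a^+=l_b^-$. A word of chords with boundary on $\Lambda^0$ is $r_{j_1}\cdots r_{j_n}$ with consecutive pairs composable, $r_{j_1}$ beginning on $\Lambda^0$, $r_{j_n}$ ending on $\Lambda^0$, all other endpoints on $\Lambda^\pm$. A chord $\kappa$ of $\Lambda^0\subset\mathbb{R}^3_{\Lambda^\pm}$ is a compact orbit segment of $R_\epsilon$ with both endpoints on $\Lambda^0$; outside the surgery handles it is a sequence of $\partial_z$-directed segments, over rectangles $\mathcal{D}_{j_1},\dots,\mathcal{D}_{j_n}$ in order, each running along the chord $r_{j_k}$, and $\mathrm{w}(\kappa)=r_{j_1}\cdots r_{j_n}$. A chord $\kappa$ of length $a$ is non-degenerate if the time-$a$ flow of $R_\epsilon$ carries $T\Lambda^0$ at its starting point to a line in $\xi$ different from $T\Lambda^0$ at its endpoint.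
   Formalization: The smallness condition on δ is also required for flow from the upper-strand to the lower-strand copy of the same rectangle (j'=j) when both ends of r_j lie on one component; with j'≠j only, words containing r_j r_j can have degenerate or non-unique chords. *)

(* Defs.v *)
From Stdlib Require Export Reals ZArith List.
From Stdlib Require Fin.
From Coquelicot Require Export Coquelicot.

Set Implicit Arguments.
Unset Strict Implicit.
Unset Printing Implicit Defensive.

Open Scope R_scope.

(* The coordinates are ((x, y), z) in the ambient space and ((z, p), q) in a
   handle. *)

Notation R3 := (R * R * R)%type.

Definition c1 (x : R3) : R := fst (fst x).
Definition c2 (x : R3) : R := snd (fst x).
Definition c3 (x : R3) : R := snd x.

Definition pi_xy (x : R3) : R * R := fst x.

Definition lift_z (h : R) (x : R3) : R3 := (c1 x, c2 x, c3 x + h).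

Definition velocity (g : R -> R3) (t : R) : R3 :=
  (Derive (fun s => c1 (g s)) t,
   Derive (fun s => c2 (g s)) t,
   Derive (fun s => c3 (g s)) t).

Definition J0 (v : R * R) : R * R := (- snd v, fst v).

Definition smooth1 (g : R -> R) : Prop := forall n x, ex_derive_n g n x.

Definition dir_deriv (v : R3) (g : R3 -> R) (x : R3) : R :=
  Derive (fun t => g (plus x (scal t v))) 0.

Fixpoint Cn_on (n : nat) (U : R3 -> Prop) (g : R3 -> R) : Prop :=
  (forall x, U x -> continuous g x) /\
  match n with
  | O => True
  | S k => forall v : R3,
      (forall x, U x -> ex_derive (fun t => g (plus x (scal t v))) 0) /\
      Cn_on k U (dir_deriv v g)
  end.

Definition smooth_on (U : R3 -> Prop) (F : R3 -> R3) : Prop :=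
  forall n, Cn_on n U (fun x => c1 (F x)) /\
            Cn_on n U (fun x => c2 (F x)) /\
            Cn_on n U (fun x => c3 (F x)).

(* The arguments are a base point and a tangent vector. *)
Definition form := R3 -> R3 -> R.

(* dz - y dx in coordinates ((x, y), z) *)
Definition alpha_std : form := fun x v => c3 v - c2 x * c1 v.

(* dz + p dq in coordinates ((z, p), q) *)
Definition alpha_loc : form := fun y v => c1 v + c2 y * c3 v.

(* (d alpha)(u, v) = D_u (alpha v) - D_v (alpha u), u and v being extended to
   constant vector fields *)
Definition d_form (a : form) (x u v : R3) : R :=
  dir_deriv u (fun x' => a x' v) x - dir_deriv v (fun x' => a x' u) x.

Definition is_Reeb_vector (a : form) (x v : R3) : Prop :=
  a x v = 1 /\ forall u, d_form a x v u = 0.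

(* The circle R/Z is represented by its universal cover: maps out of it are
   1-periodic functions on R. *)

Record link := Link {
  ncomp : nat;
  coef  : Fin.t ncomp -> Z;           (* c_i, in {1, 0, -1} *)
  lam   : Fin.t ncomp -> R -> R3      (* parameterization of Lambda_i *)
}.

Definition comp (L : link) := Fin.t (ncomp L).

Record vchord (L : link) := VChord {
  comp_lo : comp L;  par_lo : R;
  comp_hi : comp L;  par_hi : R
}.

Definition pt_lo (L : link) (r : vchord L) : R3 := lam (comp_lo r) (par_lo r).
Definition pt_hi (L : link) (r : vchord L) : R3 := lam (comp_hi r) (par_hi r).

(* Parameters are taken in [0, 1), so that a chord has one description. *)
Definition is_chord (L : link) (r : vchord L) : Prop :=
  0 <= par_lo r < 1 /\ 0 <= par_hi r < 1 /\
  pi_xy (pt_lo r) = pi_xy (pt_hi r) /\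
  c3 (pt_lo r) < c3 (pt_hi r).

Definition on_chord (L : link) (r : vchord L) (x : R3) : Prop :=
  exists h, 0 <= h <= c3 (pt_hi r) - c3 (pt_lo r) /\ x = lift_z h (pt_lo r).

(* The two ends of a chord; [true] is the upper one. *)
Definition comp_end (L : link) (r : vchord L) (b : bool) : comp L :=
  if b then comp_hi r else comp_lo r.
Definition par_end (L : link) (r : vchord L) (b : bool) : R :=
  if b then par_hi r else par_lo r.

Definition legendrian_link (L : link) : Prop :=
  (forall i : comp L, coef i = 1%Z \/ coef i = 0%Z \/ coef i = (-1)%Z) /\
  (forall i : comp L,
      smooth1 (fun q => c1 (lam i q)) /\
      smooth1 (fun q => c2 (lam i q)) /\
      smooth1 (fun q => c3 (lam i q))) /\
  (forall (i : comp L) q, lam i (q + 1) = lam i q) /\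
  (forall (i i' : comp L) q q', lam i q = lam i' q' ->
      i = i' /\ exists n : Z, q' = q + IZR n) /\
  (forall (i : comp L) q, alpha_std (lam i q) (velocity (lam i) q) = 0) /\
  (* Unit speed for the metric on xi_std in which d_x + y d_z and d_y are
     orthonormal; with period 1 each component has length 1. *)
  (forall (i : comp L) q,
      (c1 (velocity (lam i) q)) ^ 2 + (c2 (velocity (lam i) q)) ^ 2 = 1).

Definition nondegenerate_chords (L : link) : Prop :=
  forall r : vchord L, is_chord r ->
    let u := velocity (lam (comp_lo r)) (par_lo r) in
    let v := velocity (lam (comp_hi r)) (par_hi r) in
    c1 u * c2 v - c2 u * c1 v <> 0.

Definition disjoint_chords (L : link) : Prop :=
  forall r r' : vchord L, is_chord r -> is_chord r' -> r <> r' ->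
    forall x, ~ (on_chord r x /\ on_chord r' x).

Definition good_position (L : link) : Prop :=
  forall r : vchord L, is_chord r ->
    let x0 := c1 (pt_lo r) in
    let y0 := c2 (pt_lo r) in
    exists eta, 0 < eta /\
      (forall q, Rabs (q - par_hi r) < eta ->
         exists s, pi_xy (lam (comp_hi r) q) = (x0 + s, y0 - s)) /\
      (forall q, Rabs (q - par_lo r) < eta ->
         exists s, pi_xy (lam (comp_lo r) q) = (x0 + s, y0 + s)).

Definition box (e : R) (y : R3) : Prop := Rabs (c1 y) <= e /\ Rabs (c2 y) <= e.

Definition eq_mod_Z (y y' : R3) : Prop :=
  c1 y = c1 y' /\ c2 y = c2 y' /\ exists n : Z, c3 y' = c3 y + IZR n.

(* On the annulus {(p, q) : |p| <= e} of the i-th component, the part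
   lying over the rectangle D_r as the strand of the end [b] of r. By the
   normal form below, D_r is the square of half-side e around the double
   point, with sides parallel to the two strands. *)
Definition in_rect (L : link) (e : R) (r : vchord L) (b : bool)
    (i : comp L) (p q : R) : Prop :=
  is_chord r /\ i = comp_end r b /\ Rabs p <= e /\
  exists n : Z, Rabs (q + IZR n - par_end r b) <= e.

Definition tubular_neighborhoods (L : link) (eps0 : R)
    (Phi : comp L -> R3 -> R3) : Prop :=
  (forall i, exists U : R3 -> Prop,
      open U /\ (forall y, box eps0 y -> U y) /\ smooth_on U (Phi i)) /\
  (forall i z p q, box eps0 (z, p, q) -> Phi i (z, p, q + 1) = Phi i (z, p, q)) /\
  (forall i i' y y', box eps0 y -> box eps0 y' -> Phi i y = Phi i' y' ->
      i = i' /\ eq_mod_Z y y') /\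
  (forall i y, box eps0 y ->
      exists D : R3 -> R3, filterdiff (Phi i) (locally y) D /\
        (forall v, D v = zero -> v = zero) /\
        (forall v, alpha_std (Phi i y) (D v) = alpha_loc y v)) /\
  (forall i z p q, box eps0 (z, p, q) ->
      Phi i (z, p, q) = lift_z z (Phi i (0, p, q))) /\
  (forall i q, Phi i (0, 0, q) = lam i q) /\
  (forall r b z p q, is_chord r ->
      box eps0 (z, p, q) -> Rabs (q - par_end r b) <= eps0 ->
      let i := comp_end r b in
      let q0 := par_end r b in
      let v : R * R := pi_xy (velocity (lam i) q0) in
      pi_xy (Phi i (z, p, q)) =
        minus (plus (pi_xy (lam i q0)) (scal (q - q0) v)) (scal p (J0 v))) /\
  (* the strands of N_e overlap over the rectangles D_r only *)
  (forall e i i' p p' q q', 0 < e < eps0 -> Rabs p <= e -> Rabs p' <= e ->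
      pi_xy (Phi i (0, p, q)) = pi_xy (Phi i' (0, p', q')) ->
      (i = i' /\ eq_mod_Z (0, p, q) (0, p', q')) \/
      exists r b, in_rect e r b i p q /\ in_rect e r (negb b) i' p' q').

(* [f] is the lift to R, with f = 0 on (-oo, -1], of the map
   to the circle; its values on [1, +oo) are 1.                        *)

Definition twist_profile (delta : R) (f : R -> R) : Prop :=
  smooth1 f /\
  (forall p, p <= -1 -> f p = 0) /\
  (forall p, Derive f (- p) = Derive f p) /\
  (forall p, 0 <= Derive f p <= 1) /\
  (forall p, 1 < Rabs p -> Derive f p = 0) /\
  is_RInt (Derive f) (-1) 1 1 /\
  (forall p, Rabs p <= (1 - delta) / 2 -> Derive f p = 1).

Definition f_eps (eps : R) (f : R -> R) (p : R) : R := f (p / eps).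

Definition H_eps (eps : R) (f : R -> R) (p : R) : R :=
  RInt_gen (fun P => P * Derive (f_eps eps f) P)
           (Rbar_locally m_infty) (at_point p).

(* delta is small enough: vertical flow through a handle from one
   rectangle of its annulus to another one stays in the affine region.
   When both ends of r lie on the same component, D_r appears twice in
   the annulus, as (r, false) and (r, true), and those rectangles count as
   different. *)
Definition small_delta (L : link) (eps delta : R) (f : R -> R) : Prop :=
  forall (i : comp L) (r r' : vchord L) (b b' : bool) (p q : R),
    coef i <> 0%Z -> (r, b) <> (r', b') ->
    in_rect eps r b i p q ->
    in_rect eps r' b' i p (q + IZR (coef i) * f_eps eps f p) ->
    Rabs (p / eps) <= (1 - delta) / 2.

Record surgery := Surgery {
  lk :> link;
  Phi : comp lk -> R3 -> R3;
  eps0 : R;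
  eps : R;
  prof : R -> R
}.

(* Inside-to-outside change of coordinates: the identity near the bottom
   and the sides, the twist near the top. Both formulas agree modulo Z
   where |p| >= eps, as f_eps is 0 or 1 and H_eps vanishes there. *)
Definition glue_map (S : surgery) (i : comp S) (y : R3) : R3 :=
  let '(z, p, q) := y in
  if Rle_dec z 0 then (z, p, q)
  else (z - IZR (coef i) * H_eps (eps S) (prof S) p, p,
        q + IZR (coef i) * f_eps (eps S) (prof S) p).

(* The glued-in copy of N_{eps,i}. Since the twist moves the level z = eps
   to the graph z = eps - c_i H, the top of the copy is placed at the height
   which the twist sends to the top {z = eps} of the part removed. *)
Definition handle_core (S : surgery) (i : comp S) (y : R3) : Prop :=
  Rabs (c2 y) <= eps S /\
  - eps S <= c1 y <= eps S + IZR (coef i) * H_eps (eps S) (prof S) (c2 y).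

(* The handle together with an open collar, on whose complement of the core
   [glue_map] takes values in N_{eps0,i} minus N_{eps,i} *)
Definition handle_chart (S : surgery) (i : comp S) (y : R3) : Prop :=
  coef i <> 0%Z /\ Rabs (c2 y) < eps0 S /\
  - eps0 S < c1 y < eps0 S + IZR (coef i) * H_eps (eps S) (prof S) (c2 y).

Definition outside (S : surgery) (x : R3) : Prop :=
  forall (i : comp S) y, coef i <> 0%Z -> box (eps S) y -> x <> Phi i y.

Inductive prepoint (S : surgery) :=
| Outside (x : R3)
| Inside (i : comp S) (y : R3).
Arguments Outside {S} x.
Arguments Inside {S} i y.

Definition in_chart (S : surgery) (u : prepoint S) : Prop :=
  match u with
  | Outside x => outside S x
  | Inside i y => handle_chart i y
  end.

Definition glued (S : surgery) (u v : prepoint S) : Prop :=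
  match u, v with
  | Outside x, Outside x' => x = x'
  | Inside i y, Inside i' y' => i = i' /\ eq_mod_Z y y'
  | Inside i y, Outside x | Outside x, Inside i y =>
      ~ handle_core i y /\ x = Phi i (glue_map i y)
  end.

Definition point_class (S : surgery) (u : prepoint S) : prepoint S -> Prop :=
  fun v => in_chart v /\ glued u v.

(* R^3_{Lambda^{+-}}, as the quotient of the disjoint union of the charts by
   [glued] *)
Definition surgered (S : surgery) : Type :=
  { C : prepoint S -> Prop | exists u, in_chart u /\ C = point_class u }.

Definition rep (S : surgery) (P : surgered S) (u : prepoint S) : Prop :=
  proj1_sig P u.

Definition Reeb_in_chart (S : surgery) (a : form) (chart : R3 -> prepoint S)
    (g : R -> surgered S) (T t : R) : Prop :=
  exists (x : R -> R3) (eta : R), 0 < eta /\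
    forall s, 0 <= s <= T -> Rabs (s - t) < eta ->
      rep (g s) (chart (x s)) /\
      exists v, is_derive x s v /\ is_Reeb_vector a (x s) v.

(* The contact form alpha_eps is alpha_std in the outside chart and
   dz + p dq in the handle charts. *)
Definition Reeb_trajectory (S : surgery) (T : R) (g : R -> surgered S) : Prop :=
  forall t, 0 <= t <= T ->
    Reeb_in_chart alpha_std Outside g T t \/
    exists i, Reeb_in_chart alpha_loc (Inside i) g T t.

Definition Reeb_flow (S : surgery) (T : R) (P Q : surgered S) : Prop :=
  exists g, Reeb_trajectory T g /\ g 0 = P /\ g T = Q.

Definition on_Lambda0 (S : surgery) (P : surgered S) : Prop :=
  exists (i : comp S) q, coef i = 0%Z /\ rep P (Outside (lam i q)).

(* Only the restriction of [traj] to [0, len] is meaningful. *)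
Record Reeb_chord (S : surgery) := ReebChord {
  len : R;
  traj : R -> surgered S;
  len_pos : 0 < len;
  traj_Reeb : Reeb_trajectory len traj;
  traj_start : on_Lambda0 (traj 0);
  traj_end : on_Lambda0 (traj len)
}.

Definition same_chord (S : surgery) (k k' : Reeb_chord S) : Prop :=
  len k = len k' /\ forall t, 0 <= t <= len k -> traj k t = traj k' t.

Definition nondegenerate (S : surgery) (k : Reeb_chord S) : Prop :=
  exists (i i' : comp S) (q q' : R),
    coef i = 0%Z /\ coef i' = 0%Z /\
    rep (traj k 0) (Outside (lam i q)) /\ rep (traj k (len k)) (Outside (lam i' q')) /\
    (* F is the time-(len k) flow near the starting point and D is its
       differential there *)
    exists F D : R3 -> R3,
      F (lam i q) = lam i' q' /\
      locally (lam i q) (fun x => forall P : surgered S, rep P (Outside x) ->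
        exists Q, rep Q (Outside (F x)) /\ Reeb_flow (len k) P Q) /\
      filterdiff F (locally (lam i q)) D /\
      let w := D (velocity (lam i) q) in
      w <> zero /\ alpha_std (lam i' q') w = 0 /\
      ~ exists s : R, w = scal s (velocity (lam i') q').

Definition is_word (L : link) (w : list (vchord L)) : Prop :=
  w <> nil /\
  forall k r, nth_error w k = Some r ->
    is_chord r /\
    (coef (comp_lo r) = 0%Z <-> k = 0%nat) /\
    (coef (comp_hi r) = 0%Z <-> S k = length w) /\
    forall r', nth_error w (S k) = Some r' -> comp_hi r = comp_lo r'.

(* x lies over the rectangle D_r, above the lower strand of r and below
   the upper one. *)
Definition along (S : surgery) (r : vchord S) (x : R3) : Prop :=
  (exists p q h, in_rect (eps S) r false (comp_lo r) p q /\ 0 <= h /\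
     x = lift_z h (Phi (comp_lo r) (0, p, q))) /\
  (exists p q h, in_rect (eps S) r true (comp_hi r) p q /\ 0 <= h /\
     lift_z h x = Phi (comp_hi r) (0, p, q)).

(* k runs along the chords of w during the intervals (s j, e j) and is in
   the surgery handles in between. *)
Definition has_word (S : surgery) (k : Reeb_chord S) (w : list (vchord S)) : Prop :=
  w <> nil /\
  exists s e : nat -> R,
    s 0%nat = 0 /\ e (pred (length w)) = len k /\
    forall j r, nth_error w j = Some r ->
      s j < e j /\
      (forall t, s j < t < e j ->
         exists x, rep (traj k t) (Outside x) /\ along r x) /\
      ((Datatypes.S j < length w)%nat ->
         e j < s (Datatypes.S j) /\
         forall t, e j <= t <= s (Datatypes.S j) ->
           exists i y, handle_core i y /\ rep (traj k t) (Inside i y)).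

(* Main.v *)
Require Import Defs.
From Stdlib Require Import Lra Lia Psatz Classical IndefiniteDescription.
From Stdlib Require Import FunctionalExtensionality PropExtensionality ProofIrrelevance.
From Stdlib Require Nsatz.

Set Implicit Arguments.
Unset Strict Implicit.
Unset Printing Implicit Defensive.

(** Reeb trajectories are vertical in every chart, so a chord of Lambda^0 is
    described by the points X_1, ..., X_n of the plane over which its segments
    outside the handles lie.  A plane point lies under at most two strands of
    the tubular neighborhoods ([overlap_pair], which rests on the disjointness
    of the rectangles, [rect_unique]), and over the rectangle of a chord of the
    link one strand stays above the other ([gap]).  Hence a vertical segment
    between two strands runs along exactly one chord r_k of the link ([climb]);
    together with the fact that a trajectory can leave the vertical line that
    it follows outside only by entering the bottom of a handle ([outside_run])
    this gives every Reeb chord its word ([trajectory_follows]).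

    It remains to count the sequences X_1, ..., X_n that belong to a word.  Let
    u_k and u_(k+1) be the offsets p of X_k in the lower and the upper strand
    at r_k.  In good position the strands are perpendicular, so the change from
    one strand to the other is a quarter turn, while a handle shears q by
    c f_eps(p).  Smallness of delta says that f_eps is affine with slope 1/eps
    on all offsets that can occur, and the integer in q modulo Z is forced,
    because two chord ends on one component are more than 2 eps apart
    ([par_apart], [turning]).  Therefore
      c u_(k+1) / eps = +-u_k +- u_(k+2) + constant,
    where 1/eps > 2 because a chord only fits if eps_0 < 1/2 ([eps0_lt_half]).
    The middle term dominates: if the difference of two solutions does not decrease
    in absolute value at one step, it never decreases again ([hop_growth]).  Starting and
    ending on Lambda^0 means u_1 = u_(n+1) = 0, so growth gives uniqueness
    ([orbit_unique]).  For existence, u_(n+1) is an affine function of u_2 of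
    nonzero slope, and the solution with u_(n+1) = 0 never exceeds eps/2, since
    beyond eps/2 the offsets increase for ever ([orbit_shooting]).  Such a
    solution is turned into a trajectory by concatenation of vertical segments
    ([orbit_trajectory]).

    Nondegeneracy is the same growth for the linearized recurrence.  The flow
    near the chord is explicit in the plane coordinates; its height component
    is differentiated with the help of the contact forms, which the flow
    preserves ([orbit_local_flow]).  The tangent of Lambda^0 at the start has
    p-component 0 in the lower strand of r_1, hence a nonzero one in the upper
    strand, and growth keeps it nonzero up to the upper strand of r_n. *)

(** * Differentials of real functions *)

(** The algebraic structures on R hide its operations from ring and lra. *)
Ltac to_R := repeat match goal with
  | |- context [@plus ?G ?a ?b] => change (@plus G a b) with (Rplus a b)
  | |- context [@minus ?G ?a ?b] => change (@minus G a b) with (Rminus a b)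
  | |- context [@opp ?G ?a] => change (@opp G a) with (Ropp a)
  | |- context [@scal ?K ?V ?a ?b] => change (@scal K V a b) with (Rmult a b)
  | |- context [@mult ?K ?a ?b] => change (@mult K a b) with (Rmult a b)
  | |- context [@zero ?G] => change (@zero G) with R0
  end;
  try match goal with |- @eq _ ?a ?b => change (@eq R a b) end.

Lemma Rmin_lt x a b : x < Rmin a b -> x < a /\ x < b.
Proof. intros H. generalize (Rmin_l a b) (Rmin_r a b). lra. Qed.

Lemma pair_eq (A B : Type) (x y : A * B) : fst x = fst y -> snd x = snd y -> x = y.
Proof. destruct x, y; simpl; intros; now subst. Qed.

Local Instance locally_Filter (U : UniformSpace) (x : U) : Filter (locally x) :=
  @filter_filter _ _ (locally_filter x).

Section Differentials.
Context {U : NormedModule R_AbsRing}.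
Implicit Types (f g : U -> R) (x : U).

Definition sdiff f x (l : U -> R) : Prop :=
  @filterdiff R_AbsRing U R_NormedModule f (locally x) l.

Lemma sdiff_plus f g x lf lg : sdiff f x lf -> sdiff g x lg ->
  sdiff (fun y => f y + g y) x (fun v => lf v + lg v).
Proof. intros; apply (@filterdiff_plus_fct R_AbsRing U R_NormedModule); auto; apply locally_Filter. Qed.

Lemma sdiff_scal k f x lf : sdiff f x lf -> sdiff (fun y => k * f y) x (fun v => k * lf v).
Proof.
  intros; apply (@filterdiff_scal_r_fct R_AbsRing U R_NormedModule); auto.
  apply locally_Filter. exact Rmult_comm.
Qed.

Lemma sdiff_ext_lin f x lf lf' : sdiff f x lf -> (forall v, lf v = lf' v) -> sdiff f x lf'.
Proof. intros H E. exact (@filterdiff_ext_lin _ _ _ _ (locally_Filter x) _ _ _ H E). Qed.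

Lemma sdiff_ext f g x lf : (forall y, f y = g y) -> sdiff f x lf -> sdiff g x lf.
Proof. intros E H. exact (@filterdiff_ext _ _ _ _ (locally_Filter x) _ _ _ E H). Qed.

Lemma sdiff_minus f g x lf lg : sdiff f x lf -> sdiff g x lg ->
  sdiff (fun y => f y - g y) x (fun v => lf v - lg v).
Proof.
  intros Hf Hg. generalize (sdiff_plus Hf (sdiff_scal (-1) Hg)). intros H.
  apply (@sdiff_ext_lin _ _ (fun v => lf v + -1 * lg v)); [|intros; ring].
  refine (@sdiff_ext (fun y => f y + -1 * g y) _ _ _ _ H). intros; ring.
Qed.

Lemma sdiff_const k x : sdiff (fun _ => k) x (fun _ => 0).
Proof. apply (@filterdiff_const R_AbsRing U R_NormedModule), locally_Filter. Qed.

Lemma sdiff_chain (h : R -> R) d f x lf : is_derive h (f x) d -> sdiff f x lf ->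
  sdiff (fun y => h (f y)) x (fun v => d * lf v).
Proof.
  intros Hh Hf.
  apply (@sdiff_ext_lin _ _ (fun v => lf v * d)); [|intros; ring].
  exact (@filterdiff_comp' R_AbsRing U R_NormedModule R_NormedModule f h x lf _ Hf Hh).
Qed.

Lemma is_derive_line x (v : U) (t0 : R) : is_derive (fun t : R => plus x (scal t v)) t0 v.
Proof.
  unfold is_derive.
  apply (@filterdiff_ext_lin _ _ _ _ (locally_Filter (t0 : R_AbsRing)) _
    (fun t : R_AbsRing => plus zero (scal t v))).
  - apply (@filterdiff_plus_fct R_AbsRing R_NormedModule U); [apply locally_Filter| |].
    + apply (@filterdiff_const R_AbsRing R_NormedModule U), locally_Filter.
    + apply (@filterdiff_linear R_AbsRing R_NormedModule U).
      apply (@is_linear_scal_l R_AbsRing U).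
  - intros t. apply plus_zero_l.
Qed.

(** A differential is determined by the derivatives along lines through the point. *)
Lemma filterdiff_is_derive (V : NormedModule R_AbsRing) (f : U -> V) x D v :
  filterdiff f (locally x) D -> is_derive (fun t : R => f (plus x (scal t v))) 0 (D v).
Proof.
  intros H.
  assert (HD : is_linear D) by apply H.
  unfold is_derive.
  apply (@filterdiff_ext_lin _ _ _ _ (locally_Filter (0 : R_AbsRing)) _
    (fun t : R_AbsRing => D (scal t v))).
  - apply (@filterdiff_comp' R_AbsRing R_NormedModule U V
     (fun t : R => plus x (scal t v)) f 0 (fun t => scal t v) D).
    + apply is_derive_line.
    + assert (E : plus x (scal (0:R_AbsRing) v) = x).
      { rewrite (@scal_zero_l R_Ring U). apply plus_zero_r. }
      change (filterdiff f (locally (plus x (scal (0:R_AbsRing) v))) D).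
      rewrite E. exact H.
  - intros t. apply linear_scal, HD.
Qed.

Lemma sdiff_unique f x lf lf' v : sdiff f x lf -> sdiff f x lf' -> lf v = lf' v.
Proof.
  intros H H'.
  generalize (filterdiff_is_derive v H) (filterdiff_is_derive v H'). intros A B.
  rewrite <- (is_derive_unique _ _ _ A), <- (is_derive_unique _ _ _ B). reflexivity.
Qed.

Lemma sdiff_pair (V W : NormedModule R_AbsRing) (f : U -> V) (g : U -> W) x lf lg :
  filterdiff f (locally x) lf -> filterdiff g (locally x) lg ->
  filterdiff (fun y => (f y, g y)) (locally x) (fun v => (lf v, lg v)).
Proof.
  intros Hf Hg.
  apply (@filterdiff_comp'_2 R_AbsRing U V W (prod_NormedModule R_AbsRing V W) f g
    (fun a b => (a, b)) x lf lg (fun a b => (a, b)) Hf Hg).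
  pose (VW := prod_NormedModule R_AbsRing V W).
  pose (z := (f x, g x) : VW).
  assert (H : @filterdiff R_AbsRing VW VW (fun t => t) (locally z) (fun t => t))
    by apply filterdiff_id.
  apply (@filterdiff_ext R_AbsRing VW VW _ (locally_Filter (U := VW) z) (fun t => t)).
  - now intros [a b].
  - apply (@filterdiff_ext_lin R_AbsRing VW VW _ (locally_Filter (U := VW) z) _ (fun t => t)).
    + exact H.
    + now intros [a b].
Qed.

Lemma filterdiff_fst (V W : NormedModule R_AbsRing) (f : U -> V * W) x D :
  filterdiff f (locally x) D -> filterdiff (fun y => fst (f y)) (locally x) (fun v => fst (D v)).
Proof.
  intros H. apply (@filterdiff_comp' R_AbsRing U (prod_NormedModule R_AbsRing V W) V f fst x D fst H).
  apply filterdiff_linear, is_linear_fst.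
Qed.

Lemma filterdiff_snd (V W : NormedModule R_AbsRing) (f : U -> V * W) x D :
  filterdiff f (locally x) D -> filterdiff (fun y => snd (f y)) (locally x) (fun v => snd (D v)).
Proof.
  intros H. apply (@filterdiff_comp' R_AbsRing U (prod_NormedModule R_AbsRing V W) W f snd x D snd H).
  apply filterdiff_linear, is_linear_snd.
Qed.

Lemma sdiff_continuous f x l : sdiff f x l -> continuous f x.
Proof.
  intros H. apply (@filterdiff_continuous R_AbsRing U R_NormedModule). now exists l.
Qed.

End Differentials.

Notation R2m := (prod_NormedModule R_AbsRing R_NormedModule R_NormedModule).
Notation R3m := (prod_NormedModule R_AbsRing R2m R_NormedModule).

Lemma continuous_segment (x v : R * R) (t0 : R) :
  @continuous R_UniformSpace R2m (fun t : R => (fst x + t * fst v, snd x + t * snd v)) t0.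
Proof.
  apply (@ex_derive_continuous R_AbsRing R2m). exists v.
  exact (@is_derive_line R2m x v t0).
Qed.

(** * Strands, rectangles and their coordinates *)

(** A class, so that the standing assumptions are supplied by instance resolution. *)
Class good_surgery (S : surgery) : Prop := {
  gs_leg : legendrian_link S;
  gs_pos : good_position S;
  gs_tub : tubular_neighborhoods (eps0 S) (@Phi S);
  gs_eps : 0 < eps S < eps0 S;
  gs_twist : exists delta, 0 < delta /\ twist_profile delta (prof S) /\
      small_delta S (eps S) delta (prof S)
}.

Definition dot2 (u v : R * R) : R := fst u * fst v + snd u * snd v.

Lemma vchord_eq (L : link) (r r' : vchord L) :
  comp_lo r = comp_lo r' -> par_lo r = par_lo r' ->
  comp_hi r = comp_hi r' -> par_hi r = par_hi r' -> r = r'.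
Proof. destruct r, r'; simpl; intros; now subst. Qed.

Section Strands.
Context {S : surgery} {G : good_surgery S}.
Implicit Types (r : vchord S) (b : bool) (X : R * R) (e p q z t : R) (i : comp S).

Definition ctr r : R * R := pi_xy (pt_lo r).
Definition dir r b : R * R := pi_xy (velocity (lam (comp_end r b)) (par_end r b)).
(** Coordinates of a plane point relative to the double point of a chord: on the
    strand of the end [b] the tubular coordinates are [offp] and, up to the
    parameter of the chord end, [offq]. *)
Definition rel r X : R * R := (fst X - fst (ctr r), snd X - snd (ctr r)).
Definition offq r b X : R := dot2 (rel r X) (dir r b).
Definition offp r b X : R := - dot2 (rel r X) (J0 (dir r b)).
(** The sign of the quarter turn between the coordinates of the two strands. *)
Definition kap r b : R := - dot2 (J0 (dir r b)) (dir r (negb b)).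
Definition height r b X : R :=
  c3 (Phi (comp_end r b) (0, offp r b X, par_end r b + offq r b X)).
(** The rectangle of a chord, described symmetrically in its two strands. *)
Definition over e r X : Prop := forall b, Rabs (offq r b X) <= e.

Lemma eps_pos : 0 < eps S. Proof. apply gs_eps. Qed.
Lemma eps_lt : eps S < eps0 S. Proof. apply gs_eps. Qed.
Lemma eps0_pos : 0 < eps0 S. Proof. generalize (@gs_eps S G); lra. Qed.

Lemma Phi_lift i z p q : Rabs z <= eps0 S -> Rabs p <= eps0 S ->
  Phi i (z, p, q) = lift_z z (Phi i (0, p, q)).
Proof. intros; apply gs_tub; split; assumption. Qed.

Lemma Phi_core i q : Phi i (0, 0, q) = lam i q.
Proof. apply gs_tub. Qed.

Lemma Rabs0_le e : 0 <= e -> Rabs 0 <= e.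
Proof. now rewrite Rabs_R0. Qed.

Lemma zero_le_eps0 : Rabs 0 <= eps0 S.
Proof. rewrite Rabs_R0. generalize eps0_pos; lra. Qed.

Lemma Phi_period1 i z p q : Rabs z <= eps0 S -> Rabs p <= eps0 S ->
  Phi i (z, p, q + 1) = Phi i (z, p, q).
Proof. intros; apply gs_tub; split; assumption. Qed.

Lemma Phi_period i z p q (n : Z) : Rabs z <= eps0 S -> Rabs p <= eps0 S ->
  Phi i (z, p, q + IZR n) = Phi i (z, p, q).
Proof.
  intros Hz Hp.
  assert (HN : forall (m : nat) q', Phi i (z, p, q' + INR m) = Phi i (z, p, q')).
  { induction m as [|m IH]; intros q'.
    - simpl; now rewrite Rplus_0_r.
    - rewrite S_INR, <- Rplus_assoc, Phi_period1; auto. }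
  destruct (Z_le_gt_dec 0 n) as [Hn|Hn].
  - rewrite <- (Z2Nat.id n Hn), <- INR_IZR_INZ. apply HN.
  - rewrite <- (HN (Z.to_nat (- n)) (q + IZR n)).
    rewrite INR_IZR_INZ, Z2Nat.id by lia. rewrite opp_IZR.
    do 2 f_equal. ring.
Qed.

Lemma Phi_inj i i' y y' : box (eps0 S) y -> box (eps0 S) y' ->
  Phi i y = Phi i' y' -> i = i' /\ eq_mod_Z y y'.
Proof. intros; now apply gs_tub. Qed.

Lemma strands_meet e i i' p p' q q' : 0 < e < eps0 S -> Rabs p <= e -> Rabs p' <= e ->
  pi_xy (Phi i (0, p, q)) = pi_xy (Phi i' (0, p', q')) ->
  (i = i' /\ eq_mod_Z (0, p, q) (0, p', q')) \/
  exists r b, in_rect e r b i p q /\ in_rect e r (negb b) i' p' q'.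
Proof. intros; now apply gs_tub. Qed.

Lemma ctr_end r b : is_chord r -> pi_xy (lam (comp_end r b) (par_end r b)) = ctr r.
Proof. intros (_ & _ & H & _); destruct b; [symmetry; exact H | reflexivity]. Qed.

Lemma Phi_normal_form r b z p q : is_chord r -> Rabs z <= eps0 S -> Rabs p <= eps0 S ->
  Rabs (q - par_end r b) <= eps0 S ->
  pi_xy (Phi (comp_end r b) (z, p, q)) =
   (fst (ctr r) + (q - par_end r b) * fst (dir r b) + p * snd (dir r b),
    snd (ctr r) + (q - par_end r b) * snd (dir r b) - p * fst (dir r b)).
Proof.
  intros Hr Hz Hp Hq.
  destruct (@gs_tub S G) as (_ & _ & _ & _ & _ & _ & H & _).
  rewrite (H r b z p q Hr (conj Hz Hp) Hq), ctr_end by exact Hr.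
  fold (dir r b). unfold J0. apply pair_eq; simpl; to_R; ring.
Qed.

Lemma dir_unit r b : dot2 (dir r b) (dir r b) = 1.
Proof.
  destruct (@gs_leg S G) as (_ & _ & _ & _ & _ & H).
  rewrite <- (H (comp_end r b) (par_end r b)).
  unfold dot2, dir, c1, c2, pi_xy; simpl. ring.
Qed.

Lemma Derive_locally_const_sum (u v : R -> R) x k s :
  ex_derive u x -> ex_derive v x ->
  locally x (fun t => u t + s * v t = k) -> Derive u x + s * Derive v x = 0.
Proof.
  intros Hu Hv Hk.
  rewrite <- Derive_scal, <- Derive_plus; auto.
  - rewrite (Derive_ext_loc _ (fun _ => k)) by exact Hk. apply Derive_const.
  - apply ex_derive_scal; auto.
Qed.

(** In good position one of c1 + c2, c1 - c2 is constant on the strand near the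
    chord end. *)
Lemma dir_slope r b : is_chord r ->
  fst (dir r b) + (if b then 1 else -1) * snd (dir r b) = 0.
Proof.
  intros Hr.
  destruct (@gs_leg S G) as (_ & Hs & _).
  destruct (Hs (comp_end r b)) as (H1 & H2 & _).
  unfold dir, velocity, pi_xy; simpl.
  destruct (@gs_pos S G r Hr) as (eta & Heta & Hhi & Hlo).
  apply Derive_locally_const_sum
    with (k := c1 (pt_lo r) + (if b then 1 else -1) * c2 (pt_lo r)).
  - exact (H1 1%nat _).
  - exact (H2 1%nat _).
  - exists (mkposreal _ Heta). intros q Hq.
    assert (E : exists s, pi_xy (lam (comp_end r b) q) =
      (c1 (pt_lo r) + s, c2 (pt_lo r) + (if b then -1 else 1) * s)).
    { destruct b.
      - destruct (Hhi q Hq) as [s Es]. exists s. simpl. rewrite Es. f_equal; ring.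
      - destruct (Hlo q Hq) as [s Es]. exists s. simpl. rewrite Es. f_equal; ring. }
    destruct E as [s Es]. unfold c1 at 1, c2 at 1. unfold pi_xy in Es. rewrite Es.
    destruct b; simpl; ring.
Qed.

Local Opaque dir ctr.

Lemma dir_orthogonal r : is_chord r -> dot2 (dir r true) (dir r false) = 0.
Proof.
  intros Hr.
  generalize (dir_slope true Hr) (dir_slope false Hr). unfold dot2; simpl.
  intros H1 H2.
  assert (E1 : fst (dir r true) = - snd (dir r true)) by lra.
  assert (E2 : fst (dir r false) = snd (dir r false)) by lra.
  rewrite E1, E2. ring.
Qed.

Lemma J0_dir r b : is_chord r ->
  J0 (dir r b) = (- kap r b * fst (dir r (negb b)), - kap r b * snd (dir r (negb b))).
Proof.
  intros Hr. generalize (dir_orthogonal Hr) (dir_unit r true) (dir_unit r false).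
  unfold kap, dot2, J0. destruct (dir r true) as [a c] eqn:E, (dir r false) as [a' c'] eqn:E'.
  destruct b; cbn [negb]; rewrite E, E'; cbn [fst snd]; intros H1 H2 H3; f_equal; NsatzTactic.nsatz_default.
Qed.

Lemma kap_sqr r b : is_chord r -> kap r b * kap r b = 1.
Proof.
  intros Hr. generalize (dir_orthogonal Hr) (dir_unit r true) (dir_unit r false).
  unfold kap, dot2, J0. destruct (dir r true) as [a c] eqn:E, (dir r false) as [a' c'] eqn:E'.
  destruct b; cbn [negb]; rewrite E, E'; cbn [fst snd]; intros H1 H2 H3; NsatzTactic.nsatz_default.
Qed.

Lemma kap_cases r b : is_chord r -> kap r b = 1 \/ kap r b = -1.
Proof.
  intros Hr. generalize (kap_sqr b Hr). intros H.
  assert (E : (kap r b - 1) * (kap r b + 1) = 0) by lra.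
  apply Rmult_integral in E. destruct E; [left|right]; lra.
Qed.

Lemma kap_abs r b : is_chord r -> Rabs (kap r b) = 1.
Proof. intros Hr. destruct (kap_cases b Hr) as [-> | ->]; unfold Rabs; destruct Rcase_abs; lra. Qed.

(** The strands are perpendicular: to move across one is to move along the other. *)
Lemma offp_offq r b X : is_chord r -> offp r b X = kap r b * offq r (negb b) X.
Proof.
  intros Hr. unfold offp, offq. rewrite (J0_dir b Hr). unfold dot2; simpl. ring.
Qed.

Lemma offq_offp r b X : is_chord r -> offq r (negb b) X = kap r b * offp r b X.
Proof.
  intros Hr. rewrite offp_offq, <- Rmult_assoc, kap_sqr by exact Hr. ring.
Qed.

Lemma Rabs_offp r b X : is_chord r -> Rabs (offp r b X) = Rabs (offq r (negb b) X).
Proof. intros Hr. rewrite offp_offq, Rabs_mult, kap_abs by exact Hr. ring. Qed.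

Lemma over_offp e r b X : is_chord r -> over e r X -> Rabs (offp r b X) <= e.
Proof. intros Hr HX. rewrite Rabs_offp by exact Hr. apply HX. Qed.

Lemma dir_coordinates r b X :
  (fst (ctr r) + offq r b X * fst (dir r b) + offp r b X * snd (dir r b),
   snd (ctr r) + offq r b X * snd (dir r b) - offp r b X * fst (dir r b)) = X.
Proof.
  generalize (dir_unit r b). unfold offp, offq, rel, J0, dot2.
  destruct X as [x y], (ctr r) as [x0 y0], (dir r b) as [a c]; simpl. intros H.
  apply pair_eq; simpl.
  - transitivity (x0 + (x - x0) * (a * a + c * c)); [ring | rewrite H; ring].
  - transitivity (y0 + (y - y0) * (a * a + c * c)); [ring | rewrite H; ring].
Qed.

Lemma offpq_eq r b p q :
  let X := (fst (ctr r) + q * fst (dir r b) + p * snd (dir r b),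
            snd (ctr r) + q * snd (dir r b) - p * fst (dir r b)) in
  offp r b X = p /\ offq r b X = q.
Proof.
  generalize (dir_unit r b). unfold offp, offq, rel, J0, dot2.
  destruct (ctr r) as [x0 y0], (dir r b) as [a c]; simpl. intros H. split.
  - transitivity (p * (a * a + c * c)); [ring | rewrite H; ring].
  - transitivity (q * (a * a + c * c)); [ring | rewrite H; ring].
Qed.

Lemma plane_point_eq r b X Y : offp r b X = offp r b Y -> offq r b X = offq r b Y -> X = Y.
Proof.
  intros H1 H2. rewrite <- (dir_coordinates r b X), <- (dir_coordinates r b Y), H1, H2.
  reflexivity.
Qed.

(** The normal form inverts the coordinates [offp] and [offq], so over a rectangle
    the strand is a graph. *)
Lemma Phi_over r b X z : is_chord r -> over (eps0 S) r X -> Rabs z <= eps0 S ->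
  Phi (comp_end r b) (z, offp r b X, par_end r b + offq r b X) = (X, height r b X + z).
Proof.
  intros Hr HX Hz. rewrite Phi_lift by (auto using over_offp).
  unfold height.
  assert (E : pi_xy (Phi (comp_end r b) (0, offp r b X, par_end r b + offq r b X)) = X).
  { rewrite Phi_normal_form; auto.
    - replace (par_end r b + offq r b X - par_end r b) with (offq r b X) by ring.
      apply dir_coordinates.
    - apply zero_le_eps0.
    - now apply over_offp.
    - replace (par_end r b + offq r b X - par_end r b) with (offq r b X) by ring. apply HX. }
  unfold pi_xy in E.
  destruct (Phi (comp_end r b) (0, offp r b X, par_end r b + offq r b X)) as [[u v] w].
  unfold lift_z, c1, c2, c3; simpl in *. now subst.
Qed.

Lemma in_rect_over e r b i p q : e <= eps0 S -> in_rect e r b i p q ->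
  i = comp_end r b /\ over e r (pi_xy (Phi i (0, p, q))) /\
  offp r b (pi_xy (Phi i (0, p, q))) = p /\
  exists n : Z, par_end r b + offq r b (pi_xy (Phi i (0, p, q))) = q + IZR n.
Proof.
  intros He (Hr & Hi & Hp & n & Hn).
  assert (H0 := zero_le_eps0).
  rewrite <- (Phi_period i q n) by (auto; lra).
  subst i. rewrite Phi_normal_form by (auto; lra).
  destruct (offpq_eq r b p (q + IZR n - par_end r b)) as [E1 E2].
  cbv zeta in E1, E2.
  split; [reflexivity|]. split; [|split].
  - intros b'. destruct (Bool.bool_dec b b') as [<-|Hb].
    + now rewrite E2.
    + replace b' with (negb b) by (destruct b, b'; simpl; congruence).
      rewrite <- Rabs_offp by exact Hr. now rewrite E1.
  - exact E1.
  - exists n. rewrite E2. ring.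
Qed.

Lemma over_in_rect e r b X q (n : Z) : is_chord r -> over e r X ->
  par_end r b + offq r b X = q + IZR n -> in_rect e r b (comp_end r b) (offp r b X) q.
Proof.
  intros Hr HX E. split; [exact Hr|split; [reflexivity|split]].
  - now apply over_offp.
  - exists n. rewrite <- E.
    replace (par_end r b + offq r b X - par_end r b) with (offq r b X) by ring. apply HX.
Qed.

Lemma is_chord_par r b : is_chord r -> 0 <= par_end r b < 1.
Proof. intros (H1 & H2 & _); destruct b; assumption. Qed.

Lemma ctr_off r b : offp r b (ctr r) = 0 /\ offq r b (ctr r) = 0.
Proof. unfold offp, offq, rel, dot2; simpl. split; ring. Qed.

Lemma is_chord_height r : is_chord r -> height r false (ctr r) < height r true (ctr r).
Proof.
  intros Hr. destruct (Hr) as (_ & _ & _ & H). unfold height.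
  destruct (ctr_off r true) as [-> ->], (ctr_off r false) as [-> ->].
  rewrite !Rplus_0_r, !Phi_core. exact H.
Qed.

(** The normal form reaches up to eps0, so the core is straight beyond the rectangle. *)
Lemma core_line e r b i p q : e < eps0 S -> in_rect e r b i p q -> exists a : R * R,
  forall q1, Rabs (q1 - q) <= eps0 S - e ->
  pi_xy (Phi i (0, 0, q1)) = (fst a + q1 * fst (dir r b), snd a + q1 * snd (dir r b)).
Proof.
  intros He (Hr & -> & _ & n & Hn). pose (m := IZR n - par_end r b).
  exists (fst (ctr r) + m * fst (dir r b), snd (ctr r) + m * snd (dir r b)). intros q1 Hq1.
  rewrite <- (Phi_period _ q1 n), Phi_normal_form by (auto using zero_le_eps0;
    replace (q1 + IZR n - par_end r b) with ((q1 - q) + (q + IZR n - par_end r b)) by ring;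
    generalize (Rabs_triang (q1 - q) (q + IZR n - par_end r b)); lra).
  unfold m; simpl. f_equal; ring.
Qed.

Lemma rect_same_dir e r r' b b' i p q : 0 < e < eps0 S ->
  in_rect e r b i p q -> in_rect e r' b' i p q -> dir r b = dir r' b'.
Proof.
  intros [_ He] HI HI'.
  destruct (core_line He HI) as [a N], (core_line He HI') as [a' N'].
  pose (h := eps0 S - e).
  assert (A0 : Rabs (q - q) <= h) by (rewrite Rminus_diag, Rabs_R0; unfold h; lra).
  assert (A1 : Rabs (q + h - q) <= h).
  { replace (q + h - q) with h by ring. unfold h. rewrite Rabs_right; lra. }
  generalize (N q A0) (N' q A0) (N _ A1) (N' _ A1). intros -> E0 -> E1.
  injection E0; injection E1; intros F1 F2 F3 F4.
  apply pair_eq; apply Rmult_eq_reg_l with h; unfold h in *; lra.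
Qed.

(** Rectangles on one strand do not overlap.  Otherwise both double points lie on
    a straight piece of the strand.  The two strands that cross it there have a
    common point over the midpoint; if they differ, this point lies in a further
    rectangle, in which they would have to be perpendicular, but they are parallel. *)
Lemma rect_unique e r r' b b' i p q : 0 < e < eps0 S ->
  in_rect e r b i p q -> in_rect e r' b' i p q -> r = r' /\ b = b'.
Proof.
  intros He Hin Hin'.
  assert (Hdir := rect_same_dir He Hin Hin').
  destruct (in_rect_over (Rlt_le _ _ (proj2 He)) Hin) as (Ei & HX & Ep & n & En).
  destruct (in_rect_over (Rlt_le _ _ (proj2 He)) Hin') as (Ei' & HX' & Ep' & n' & En').
  destruct Hin as (Hr & _ & Hp & _), Hin' as (Hr' & _ & _ & _).
  set (X := pi_xy (Phi i (0, p, q))) in *.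
  (* Both centers lie on the core of the common strand; 2 s is their signed distance and
     Y their midpoint. *)
  pose (s := (offq r b X - offq r' b' X) / 2).
  assert (Hs : Rabs s <= e).
  { generalize (HX b) (HX' b'). unfold s. intros A B.
    unfold Rabs in *; repeat destruct Rcase_abs; lra. }
  pose (Y := (fst (ctr r) + s * fst (dir r b), snd (ctr r) + s * snd (dir r b))).
  assert (EY : Y = (fst (ctr r') - s * fst (dir r b), snd (ctr r') - s * snd (dir r b))).
  { generalize (dir_coordinates r b X) (dir_coordinates r' b' X).
    rewrite <- Hdir, Ep, Ep'. intros F F'.
    assert (E1 := eq_trans (f_equal fst F) (eq_sym (f_equal fst F'))).
    assert (E2 := eq_trans (f_equal snd F) (eq_sym (f_equal snd F'))).
    cbv [fst snd] in E1, E2. fold (fst (ctr r)) (fst (ctr r')) (fst (dir r b)) in E1.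
    fold (snd (ctr r)) (snd (ctr r')) (snd (dir r b)) in E2.
    unfold Y, s. apply pair_eq; simpl; lra. }
  assert (QY : offq r b Y = s /\ offp r b Y = 0).
  { generalize (offpq_eq r b 0 s). cbv zeta. unfold Y. intros [A B].
    rewrite !Rmult_0_l, Rplus_0_r, Rminus_0_r in A, B. auto. }
  assert (QY' : offq r' b' Y = - s /\ offp r' b' Y = 0).
  { generalize (offpq_eq r' b' 0 (- s)). cbv zeta. rewrite EY, Hdir. intros [A B].
    rewrite !Rmult_0_l, Rplus_0_r, Rminus_0_r, !Ropp_mult_distr_l_reverse in A, B. auto. }
  destruct QY as [QY PY], QY' as [QY' PY'].
  assert (QN : offq r (negb b) Y = 0) by (rewrite offq_offp, PY by exact Hr; ring).
  assert (QN' : offq r' (negb b') Y = 0) by (rewrite offq_offp, PY' by exact Hr'; ring).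
  assert (OY : over e r Y).
  { intros b1. destruct (Bool.bool_dec b b1) as [<-|Hb]; [now rewrite QY|].
    replace b1 with (negb b) by (destruct b, b1; simpl; congruence).
    rewrite QN. apply Rabs0_le; lra. }
  assert (OY' : over e r' Y).
  { intros b1. destruct (Bool.bool_dec b' b1) as [<-|Hb]; [rewrite QY', Rabs_Ropp; auto|].
    replace b1 with (negb b') by (destruct b', b1; simpl; congruence).
    rewrite QN'. apply Rabs0_le; lra. }
  assert (OY0 : over (eps0 S) r Y) by (intros b1; generalize (OY b1); lra).
  assert (OY0' : over (eps0 S) r' Y) by (intros b1; generalize (OY' b1); lra).
  assert (H0 := zero_le_eps0).
  assert (M := Phi_over (negb b) Hr OY0 H0).
  assert (M' := Phi_over (negb b') Hr' OY0' H0).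
  destruct (@strands_meet e (comp_end r (negb b)) (comp_end r' (negb b'))
    (offp r (negb b) Y) (offp r' (negb b') Y)
    (par_end r (negb b) + offq r (negb b) Y) (par_end r' (negb b') + offq r' (negb b') Y) He)
    as [[Ec (_ & _ & m & Em)] | (r2 & b2 & R1 & R2)].
  - now apply over_offp.
  - now apply over_offp.
  - rewrite M, M'. reflexivity.
  - simpl in Em. unfold c3 in Em; simpl in Em. rewrite QN, QN', !Rplus_0_r in Em.
    generalize (is_chord_par (negb b) Hr) (is_chord_par (negb b') Hr'). intros B1 B2.
    assert (m0 : m = 0%Z).
    { assert (-1 < IZR m < 1) by lra.
      assert (-1 < m < 1)%Z by (split; apply lt_IZR; simpl; lra). lia. }
    subst m. rewrite Rplus_0_r in Em.
    assert (Ectr : ctr r = ctr r').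
    { rewrite <- (ctr_end (negb b) Hr), <- (ctr_end (negb b') Hr'), Ec, Em. reflexivity. }
    assert (Es : s = 0).
    { unfold Y in EY. rewrite Ectr in EY. injection EY; intros F1 F2.
      generalize (dir_unit r b). unfold dot2. intros U.
      transitivity (s * (fst (dir r b) * fst (dir r b) + snd (dir r b) * snd (dir r b)));
        [rewrite U; ring|].
      replace (s * (fst (dir r b) * fst (dir r b) + snd (dir r b) * snd (dir r b))) with
        (fst (dir r b) * (s * fst (dir r b)) + snd (dir r b) * (s * snd (dir r b))) by ring.
      replace (s * fst (dir r b)) with 0 by lra.
      replace (s * snd (dir r b)) with 0 by lra. ring. }
    assert (Epar : par_end r b = par_end r' b').
    { generalize (is_chord_par b Hr) (is_chord_par b' Hr'). intros B3 B4.
      assert (Ed : par_end r b - par_end r' b' = IZR (n - n')).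
      { rewrite minus_IZR. unfold s in Es. lra. }
      assert (D0 : (n - n' = 0)%Z).
      { assert (-1 < IZR (n - n') < 1) by lra.
        assert (-1 < n - n' < 1)%Z by (split; apply lt_IZR; simpl; lra). lia. }
      rewrite D0 in Ed. lra. }
    assert (Ecb : comp_end r b = comp_end r' b') by congruence.
    destruct (Bool.bool_dec b b') as [<-|Hb].
    + split; [|reflexivity]. destruct b; simpl in *; apply vchord_eq; auto.
    + exfalso. destruct Hr as (_ & _ & _ & Z1), Hr' as (_ & _ & _ & Z2).
      unfold pt_lo, pt_hi in *.
      assert (Q1 : lam (comp_end r (negb b)) (par_end r (negb b)) =
        lam (comp_end r' (negb b')) (par_end r' (negb b'))) by congruence.
      assert (Q2 : lam (comp_end r b) (par_end r b) =
        lam (comp_end r' b') (par_end r' b')) by congruence.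
      destruct b, b'; simpl in Q1, Q2; try congruence; rewrite Q1, Q2 in Z1; lra.
  - exfalso.
    assert (I1 := over_in_rect (b := negb b) (n := 0%Z) Hr OY (eq_sym (Rplus_0_r _))).
    assert (I2 := over_in_rect (b := negb b') (n := 0%Z) Hr' OY' (eq_sym (Rplus_0_r _))).
    assert (D1 := rect_same_dir He R1 I1).
    assert (D2 := rect_same_dir He R2 I2).
    assert (O1 : dot2 (dir r b) (dir r (negb b)) = 0).
    { generalize (dir_orthogonal Hr). unfold dot2. destruct b; simpl; lra. }
    assert (O2 : dot2 (dir r' b') (dir r' (negb b')) = 0).
    { generalize (dir_orthogonal Hr'). unfold dot2. destruct b'; simpl; lra. }
    assert (O3 : dot2 (dir r2 b2) (dir r2 (negb b2)) = 0).
    { destruct R1 as (Hr2 & _). generalize (dir_orthogonal Hr2). unfold dot2. destruct b2; simpl; lra. }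
    rewrite D1, D2 in O3. rewrite <- Hdir in O2.
    generalize (dir_unit r b) (dir_unit r (negb b)) (dir_unit r' (negb b')).
    revert O1 O2 O3. unfold dot2.
    destruct (dir r b) as [a1 a2], (dir r (negb b)) as [x1 x2], (dir r' (negb b')) as [y1 y2]; simpl.
    intros O1 O2 O3 U1 U2 U3. apply R1_neq_R0. NsatzTactic.nsatz_default.
Qed.

(** A third strand over the point would meet the upper strand of [r] in the rectangle
    of another chord, against [rect_unique]. *)
Lemma overlap_pair e r X i p q : 0 < e < eps0 S -> is_chord r -> over e r X ->
  Rabs p <= e -> pi_xy (Phi i (0, p, q)) = X ->
  exists b, i = comp_end r b /\ offp r b X = p /\
   exists n : Z, par_end r b + offq r b X = q + IZR n.
Proof.
  intros He Hr HX Hp EX.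
  assert (HX0 : over (eps0 S) r X) by (intros b1; generalize (HX b1); lra).
  assert (H0 := zero_le_eps0).
  assert (M := Phi_over true Hr HX0 H0).
  destruct (@strands_meet e (comp_end r true) i (offp r true X) p
     (par_end r true + offq r true X) q He)
    as [[Ec (_ & Ep & m & Em)] | (r2 & b2 & R1 & R2)]; auto.
  - now apply over_offp.
  - rewrite M, EX. reflexivity.
  - exists true. unfold c2, c3 in *; simpl in *. split; [auto|split; [auto|]].
    exists (- m)%Z. rewrite opp_IZR. lra.
  - assert (I1 := over_in_rect (b := true) (n := 0%Z) Hr HX (eq_sym (Rplus_0_r _))).
    destruct (rect_unique He R1 I1) as [-> ->]. simpl in R2.
    exists false. destruct (in_rect_over (Rlt_le _ _ (proj2 He)) R2) as (A & B & C & D).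
    rewrite EX in *. auto.
Qed.

Lemma over_unique e r r' X : 0 < e < eps0 S -> is_chord r -> is_chord r' ->
  over e r X -> over e r' X -> r = r'.
Proof.
  intros He Hr Hr' HX HX'.
  assert (HX0' : over (eps0 S) r' X) by (intros b1; generalize (HX' b1); lra).
  assert (H0 := zero_le_eps0).
  assert (M := Phi_over false Hr' HX0' H0).
  assert (MX : pi_xy (Phi (comp_end r' false) (0, offp r' false X, par_end r' false + offq r' false X)) = X)
    by (rewrite M; reflexivity).
  destruct (overlap_pair He Hr HX (over_offp false Hr' HX') MX) as (b & Ei & Ep & n & En).
  assert (I1 := over_in_rect Hr HX En).
  assert (I2 := over_in_rect (b := false) (n := 0%Z) Hr' HX' (eq_sym (Rplus_0_r _))).
  rewrite Ep, <- Ei in I1. now destruct (rect_unique He I1 I2).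
Qed.

(** The strand is straight on an interval of length 2 eps0 about a chord end, which
    is impossible over a full period. *)
Lemma eps0_lt_half r : is_chord r -> eps0 S < 1 / 2.
Proof.
  intros Hr. destruct (Rlt_or_le (eps0 S) (1 / 2)) as [H|H]; [exact H|exfalso].
  assert (H0 := zero_le_eps0).
  pose (a := par_end r true).
  assert (E1 := @Phi_normal_form r true 0 0 (a - 1 / 2) Hr H0 H0).
  assert (E2 := @Phi_normal_form r true 0 0 (a - 1 / 2 + 1) Hr H0 H0).
  rewrite Phi_period1 in E2 by auto. fold a in E1, E2.
  assert (A1 : Rabs (a - 1 / 2 - a) <= eps0 S) by (unfold Rabs; destruct Rcase_abs; lra).
  assert (A2 : Rabs (a - 1 / 2 + 1 - a) <= eps0 S) by (unfold Rabs; destruct Rcase_abs; lra).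
  specialize (E1 A1); specialize (E2 A2). rewrite E1 in E2.
  injection E2; intros F1 F2.
  assert (D1 : fst (dir r true) = 0) by lra.
  assert (D2 : snd (dir r true) = 0) by lra.
  generalize (dir_unit r true). unfold dot2. rewrite D1, D2. lra.
Qed.

(** The linear parts of [offq] and [offp]. *)
Definition lq r b (w : R * R) : R := dot2 w (dir r b).
Definition lp r b (w : R * R) : R := - dot2 w (J0 (dir r b)).

Lemma lp_lq r b w : is_chord r -> lp r b w = kap r b * lq r (negb b) w.
Proof. intros Hr. unfold lp, lq. rewrite (J0_dir b Hr). unfold dot2; simpl. ring. Qed.

Lemma sdiff_fst (X : R2m) : sdiff (fun Y : R2m => fst Y : R) X (fun w => fst w).
Proof. apply (@filterdiff_linear R_AbsRing R2m R_NormedModule), is_linear_fst. Qed.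

Lemma sdiff_snd (X : R2m) : sdiff (fun Y : R2m => snd Y : R) X (fun w => snd w).
Proof. apply (@filterdiff_linear R_AbsRing R2m R_NormedModule), is_linear_snd. Qed.

Lemma sdiff_rel_dot r (u : R * R) (X : R2m) :
  sdiff (fun Y : R2m => dot2 (rel r Y) u) X (fun w => dot2 w u).
Proof.
  unfold dot2, rel; simpl.
  apply (@sdiff_ext _ (fun Y : R2m => fst u * fst Y + snd u * snd Y -
     (fst u * fst (ctr r) + snd u * snd (ctr r)))).
  { intros Y. destruct Y as [y1 y2]; simpl; ring. }
  apply sdiff_ext_lin with (fun w : R2m => fst u * fst w + snd u * snd w - 0).
  - apply sdiff_minus; [apply sdiff_plus; apply sdiff_scal|apply sdiff_const].
    + apply sdiff_fst.
    + apply sdiff_snd.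
  - intros w. destruct w as [w1 w2]; simpl; ring.
Qed.

Lemma sdiff_offq r b (X : R2m) : sdiff (fun Y : R2m => offq r b Y) X (lq r b).
Proof. apply sdiff_rel_dot. Qed.

Lemma sdiff_offp r b (X : R2m) : sdiff (fun Y : R2m => offp r b Y) X (lp r b).
Proof.
  apply (@sdiff_ext _ (fun Y : R2m => -1 * dot2 (rel r Y) (J0 (dir r b)))).
  { intros Y. unfold offp. ring. }
  apply sdiff_ext_lin with (fun w : R2m => -1 * dot2 w (J0 (dir r b))).
  - apply sdiff_scal, sdiff_rel_dot.
  - intros w. unfold lp. ring.
Qed.

Lemma continuous_lt (U : UniformSpace) (f : U -> R) (x : U) c :
  continuous f x -> f x < c -> locally x (fun y => f y < c).
Proof.
  intros Hf Hc. apply (Hf (fun v => v < c)).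
  exists (mkposreal _ (proj2 (Rlt_0_minus _ _) Hc)). intros v Hv.
  apply Rabs_lt_between in Hv. simpl in Hv. unfold minus, plus, opp in Hv; simpl in Hv. lra.
Qed.

Lemma continuous_gt (U : UniformSpace) (f : U -> R) (x : U) c :
  continuous f x -> c < f x -> locally x (fun y => c < f y).
Proof.
  intros Hf Hc. apply (Hf (fun v => c < v)).
  exists (mkposreal _ (proj2 (Rlt_0_minus _ _) Hc)). intros v Hv.
  apply Rabs_lt_between in Hv. simpl in Hv. unfold minus, plus, opp in Hv; simpl in Hv. lra.
Qed.

Lemma over_locally e r (X : R2m) : (forall b, Rabs (offq r b X) < e) ->
  locally X (fun Y : R2m => forall b, Rabs (offq r b Y) < e).
Proof.
  intros HX.
  assert (K : forall b, locally X (fun Y : R2m => Rabs (offq r b Y) < e)).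
  { intros b. apply (@continuous_lt R2m (fun Y : R2m => Rabs (offq r b Y))); [|apply HX].
    apply (continuous_comp (fun Y : R2m => offq r b Y) Rabs).
    - apply sdiff_continuous with (lq r b), sdiff_offq.
    - apply continuous_Rabs. }
  generalize (filter_and _ _ (K true) (K false)). apply filter_imp.
  intros Y [A B] [|]; assumption.
Qed.

(** Since [Phi] pulls dz - y dx back to dz + p dq, the height of a strand has the
    differential p dq + y dx. *)
Lemma height_differential e r b (X : R2m) : e < eps0 S -> is_chord r -> over e r X ->
  sdiff (fun Y : R2m => height r b Y) X
    (fun w => offp r b X * lq r b w + snd X * fst w).
Proof.
  intros He Hr HX.
  assert (HX0 : over (eps0 S) r X) by (intros b1; generalize (HX b1); lra).
  assert (H0 := zero_le_eps0).
  pose (psi := fun Y : R2m => (0, offp r b Y, par_end r b + offq r b Y) : R3m).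
  assert (Hbox : box (eps0 S) (psi X)).
  { split; [exact H0|]. now apply over_offp. }
  assert (HD : exists D, filterdiff (Phi (comp_end r b)) (locally (psi X)) D /\
    (forall v, alpha_std (Phi (comp_end r b) (psi X)) (D v) = alpha_loc (psi X) v)).
  { destruct (@gs_tub S G) as (_ & _ & _ & H & _).
    destruct (H (comp_end r b) (psi X) Hbox) as (D & HD & _ & Ha). now exists D. }
  destruct HD as (D & HD & Ha).
  assert (Hpsi : @filterdiff R_AbsRing R2m R3m psi (locally X) (fun w => (0, lp r b w, lq r b w))).
  { apply (@sdiff_pair R2m R2m R_NormedModule (fun Y => (0, offp r b Y) : R2m)
      (fun Y => par_end r b + offq r b Y) X (fun w => (0, lp r b w))).
    - apply (@sdiff_pair R2m R_NormedModule R_NormedModule (fun _ => 0) (fun Y => offp r b Y) X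
        (fun _ => 0)).
      + apply sdiff_const.
      + apply sdiff_offp.
    - apply sdiff_ext_lin with (fun w : R2m => 0 + lq r b w).
      + apply (@sdiff_plus R2m (fun _ => par_end r b)); [apply sdiff_const|apply sdiff_offq].
      + intros; apply Rplus_0_l. }
  assert (HC := @filterdiff_comp' R_AbsRing R2m R3m R3m psi (Phi (comp_end r b)) X _ D Hpsi HD).
  pose (Dl := fun w : R2m => D (0, lp r b w, lq r b w)).
  assert (E1 : forall w : R2m, c1 (Dl w) = fst w).
  { intros w. apply (@sdiff_unique R2m (fun Y : R2m => fst Y) X (fun w => c1 (Dl w)) (fun w => fst w));
      [|apply sdiff_fst].
    apply (@filterdiff_ext_locally R_AbsRing R2m R_NormedModule
      (fun Y => c1 (Phi (comp_end r b) (psi Y)))).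
    - assert (HX1 : forall b, Rabs (offq r b X) < eps0 S).
      { intros b1. generalize (HX b1). lra. }
      generalize (over_locally HX1). apply filter_imp. intros Y HY.
      assert (HY' : over (eps0 S) r Y) by (intros b1; apply Rlt_le, HY).
      unfold psi. rewrite (Phi_over b Hr HY' H0). reflexivity.
    - apply (@filterdiff_fst R2m R_NormedModule R_NormedModule).
      apply (@filterdiff_fst R2m R2m R_NormedModule). exact HC. }
  apply sdiff_ext_lin with (fun w => c3 (Dl w)).
  - apply (@filterdiff_snd R2m R2m R_NormedModule). exact HC.
  - intros w. generalize (Ha (0, lp r b w, lq r b w)).
    unfold alpha_std, alpha_loc. fold (Dl w). rewrite E1.
    unfold psi. rewrite (Phi_over b Hr HX0 H0). unfold c1, c2, c3; simpl. lra.
Qed.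

Lemma height_continuous e r b (X : R2m) : e < eps0 S -> is_chord r -> over e r X ->
  continuous (fun Y : R2m => height r b Y) X.
Proof.
  intros He Hr HX. eapply sdiff_continuous, height_differential; eauto.
Qed.

(** Two strands with heights at most 2e apart have a common point in the tubular
    neighborhoods. *)
Lemma gap_apart e r X : 0 < e < eps0 S -> is_chord r -> over e r X ->
  2 * e < Rabs (height r true X - height r false X).
Proof.
  intros He Hr HX.
  destruct (Rlt_or_le (2 * e) (Rabs (height r true X - height r false X))) as [H|H]; [exact H|].
  exfalso.
  pose (z := (height r true X - height r false X) / 2).
  assert (Hz : Rabs z <= eps0 S).
  { unfold z, Rabs in *; repeat destruct Rcase_abs; lra. }
  assert (Hz' : Rabs (- z) <= eps0 S) by now rewrite Rabs_Ropp.
  assert (HX0 : over (eps0 S) r X) by (intros b1; generalize (HX b1); lra).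
  assert (M := Phi_over false Hr HX0 Hz).
  assert (M' := Phi_over true Hr HX0 Hz').
  assert (E : Phi (comp_end r false) (z, offp r false X, par_end r false + offq r false X) =
    Phi (comp_end r true) (- z, offp r true X, par_end r true + offq r true X)).
  { rewrite M, M'. f_equal. unfold z. field. }
  apply Phi_inj in E; [|split; [exact Hz|now apply over_offp]|split; [exact Hz'|now apply over_offp]].
  destruct E as (Ec & _ & Ep & n & En). unfold c2, c3 in Ep, En; simpl in Ep, En.
  assert (I1 := over_in_rect (b := false) (n := 0%Z) Hr HX (eq_sym (Rplus_0_r _))).
  assert (I2 := over_in_rect (b := true) (n := n) Hr HX En).
  rewrite <- Ep in I2. rewrite Ec in I1.
  destruct (rect_unique He I1 I2) as [_ F]. discriminate F.
Qed.

(** The difference of the heights is positive at the double point, and by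
    [gap_apart] it cannot change sign on the way to [X]. *)
Lemma gap e r X : 0 < e < eps0 S -> is_chord r -> over e r X ->
  height r false X + 2 * e < height r true X.
Proof.
  intros He Hr HX.
  pose (w := rel r X).
  pose (Y := fun t : R => (fst (ctr r) + t * fst w, snd (ctr r) + t * snd w)).
  assert (EQ : forall b t, offq r b (Y t) = t * offq r b X).
  { intros b t. unfold offq. replace (rel r (Y t)) with (t * fst w, t * snd w).
    - unfold dot2, w; simpl. ring.
    - unfold rel at 1; unfold Y. apply pair_eq; simpl; ring. }
  assert (OY : forall t, 0 <= t <= 1 -> over e r (Y t)).
  { intros t Ht b. rewrite EQ, Rabs_mult, (Rabs_right t) by lra.
    generalize (HX b) (Rabs_pos (offq r b X)). nra. }
  pose (u := fun t => height r true (Y t) - height r false (Y t)).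
  assert (Cu : forall t, 0 <= t <= 1 -> continuity_pt u t).
  { intros t Ht.
    assert (CY : @continuous R_UniformSpace R2m Y t).
    { exact (@continuous_segment (ctr r) w t). }
    assert (CH : forall b, continuity_pt (fun t => height r b (Y t)) t).
    { intros b. apply continuity_pt_filterlim.
      exact (@continuous_comp R_UniformSpace R2m R_UniformSpace Y
        (fun Z => height r b Z) t CY (@height_continuous e r b (Y t) (proj2 He) Hr (OY t Ht))). }
    exact (continuity_pt_minus _ _ t (CH true) (CH false)). }
  assert (U0 : 2 * e < u 0).
  { assert (Y0 : Y 0 = ctr r) by (unfold Y, w, rel; apply pair_eq; simpl; ring).
    generalize (gap_apart He Hr (OY 0 ltac:(lra))) (is_chord_height Hr).
    unfold u. rewrite Y0. unfold Rabs; destruct Rcase_abs; lra. }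
  assert (UX : u 1 = height r true X - height r false X).
  { assert (Y1 : Y 1 = X) by (unfold Y, w, rel; apply pair_eq; simpl; ring).
    unfold u. now rewrite Y1. }
  destruct (Rlt_or_le (2 * e) (u 1)) as [H|H]; [lra|].
  exfalso.
  generalize (gap_apart He Hr HX). rewrite <- UX. intros A.
  assert (U1 : u 1 < 0) by (revert A; unfold Rabs; destruct Rcase_abs; lra).
  destruct (Ranalysis5.IVT_interv (fun t => - u t) 0 1) as [t [Ht Et]]; try lra.
  - intros t Ht. apply continuity_pt_opp, Cu, Ht.
  - generalize (gap_apart He Hr (OY t Ht)). fold (u t).
    replace (u t) with 0 by lra. rewrite Rabs_R0. lra.
Qed.

End Strands.

(** * The twist functions *)

Lemma zero_derivative_eq (f df : R -> R) a b :
  (forall x, is_derive f x (df x)) ->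
  (forall x, Rmin a b < x < Rmax a b -> df x = 0) -> f a = f b.
Proof.
  intros Hf H0.
  assert (K : forall a b, a < b -> (forall x, a < x < b -> df x = 0) -> f a = f b).
  { clear a b H0; intros a b Hab H0.
    destruct (MVT_cor2 f df a b Hab) as (c & E & Hc).
    - intros; apply is_derive_Reals, Hf.
    - rewrite (H0 c Hc) in E. lra. }
  destruct (Rtotal_order a b) as [H|[-> |H]]; [|reflexivity|symmetry]; apply K; auto;
    intros x Hx; apply H0; unfold Rmin, Rmax; destruct Rle_dec; lra.
Qed.

Section Twist.
Context {S : surgery} {G : good_surgery S}.
Implicit Types (p q : R).

Local Notation f := (prof S).
Local Notation e := (eps S).

Definition feps p : R := f_eps e f p.
Definition heps p : R := H_eps e f p.

Lemma prof_smooth : smooth1 f.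
Proof. destruct (@gs_twist S G) as (d & _ & (H & _) & _). exact H. Qed.

Lemma prof_derive x : is_derive f x (Derive f x).
Proof. apply Derive_correct. exact (prof_smooth 1%nat x). Qed.

Lemma prof_derive_continuous x : continuous (Derive f) x.
Proof. apply (@ex_derive_continuous R_AbsRing R_NormedModule). exact (prof_smooth 2%nat x). Qed.

Lemma prof_derive_bounds x : 0 <= Derive f x <= 1.
Proof. destruct (@gs_twist S G) as (d & _ & (_ & _ & _ & H & _) & _). apply H. Qed.

Lemma prof_derive_even x : Derive f (- x) = Derive f x.
Proof. destruct (@gs_twist S G) as (d & _ & (_ & _ & H & _) & _). apply H. Qed.

Lemma prof_derive_support x : 1 < Rabs x -> Derive f x = 0.
Proof. destruct (@gs_twist S G) as (d & _ & (_ & _ & _ & _ & H & _) & _). apply H. Qed.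

Lemma prof_left x : x <= -1 -> f x = 0.
Proof. destruct (@gs_twist S G) as (d & _ & (_ & H & _) & _). apply H. Qed.

Lemma prof_1 : f 1 = 1.
Proof.
  destruct (@gs_twist S G) as (d & _ & (_ & _ & _ & _ & _ & H & _) & _).
  assert (E : is_RInt (Derive f) (-1) 1 (minus (f 1) (f (-1)))).
  { apply (@is_RInt_derive R_CompleteNormedModule); intros; [apply prof_derive|apply prof_derive_continuous]. }
  apply (@is_RInt_unique R_CompleteNormedModule) in H, E. rewrite E in H.
  rewrite (prof_left (x := -1)) in H by lra. revert H. to_R. intros H. lra.
Qed.

Lemma prof_right x : 1 <= x -> f x = 1.
Proof.
  intros Hx. rewrite <- prof_1. symmetry. apply zero_derivative_eq with (Derive f).
  - apply prof_derive.
  - intros y Hy. apply prof_derive_support. rewrite Rmin_left, Rmax_right in Hy by lra.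
    rewrite Rabs_right; lra.
Qed.

(** Since f' is even, f(x) + f(-x) is constant. *)
Lemma prof_0 : f 0 = 1 / 2.
Proof.
  assert (E : (fun x => f x + f (- x)) 0 = (fun x => f x + f (- x)) 1).
  { apply (@zero_derivative_eq (fun x => f x + f (- x)) (fun x => Derive f x - Derive f (- x))).
    - intros x. auto_derive.
      + split; [|split; [|exact I]]; eexists; apply prof_derive.
      + change (fun x0 : R => f x0) with f. ring.
    - intros x _. rewrite prof_derive_even. ring. }
  simpl in E. rewrite prof_1, Ropp_0, (prof_left (x := Ropp 1)) in E by lra. lra.
Qed.

Lemma feps_derive p : is_derive feps p (Derive f (p / e) / e).
Proof.
  unfold feps, f_eps. generalize eps_pos; intros He0.
  replace (Derive f (p / e) / e) with (scal (/ e) (Derive f (p / e))) by (to_R; field; lra).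
  apply (is_derive_comp f (fun p => p / e)); [apply prof_derive|].
  auto_derive; [exact I|]. field; lra.
Qed.

Lemma feps_continuous p : continuous feps p.
Proof. apply (@ex_derive_continuous R_AbsRing R_NormedModule). eexists; apply feps_derive. Qed.

Lemma feps_left p : p <= - e -> feps p = 0.
Proof.
  intros H. generalize eps_pos; intros He0. apply prof_left.
  apply Rmult_le_reg_r with e; [lra|]. unfold Rdiv. rewrite Rmult_assoc, Rinv_l by lra. lra.
Qed.

Lemma feps_right p : e <= p -> feps p = 1.
Proof.
  intros H. generalize eps_pos; intros He0. apply prof_right.
  apply Rmult_le_reg_r with e; [lra|]. unfold Rdiv. rewrite Rmult_assoc, Rinv_l by lra. lra.
Qed.

Lemma feps_le p p' : p <= p' -> feps p <= feps p'.
Proof.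
  intros [H| ->]; [|lra].
  destruct (MVT_cor2 feps (fun p => Derive f (p / e) / e) p p' H) as (c & E & Hc).
  - intros; apply is_derive_Reals, feps_derive.
  - generalize (prof_derive_bounds (c / e)) eps_pos. intros B He0.
    assert (0 <= Derive f (c / e) / e) by (apply Rdiv_le_0_compat; lra). nra.
Qed.

Lemma feps_bounds p : 0 <= feps p <= 1.
Proof.
  generalize eps_pos; intros He0. split.
  - destruct (Rle_or_lt p (- e)) as [H|H].
    + rewrite feps_left; lra.
    + rewrite <- (feps_left (p := - e)) by lra. apply feps_le; lra.
  - destruct (Rle_or_lt e p) as [H|H].
    + rewrite feps_right; lra.
    + rewrite <- (feps_right (p := e)) by lra. apply feps_le; lra.
Qed.

Lemma feps_integer p : e <= Rabs p -> exists n : Z, feps p = IZR n.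
Proof.
  intros H. unfold Rabs in H. destruct (Rcase_abs p).
  - exists 0%Z. apply feps_left. lra.
  - exists 1%Z. apply feps_right. lra.
Qed.

Lemma feps_affine delta p : twist_profile delta f -> Rabs (p / e) <= (1 - delta) / 2 ->
  feps p = 1 / 2 + p / e.
Proof.
  intros (_ & _ & _ & _ & _ & _ & H) Hp. unfold feps, f_eps.
  assert (E : (fun x => f x - x) 0 = (fun x => f x - x) (p / e)).
  { apply (@zero_derivative_eq (fun x => f x - x) (fun x => Derive f x - 1)).
    - intros x. auto_derive; [eexists; apply prof_derive|].
      change (fun x0 : R => f x0) with f. ring.
    - intros x Hx. rewrite H; [ring|]. revert Hp Hx. unfold Rabs, Rmin, Rmax.
      repeat destruct Rcase_abs; destruct Rle_dec; lra. }
  simpl in E. rewrite prof_0 in E. lra.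
Qed.

Let g P := P * Derive feps P.

Lemma Derive_feps p : Derive feps p = Derive f (p / e) / e.
Proof. apply is_derive_unique, feps_derive. Qed.

Lemma g_continuous p : continuous g p.
Proof.
  unfold g. apply (continuous_ext (fun P => P * (Derive f (P / e) * / e))).
  - intros; now rewrite Derive_feps.
  - apply (continuous_mult (fun P : R => P)); [apply continuous_id|].
    apply (continuous_mult (fun P : R => Derive f (P / e)) (fun _ => / e)); [|apply continuous_const].
    apply (continuous_comp (fun P : R => P / e)); [|apply prof_derive_continuous].
    apply (continuous_mult (fun P : R => P) (fun _ => / e)); [apply continuous_id|apply continuous_const].
Qed.

Lemma g_support p : e < Rabs p -> g p = 0.
Proof.
  intros Hp. generalize eps_pos; intros He0. unfold g. rewrite Derive_feps, prof_derive_support.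
  - unfold Rdiv; ring.
  - unfold Rdiv. rewrite Rabs_mult, (Rabs_right (/ e)).
    + apply Rmult_lt_reg_r with e; [lra|]. rewrite Rmult_assoc, Rinv_l by lra. lra.
    + apply Rle_ge, Rlt_le, Rinv_0_lt_compat; lra.
Qed.

Lemma heps_RInt p : heps p = RInt g (- e) p.
Proof.
  generalize eps_pos; intros He0.
  unfold heps, H_eps. apply is_RInt_gen_unique.
  intros P HP. unfold filtermapi.
  apply (Filter_prod _ _ _ (fun a => a < - e) (fun b => b = p)).
  - exists (- e). auto.
  - reflexivity.
  - intros a b Ha ->. simpl. exists (RInt g (- e) p).
    split; [|exact (locally_singleton _ _ HP)].
    replace (RInt g (- e) p) with (0 + RInt g (- e) p) by ring.
    apply (@is_RInt_Chasles R_NormedModule g a (- e) p 0 (RInt g (- e) p)).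
    + apply (@is_RInt_ext R_NormedModule (fun _ => 0)).
      * rewrite Rmin_left, Rmax_right by lra. intros x Hx. symmetry. apply g_support.
        rewrite Rabs_left; lra.
      * generalize (@is_RInt_const R_NormedModule a (- e) 0).
        change (scal (- e - a) (0 : R_NormedModule)) with ((- e - a) * 0).
        now rewrite Rmult_0_r.
    + apply (@RInt_correct R_CompleteNormedModule), (@ex_RInt_continuous R_CompleteNormedModule).
      intros; apply g_continuous.
Qed.

Lemma heps_derive p : is_derive heps p (p * Derive feps p).
Proof.
  apply (is_derive_ext (fun p => RInt g (- e) p)); [intros; now rewrite heps_RInt|].
  apply (@is_derive_RInt R_CompleteNormedModule g (RInt g (- e)) (- e)); [|apply g_continuous].
  exists (mkposreal 1 Rlt_0_1). intros y _.
  apply (@RInt_correct R_CompleteNormedModule), (@ex_RInt_continuous R_CompleteNormedModule).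
  intros; apply g_continuous.
Qed.

Lemma heps_start : heps (- e) = 0.
Proof. rewrite heps_RInt. apply (@RInt_point R_CompleteNormedModule). Qed.

Lemma heps_even p : heps (- p) = heps p.
Proof.
  assert (E : (fun p => heps p - heps (- p)) 0 = (fun p => heps p - heps (- p)) p).
  { apply (@zero_derivative_eq (fun p => heps p - heps (- p))
      (fun p => p * Derive feps p + (- p) * Derive feps (- p))).
    - intros x. auto_derive.
      + split; [|split; [|exact I]]; eexists; apply heps_derive.
      + change (fun x0 : R => heps x0) with heps. rewrite !(is_derive_unique _ _ _ (heps_derive _)). ring.
    - intros x _. rewrite !Derive_feps. replace (- x / e) with (- (x / e)) by (unfold Rdiv; ring).
      rewrite prof_derive_even. unfold Rdiv; ring. }
  simpl in E. rewrite Ropp_0 in E. lra.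
Qed.

Lemma heps_outside p : e <= Rabs p -> heps p = 0.
Proof.
  generalize eps_pos; intros He0.
  assert (K : forall p, p <= - e -> heps p = 0).
  { intros p' Hp. rewrite <- heps_start.
    apply zero_derivative_eq with (fun p => p * Derive feps p); [apply heps_derive|].
    rewrite Rmin_left, Rmax_right by lra. intros x Hx. apply g_support. rewrite Rabs_left; lra. }
  unfold Rabs. destruct (Rcase_abs p); intros H; [|rewrite <- heps_even]; apply K; lra.
Qed.

(** H_eps vanishes at distance eps from 0, and its slope is less than
    1 in absolute value on the way. *)
Lemma heps_bound p : Rabs (heps p) < e.
Proof.
  generalize eps_pos; intros He0.
  assert (K : forall p, p <= 0 -> Rabs (heps p) < e).
  { intros p' Hp. destruct (Rle_or_lt p' (- e)) as [H|H].
    - rewrite heps_outside by (unfold Rabs; destruct Rcase_abs; lra). now rewrite Rabs_R0.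
    - destruct (MVT_cor2 heps g (- e) p' H) as (c & E & Hc).
      + intros; apply is_derive_Reals, heps_derive.
      + rewrite heps_start, Rminus_0_r in E. rewrite E, Rabs_mult.
        rewrite (Rabs_right (p' - - e)) by lra.
        assert (B : Rabs (g c) < 1).
        { unfold g. rewrite Derive_feps. generalize (prof_derive_bounds (c / e)). intros B.
          assert (Hc' : Rabs c < e) by (unfold Rabs; destruct Rcase_abs; lra).
          set (d := Derive f (c / e)) in *.
          rewrite Rabs_mult, (Rabs_right (d / e)) by (apply Rle_ge, Rdiv_le_0_compat; lra).
          apply Rmult_lt_reg_r with e; [lra|].
          replace (Rabs c * (d / e) * e) with (Rabs c * d) by (field; lra).
          generalize (Rabs_pos c). nra. }
        generalize (Rabs_pos (g c)). nra. }
  destruct (Rle_or_lt p 0) as [H|H]; [auto|]. rewrite <- heps_even. apply K; lra.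
Qed.

End Twist.

Arguments feps S p : clear implicits.
Arguments heps S p : clear implicits.

(** * The surgered manifold *)

Definition raise (t : R) (y : R3) : R3 := (c1 y + t, c2 y, c3 y).

Lemma lift_lift a b x : lift_z a (lift_z b x) = lift_z (b + a) x.
Proof. unfold lift_z, c1, c2, c3; simpl. now rewrite Rplus_assoc. Qed.

Lemma lift_0 x : lift_z 0 x = x.
Proof. destruct x as [[a b] c]; unfold lift_z, c1, c2, c3; simpl. now rewrite Rplus_0_r. Qed.

Lemma lift_swap t x x' : lift_z t x = x' -> x = lift_z (- t) x'.
Proof. intros <-. rewrite lift_lift, Rplus_opp_r. now rewrite lift_0. Qed.

Lemma raise_raise a b y : raise a (raise b y) = raise (b + a) y.
Proof. unfold raise, c1, c2, c3; simpl. now rewrite Rplus_assoc. Qed.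

Lemma raise_0 y : raise 0 y = y.
Proof. destruct y as [[a b] c]; unfold raise, c1, c2, c3; simpl. now rewrite Rplus_0_r. Qed.

Lemma eq_mod_Z_refl y : eq_mod_Z y y.
Proof. split; [|split]; auto. exists 0%Z. ring. Qed.

Lemma eq_mod_Z_sym y y' : eq_mod_Z y y' -> eq_mod_Z y' y.
Proof.
  intros (A & B & n & C). split; [|split]; auto. exists (- n)%Z. rewrite C, opp_IZR. ring.
Qed.

Lemma eq_mod_Z_trans y y' y'' : eq_mod_Z y y' -> eq_mod_Z y' y'' -> eq_mod_Z y y''.
Proof.
  intros (A & B & n & C) (A' & B' & n' & C'). split; [|split]; try congruence.
  exists (n + n')%Z. rewrite C', C, plus_IZR. ring.
Qed.

Lemma eq_mod_Z_raise t y y' : eq_mod_Z y y' -> eq_mod_Z (raise t y) (raise t y').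
Proof.
  intros (A & B & n & C). split; [|split]; unfold raise, c1, c2, c3 in *; simpl; try congruence.
  now exists n.
Qed.

Section Surgered.
Context {S : surgery} {G : good_surgery S}.
Implicit Types (i : comp S) (x y : R3) (z p q t : R) (P Q : surgered S) (u v : prepoint S).

Local Notation e := (eps S).

(** The twist moves the level z = [ceil i p] to z = eps, so this is the top of the
    core. *)
Definition ceil i p : R := e + IZR (coef i) * heps S p.

Lemma coef_H i p : Rabs (IZR (coef i) * heps S p) < e.
Proof.
  generalize (heps_bound p) (Rabs_pos (heps S p)). intros B C.
  destruct (@gs_leg S G) as (Hc & _). rewrite Rabs_mult.
  destruct (Hc i) as [-> |[-> | ->]].
  - rewrite Rabs_R1; lra.
  - rewrite Rabs_R0; lra.
  - rewrite (Rabs_left (-1)) by lra. lra.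
Qed.

Lemma ceil_bounds i p : 0 < ceil i p < 2 * e.
Proof.
  unfold ceil. generalize (coef_H i p). intros B. apply Rabs_lt_between in B. lra.
Qed.

Lemma ceil_wide i p : e <= Rabs p -> ceil i p = e.
Proof. intros H. unfold ceil. rewrite heps_outside by exact H. ring. Qed.

Lemma handle_coreE i z p q :
  handle_core i (z, p, q) <-> Rabs p <= e /\ - e <= z <= ceil i p.
Proof. reflexivity. Qed.

Lemma handle_chartE i z p q :
  handle_chart i (z, p, q) <->
  coef i <> 0%Z /\ Rabs p < eps0 S /\ - eps0 S < z < eps0 S - e + ceil i p.
Proof.
  unfold handle_chart, ceil; simpl. unfold c1, c2, heps; simpl. fold e.
  split; intros (A & B & C); repeat split; auto; try lra.
Qed.

Lemma not_core i z p q : ~ handle_core i (z, p, q) <-> e < Rabs p \/ z < - e \/ ceil i p < z.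
Proof.
  rewrite handle_coreE. split.
  - intros H. destruct (Rle_or_lt (Rabs p) e); [|now left]. right.
    destruct (Rle_or_lt (- e) z); [|now left]. right.
    destruct (Rle_or_lt z (ceil i p)); [|assumption]. exfalso; auto.
  - intros [H|[H|H]] (A & B); lra.
Qed.

Lemma glue_mapE i z p q :
  glue_map i (z, p, q) = if Rle_dec z 0 then (z, p, q)
    else (z - IZR (coef i) * heps S p, p, q + IZR (coef i) * feps S p).
Proof. reflexivity. Qed.

Lemma glue_low i z p q : z <= 0 -> glue_map i (z, p, q) = (z, p, q).
Proof. intros H. rewrite glue_mapE. destruct Rle_dec; [reflexivity|contradiction]. Qed.

Lemma glue_high i z p q : 0 < z ->
  glue_map i (z, p, q) = (z - IZR (coef i) * heps S p, p, q + IZR (coef i) * feps S p).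
Proof. intros H. rewrite glue_mapE. destruct Rle_dec; [lra|reflexivity]. Qed.

Local Opaque glue_map.

Lemma glue_box i z p q : handle_chart i (z, p, q) -> ~ handle_core i (z, p, q) ->
  box (eps0 S) (glue_map i (z, p, q)) /\ ~ box e (glue_map i (z, p, q)).
Proof.
  rewrite handle_chartE, not_core. intros (Hc & Hp & Hz) Hn.
  generalize (eps_lt (S := S)) (eps_pos (S := S)) (ceil_bounds i p). intros B1 B2 B3.
  destruct (Rle_or_lt z 0) as [H|H].
  - rewrite glue_low by exact H. unfold box, c1, c2; simpl. split.
    + split; [|lra]. apply Rabs_le; lra.
    + intros [A B]. apply Rabs_le_between in A. destruct Hn as [Hn|[Hn|Hn]]; lra.
  - rewrite glue_high by exact H. unfold box, c1, c2; simpl.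
    destruct (Rle_or_lt (Rabs p) e) as [H1|H1].
    + destruct Hn as [Hn|[Hn|Hn]]; [lra|lra|]. unfold ceil in *. split.
      * split; [|lra]. apply Rabs_le; lra.
      * intros [A B]. apply Rabs_le_between in A. lra.
    + rewrite (ceil_wide i (p := p)) in * by lra. rewrite heps_outside by lra.
      split; [split|intros [A B]; lra]; [|lra].
      apply Rabs_le; lra.
Qed.

Lemma Phi_glue_low i z p q : handle_chart i (z, p, q) -> z <= 0 ->
  Phi i (glue_map i (z, p, q)) = lift_z z (Phi i (0, p, q)).
Proof.
  rewrite handle_chartE. intros (Hc & Hp & Hz) H. rewrite glue_low by exact H.
  apply Phi_lift; [apply Rabs_le|]; lra.
Qed.

Lemma Phi_glue_high i z p q : handle_chart i (z, p, q) -> ~ handle_core i (z, p, q) -> 0 < z ->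
  Phi i (glue_map i (z, p, q)) =
  lift_z (z - IZR (coef i) * heps S p) (Phi i (0, p, q + IZR (coef i) * feps S p)).
Proof.
  intros H1 H2 H. generalize (proj1 (glue_box H1 H2)). rewrite glue_high by exact H.
  intros [A B]. apply Phi_lift; assumption.
Qed.

(** Beside the core the twist is a whole number of turns, so the change of formula
    of [glue_map] at z = 0 is invisible in the ambient space. *)
Lemma Phi_glue_wide i z p q : handle_chart i (z, p, q) -> e < Rabs p ->
  Phi i (glue_map i (z, p, q)) = lift_z z (Phi i (0, p, q)).
Proof.
  intros H1 Hp. destruct (Rle_or_lt z 0) as [H|H].
  - now apply Phi_glue_low.
  - rewrite Phi_glue_high; [|exact H1|rewrite not_core; auto|exact H].
    rewrite heps_outside by lra. destruct (feps_integer (Rlt_le _ _ Hp)) as [n En].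
    rewrite Rmult_0_r, En, <- mult_IZR, Phi_period.
    + f_equal; ring.
    + apply zero_le_eps0.
    + apply handle_chartE in H1. lra.
Qed.

Lemma Phi_glue_period i y y' : handle_chart i y -> ~ handle_core i y -> eq_mod_Z y y' ->
  Phi i (glue_map i y) = Phi i (glue_map i y').
Proof.
  destruct y as [[z p] q], y' as [[z' p'] q']. intros H1 H2 (A & B & n & C).
  unfold c1, c2, c3 in A, B, C; simpl in A, B, C. subst z' p' q'.
  generalize (proj1 (glue_box H1 H2)).
  destruct (Rle_or_lt z 0) as [H|H].
  - rewrite !glue_low by exact H. intros [B1 B2]. symmetry. now apply Phi_period.
  - rewrite !glue_high by exact H. intros [B1 B2]. symmetry.
    replace (q + IZR n + IZR (coef i) * feps S p) with (q + IZR (coef i) * feps S p + IZR n) by ring.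
    now apply Phi_period.
Qed.

(** The formula for z <= 0 keeps heights nonpositive; the other one yields positive
    heights outside the core, as H_eps vanishes beside it. *)
Lemma glue_map_inj i y y' : handle_chart i y -> handle_chart i y' ->
  ~ handle_core i y -> ~ handle_core i y' ->
  eq_mod_Z (glue_map i y) (glue_map i y') -> eq_mod_Z y y'.
Proof.
  destruct y as [[z p] q], y' as [[z' p'] q']. intros H1 H1' H2 H2' E.
  rewrite not_core in H2, H2'.
  generalize (ceil_bounds i p) (ceil_bounds i p'). unfold ceil in *. intros B B'.
  destruct (Rle_or_lt z 0) as [H|H], (Rle_or_lt z' 0) as [H'|H'];
    try rewrite (@glue_low i z p q H) in E; try rewrite (@glue_high i z p q H) in E;
    try rewrite (@glue_low i z' p' q' H') in E; try rewrite (@glue_high i z' p' q' H') in E;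
    destruct E as (A1 & A2 & n & A3); cbv [c1 c2 c3 fst snd] in A1, A2, A3; subst p'.
  - split; [|split]; [exact A1|reflexivity|]. now exists n.
  - destruct (Rle_or_lt (Rabs p) e) as [Hp|Hp]; [lra|].
    rewrite (heps_outside (p := p)) in A1 by lra. lra.
  - destruct (Rle_or_lt (Rabs p) e) as [Hp|Hp]; [lra|].
    rewrite (heps_outside (p := p)) in A1 by lra. lra.
  - split; [|split]; cbv [c1 c2 c3 fst snd]; [lra|reflexivity|]. exists n. lra.
Qed.

Lemma glue_outside i y : handle_chart i y -> ~ handle_core i y -> outside S (Phi i (glue_map i y)).
Proof.
  destruct y as [[z p] q]. intros H1 H2 j y' Hj Hy' E.
  destruct (glue_box H1 H2) as [B1 B2].
  assert (Hy0 : box (eps0 S) y').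
  { generalize (eps_lt (S := S)). destruct Hy'; split; lra. }
  destruct (Phi_inj B1 Hy0 E) as [<- (A & B & _)].
  apply B2. unfold box in *. now rewrite A, B.
Qed.

Lemma handle_core_mod i y y' : eq_mod_Z y y' -> handle_core i y -> handle_core i y'.
Proof. intros (A & B & _) H. unfold handle_core in *. now rewrite <- A, <- B. Qed.

Lemma glued_refl u : glued u u.
Proof. destruct u; simpl; auto using eq_mod_Z_refl. Qed.

Lemma glued_sym u v : glued u v -> glued v u.
Proof.
  destruct u, v; simpl; auto. intros [<- H]. split; [reflexivity|]. now apply eq_mod_Z_sym.
Qed.

(** The chain inside, outside, inside is the essential case: it needs that [Phi] and
    [glue_map] are injective modulo Z. *)
Lemma glued_trans u v w : in_chart u -> in_chart v -> in_chart w ->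
  glued u v -> glued v w -> glued u w.
Proof.
  destruct u as [x|i y], v as [x'|i' y'], w as [x''|i'' y'']; simpl; intros C1 C2 C3.
  - congruence.
  - intros ->. auto.
  - intros [N ->] [_ ->]. reflexivity.
  - intros [N ->] [<- E].
    assert (N' : ~ handle_core i' y'').
    { intros H; apply N, (handle_core_mod (eq_mod_Z_sym E) H). }
    split; [exact N'|]. now apply Phi_glue_period.
  - intros [N E] ->. auto.
  - intros [N ->] [N' E].
    destruct y as [[z p] q], y'' as [[z' p'] q'].
    destruct (Phi_inj (proj1 (glue_box C1 N)) (proj1 (glue_box C3 N')) E) as [-> E'].
    split; [reflexivity|]. now apply glue_map_inj with i''.
  - intros [<- E] [N ->].
    assert (N' : ~ handle_core i y).
    { intros H; apply N, (handle_core_mod E H). }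
    split; [exact N'|]. symmetry. now apply Phi_glue_period.
  - intros [<- E] [<- E']. split; [reflexivity|]. eapply eq_mod_Z_trans; eauto.
Qed.

Lemma rep_in_chart P u : rep P u -> in_chart u.
Proof. destruct P as [C (u0 & H0 & ->)]. intros [H _]. exact H. Qed.

Lemma rep_glued P u v : rep P u -> rep P v -> glued u v.
Proof.
  destruct P as [C (u0 & H0 & ->)]. unfold rep; simpl. intros [H1 H2] [H3 H4].
  apply glued_trans with u0; auto. now apply glued_sym.
Qed.

Lemma rep_transfer P u v : rep P u -> in_chart v -> glued u v -> rep P v.
Proof.
  destruct P as [C (u0 & H0 & ->)]. unfold rep; simpl. intros [H1 H2] H3 H4.
  split; [exact H3|]. now apply glued_trans with u.
Qed.

Lemma rep_eq P Q u : rep P u -> rep Q u -> P = Q.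
Proof.
  intros HP HQ.
  assert (K : forall v, rep P v <-> rep Q v).
  { intros v. split; intros H.
    - apply rep_transfer with u; [exact HQ|now apply rep_in_chart with P|now apply rep_glued with P].
    - apply rep_transfer with u; [exact HP|now apply rep_in_chart with Q|now apply rep_glued with Q]. }
  destruct P as [C HC], Q as [D HD]. unfold rep in K; simpl in K.
  apply subset_eq_compat. apply functional_extensionality. intros v.
  apply propositional_extensionality, K.
Qed.

Lemma rep_exists u : in_chart u -> exists P, rep P u.
Proof.
  intros H. exists (exist _ (point_class u) (ex_intro _ u (conj H eq_refl))).
  split; [exact H|apply glued_refl].
Qed.

Lemma rep_Inside_mod P i y y' : eq_mod_Z y y' -> rep P (Inside i y) -> rep P (Inside i y').
Proof.
  intros E H. apply rep_transfer with (Inside i y); auto.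
  - generalize (rep_in_chart H). destruct E as (A & B & _). simpl.
    unfold handle_chart. now rewrite A, B.
  - split; [reflexivity|exact E].
Qed.

Lemma rep_Outside_inj P x x' : rep P (Outside x) -> rep P (Outside x') -> x = x'.
Proof. intros H H'. exact (rep_glued H H'). Qed.

Lemma rep_mixed P i y x : rep P (Inside i y) -> rep P (Outside x) ->
  ~ handle_core i y /\ x = Phi i (glue_map i y).
Proof. intros H H'. exact (rep_glued H H'). Qed.

Lemma rep_Outside_glue P i y : rep P (Inside i y) -> ~ handle_core i y ->
  rep P (Outside (Phi i (glue_map i y))).
Proof.
  intros H N. apply rep_transfer with (Inside i y); auto.
  - apply glue_outside; auto. exact (rep_in_chart H).
  - split; auto.
Qed.

Lemma rep_Inside_glue P i y : rep P (Outside (Phi i (glue_map i y))) -> handle_chart i y ->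
  ~ handle_core i y -> rep P (Inside i y).
Proof.
  intros H C N. apply rep_transfer with (Outside (Phi i (glue_map i y))); auto. split; auto.
Qed.

(** Along a vertical line that avoids the core the two formulas of [glue_map] cannot
    both be in use, except beside the core, where they agree modulo Z. *)
Lemma glue_shift i y t : handle_chart i y -> handle_chart i (raise t y) ->
  (forall s, Rmin 0 t <= s <= Rmax 0 t -> ~ handle_core i (raise s y)) ->
  Phi i (glue_map i (raise t y)) = lift_z t (Phi i (glue_map i y)).
Proof.
  destruct y as [[z p] q]. unfold raise, c1, c2, c3; simpl. intros C C' N.
  assert (N0 := N 0 ltac:(split; [apply Rmin_l|apply Rmax_l])).
  assert (N1 := N t ltac:(split; [apply Rmin_r|apply Rmax_r])).
  rewrite Rplus_0_r in N0.
  destruct (Rlt_or_le e (Rabs p)) as [Hp|Hp].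
  - rewrite !Phi_glue_wide, lift_lift by assumption. reflexivity.
  - generalize (ceil_bounds i p) (eps_pos (S := S)); intros B1 B2.
    assert (M0 := proj1 (not_core _ _ _ _) N0). assert (M1 := proj1 (not_core _ _ _ _) N1).
    destruct M0 as [M0|[M0|M0]]; [lra| |]; destruct M1 as [M1|[M1|M1]]; [lra| | |lra| |].
    + rewrite !Phi_glue_low by (assumption || lra). now rewrite lift_lift.
    + exfalso. apply (N (- e - z)).
      * rewrite Rmin_left, Rmax_right by lra. lra.
      * apply handle_coreE. split; [exact Hp|]. lra.
    + exfalso. apply (N (- e - z)).
      * rewrite Rmin_right, Rmax_left by lra. lra.
      * apply handle_coreE. split; [exact Hp|]. lra.
    + rewrite !Phi_glue_high by (assumption || lra). rewrite lift_lift. f_equal. ring.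
Qed.

Lemma handle_chart_open i y : handle_chart i y ->
  exists eta, 0 < eta /\ forall t, Rabs t < eta -> handle_chart i (raise t y).
Proof.
  destruct y as [[z p] q]. rewrite handle_chartE. intros (Hc & Hp & Hz).
  exists (Rmin (z + eps0 S) (eps0 S - e + ceil i p - z)). split.
  - apply Rmin_glb_lt; lra.
  - intros t Ht. unfold raise, c1, c2, c3; simpl. rewrite handle_chartE.
    destruct (Rmin_lt Ht) as [A B].
    apply Rabs_lt_between in A. apply Rabs_lt_between in B.
    repeat split; auto; lra.
Qed.

Lemma not_core_open i y : ~ handle_core i y ->
  exists eta, 0 < eta /\ forall t, Rabs t < eta -> ~ handle_core i (raise t y).
Proof.
  destruct y as [[z p] q]. rewrite not_core. unfold raise, c1, c2, c3; simpl. intros [H|[H|H]].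
  - exists 1. split; [lra|]. intros t _. rewrite not_core. auto.
  - exists (- e - z). split; [lra|]. intros t Ht. apply Rabs_lt_between in Ht.
    rewrite not_core. lra.
  - exists (z - ceil i p). split; [lra|]. intros t Ht. apply Rabs_lt_between in Ht.
    rewrite not_core. lra.
Qed.

(** Both charts are open in the vertical direction and glued by a map that commutes
    with vertical translations, by [glue_shift]. *)
Lemma transition_local P i x y : rep P (Outside x) -> rep P (Inside i y) ->
  exists eta, 0 < eta /\ forall t, Rabs t < eta -> forall Q,
    rep Q (Outside (lift_z t x)) <-> rep Q (Inside i (raise t y)).
Proof.
  intros H1 H2. destruct (rep_mixed H2 H1) as [N ->].
  assert (C := rep_in_chart H2). simpl in C.
  destruct (handle_chart_open C) as (e1 & He1 & K1).
  destruct (not_core_open N) as (e2 & He2 & K2).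
  exists (Rmin e1 e2). split; [now apply Rmin_glb_lt|]. intros t Ht Q.
  destruct (Rmin_lt Ht) as [A B].
  assert (E : Phi i (glue_map i (raise t y)) = lift_z t (Phi i (glue_map i y))).
  { apply glue_shift; auto. intros s Hs. apply K2.
    eapply Rle_lt_trans; [|exact B]. revert Hs. unfold Rmin, Rmax, Rabs.
    destruct Rle_dec, Rcase_abs, Rcase_abs; lra. }
  rewrite <- E. split; intros H.
  - apply rep_Inside_glue; auto.
  - apply rep_Outside_glue; auto.
Qed.

(** The space is Hausdorff along vertical lines: a limit point of the line can fail to
    be glued only if it lies in the core, and the core is entered from below
    through its bottom. *)
Lemma transition_limit i x y eta : 0 < eta -> handle_chart i y ->
  (forall t, - eta < t < 0 -> ~ handle_core i (raise t y) /\
     lift_z t x = Phi i (glue_map i (raise t y))) ->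
  (~ handle_core i y /\ x = Phi i (glue_map i y)) \/
  (c1 y = - e /\ Rabs (c2 y) <= e /\ x = Phi i y).
Proof.
  intros Heta C K.
  destruct (handle_chart_open C) as (e1 & He1 & K1).
  destruct (classic (handle_core i y)) as [HC|N].
  - right. destruct y as [[z p] q]. assert (HC' := proj1 (handle_coreE _ _ _ _) HC).
    destruct HC' as [Hp Hz].
    assert (K' : forall t, - eta < t < 0 -> ~ handle_core i (z + t, p, q) /\
      lift_z t x = Phi i (glue_map i (z + t, p, q))) by exact K.
    assert (K1' : forall t, Rabs t < e1 -> handle_chart i (z + t, p, q)) by exact K1.
    clear K K1. change (c1 (z, p, q)) with z. change (c2 (z, p, q)) with p.
    generalize (ceil_bounds i p) (eps_pos (S := S)) (eps_lt (S := S)); intros B1 B2 B3.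
    assert (Ez : z = - e).
    { destruct (Rle_lt_or_eq_dec (- e) z) as [H|H]; [lra| |lra]. exfalso.
      pose (t := - Rmin (eta / 2) (z + e)).
      assert (Ht : 0 < Rmin (eta / 2) (z + e)) by (apply Rmin_glb_lt; lra).
      generalize (Rmin_l (eta / 2) (z + e)) (Rmin_r (eta / 2) (z + e)). intros T1 T2.
      destruct (K' t) as [Kt _]; [unfold t; lra|]. apply Kt, handle_coreE. unfold t. lra. }
    split; [exact Ez|split; [exact Hp|]]. subst z.
    pose (t := - Rmin (eta / 2) (e1 / 2)).
    assert (Ht : 0 < Rmin (eta / 2) (e1 / 2)) by (apply Rmin_glb_lt; lra).
    generalize (Rmin_l (eta / 2) (e1 / 2)) (Rmin_r (eta / 2) (e1 / 2)). intros T1 T2.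
    destruct (K' t) as [_ Kt]; [unfold t; lra|].
    rewrite Phi_glue_low in Kt; [| |unfold t; lra].
    + apply lift_swap in Kt. rewrite Kt, lift_lift, (Phi_lift i (z := - e)).
      * f_equal. ring.
      * apply Rabs_le; lra.
      * lra.
    + apply K1'. unfold t. rewrite Rabs_Ropp, Rabs_right; lra.
  - left. split; [exact N|].
    destruct (not_core_open N) as (e2 & He2 & K2).
    pose (d := Rmin eta (Rmin e1 e2)).
    assert (Hd : 0 < d) by (repeat apply Rmin_glb_lt; lra).
    assert (D1 : d <= eta) by apply Rmin_l.
    assert (D2 : d <= e1) by (eapply Rle_trans; [apply Rmin_r|apply Rmin_l]).
    assert (D3 : d <= e2) by (eapply Rle_trans; [apply Rmin_r|apply Rmin_r]).
    destruct (K (- (d / 2))) as [_ Kt]; [lra|].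
    rewrite glue_shift in Kt; auto.
    + apply lift_swap in Kt. rewrite Kt, lift_lift, Rplus_opp_r. apply lift_0.
    + apply K1. rewrite Rabs_Ropp, Rabs_right; lra.
    + intros s Hs. apply K2. rewrite Rmin_right, Rmax_left in Hs by lra. apply Rabs_lt_between. lra.
Qed.

End Surgered.

(** * Trajectories are vertical *)

Lemma lift_eq t (x : R3) : lift_z t x = @plus R3m x (scal t ((0, 0, 1) : R3m)).
Proof.
  destruct x as [[a b] c]. unfold lift_z, c1, c2, c3; simpl.
  apply pair_eq; [apply pair_eq|]; simpl; to_R; ring.
Qed.

Lemma raise_eq t (y : R3) : raise t y = @plus R3m y (scal t ((1, 0, 0) : R3m)).
Proof.
  destruct y as [[a b] c]. unfold raise, c1, c2, c3; simpl.
  apply pair_eq; [apply pair_eq|]; simpl; to_R; ring.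
Qed.

(** x(s) - s v has derivative zero. *)
Lemma constant_velocity (x : R -> R3m) (v : R3m) a b :
  (forall s, Rmin a b <= s <= Rmax a b -> is_derive x s v) -> x b = plus (x a) (scal (b - a) v).
Proof.
  intros H.
  pose (y := fun s : R => minus (x s) (scal s v)).
  assert (K : forall s, Rmin a b <= s <= Rmax a b -> is_derive y s (@zero R3m)).
  { intros s Hs.
    assert (Z : @minus R3m v v = @zero R3m) by apply (@minus_eq_zero R3m). rewrite <- Z.
    apply (@is_derive_minus R_AbsRing R3m); [apply H, Hs|].
    apply (is_derive_ext (fun t => plus (@zero R3m) (scal t v))).
    - intros t. apply (@plus_zero_l R3m).
    - apply (@is_derive_line R3m). }
  assert (E : y a = y b).
  { destruct (Rtotal_order a b) as [h|[-> |h]]; [|reflexivity|symmetry];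
    apply (@eq_is_derive R3m); auto; intros t Ht; apply K; unfold Rmin, Rmax;
    destruct Rle_dec; lra. }
  revert E. unfold y. intros E.
  assert (E2 : x b = plus (minus (x a) (scal a v)) (scal b v)).
  { rewrite E. unfold minus. rewrite <- plus_assoc, plus_opp_l. symmetry; apply plus_zero_r. }
  rewrite E2. destruct (x a) as [[u1 u2] u3], v as [[v1 v2] v3].
  apply pair_eq; [apply pair_eq|]; simpl; to_R; ring.
Qed.

Lemma Derive_affine a k : Derive (fun t => a + t * k) 0 = k.
Proof. apply is_derive_unique. auto_derive; [exact I|ring]. Qed.

Lemma d_alpha_std (x u v : R3) : d_form alpha_std x u v = c2 v * c1 u - c2 u * c1 v.
Proof.
  assert (K : forall u v, dir_deriv u (fun x' => alpha_std x' v) x = - (c2 u * c1 v)).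
  { intros [[u1 u2] u3] [[v1 v2] v3]. destruct x as [[x1 x2] x3].
    unfold dir_deriv, alpha_std. rewrite <- (@Derive_affine (v3 - x2 * v1)).
    apply Derive_ext. intros t. unfold c1, c2, c3; simpl. to_R. ring. }
  unfold d_form. rewrite !K. ring.
Qed.

Lemma d_alpha_loc (x u v : R3) : d_form alpha_loc x u v = c2 u * c3 v - c2 v * c3 u.
Proof.
  assert (K : forall u v, dir_deriv u (fun x' => alpha_loc x' v) x = c2 u * c3 v).
  { intros [[u1 u2] u3] [[v1 v2] v3]. destruct x as [[x1 x2] x3].
    unfold dir_deriv, alpha_loc. rewrite <- (@Derive_affine (v1 + x2 * v3)).
    apply Derive_ext. intros t. unfold c1, c2, c3; simpl. to_R. ring. }
  unfold d_form. rewrite !K. ring.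
Qed.

Lemma Reeb_std x v : is_Reeb_vector alpha_std x v <-> v = (0, 0, 1).
Proof.
  unfold is_Reeb_vector. destruct v as [[v1 v2] v3]. split.
  - intros [A B].
    assert (B1 := B (1, 0, 0)). assert (B2 := B (0, 1, 0)).
    rewrite d_alpha_std in B1, B2. unfold alpha_std, c1, c2, c3 in *; simpl in *.
    assert (v1 = 0) by lra. assert (v2 = 0) by lra. subst.
    apply pair_eq; [reflexivity|simpl; lra].
  - intros E; injection E; intros -> -> ->. split.
    + unfold alpha_std, c1, c2, c3; simpl. ring.
    + intros u. rewrite d_alpha_std. unfold c1, c2; simpl. ring.
Qed.

Lemma Reeb_loc x v : is_Reeb_vector alpha_loc x v <-> v = (1, 0, 0).
Proof.
  unfold is_Reeb_vector. destruct v as [[v1 v2] v3]. split.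
  - intros [A B].
    assert (B1 := B (0, 1, 0)). assert (B2 := B (0, 0, 1)).
    rewrite d_alpha_loc in B1, B2. unfold alpha_loc, c1, c2, c3 in *; simpl in *.
    assert (v3 = 0) by lra. assert (v2 = 0) by lra. subst.
    apply pair_eq; [apply pair_eq; simpl; lra|reflexivity].
  - intros E; injection E; intros -> -> ->. split.
    + unfold alpha_loc, c1, c2, c3; simpl. ring.
    + intros u. rewrite d_alpha_loc. unfold c2, c3; simpl. ring.
Qed.

Section Trajectories.
Context {S : surgery} {G : good_surgery S}.
Implicit Types (i : comp S) (x y : R3) (z p q t T : R) (P Q : surgered S) (g : R -> surgered S).

Local Notation e := (eps S).

Definition germ (chart : R3 -> prepoint S) (shift : R -> R3 -> R3) g T t : Prop :=
  exists x eta, 0 < eta /\ forall s, 0 <= s <= T -> Rabs (s - t) < eta ->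
    rep (g s) (chart (shift (s - t) x)).

Definition vertical g T t : Prop :=
  germ Outside lift_z g T t \/ exists i, germ (Inside i) raise g T t.

(** The Reeb field is constant in each chart, so its integral curves are lines. *)
Lemma chart_germ (a : form) (chart : R3 -> prepoint S) (shift : R -> R3 -> R3) (v0 : R3) g T t :
  (forall x v, is_Reeb_vector a x v <-> v = v0) ->
  (forall t x, shift t x = @plus R3m x (scal t (v0 : R3m))) ->
  0 <= t <= T -> (Reeb_in_chart a chart g T t <-> germ chart shift g T t).
Proof.
  intros Ha Hs Ht. split.
  - intros (x & eta & Heta & H). exists (x t), eta. split; [exact Heta|].
    intros s Hs1 Hs2. rewrite Hs.
    assert (E : x s = @plus R3m (x t) (scal (s - t) (v0 : R3m))).
    { apply constant_velocity. intros s' Hs'.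
      destruct (H s') as [_ (v & Hv & Hr)].
      - revert Hs'. unfold Rmin, Rmax. destruct Rle_dec; lra.
      - revert Hs' Hs2. unfold Rmin, Rmax, Rabs. destruct Rle_dec, Rcase_abs, Rcase_abs; lra.
      - rewrite Ha in Hr. subst v. exact Hv. }
    rewrite <- E. now apply H.
  - intros (x & eta & Heta & H). exists (fun s => shift (s - t) x), eta.
    split; [exact Heta|]. intros s Hs1 Hs2. split; [now apply H|].
    exists v0. split; [|now rewrite Ha].
    apply (is_derive_ext (fun s => @plus R3m (shift (- t) x) (scal s (v0 : R3m)))).
    + intros s'. rewrite !Hs. destruct x as [[x1 x2] x3], v0 as [[v1 v2] v3].
      apply pair_eq; [apply pair_eq|]; simpl; to_R; ring.
    + apply (@is_derive_line R3m).
Qed.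

Lemma trajectory_vertical T g : Reeb_trajectory T g <-> forall t, 0 <= t <= T -> vertical g T t.
Proof.
  assert (KO : forall t, 0 <= t <= T ->
    (Reeb_in_chart alpha_std Outside g T t <-> germ Outside lift_z g T t)).
  { intros t Ht. apply chart_germ with (0, 0, 1); auto using Reeb_std, lift_eq. }
  assert (KI : forall i t, 0 <= t <= T ->
    (Reeb_in_chart alpha_loc (Inside i) g T t <-> germ (Inside i) raise g T t)).
  { intros i t Ht. apply chart_germ with (1, 0, 0); auto using Reeb_loc, raise_eq. }
  split; intros H t Ht; (destruct (H t Ht) as [H1|[i H1]]; [left|right; exists i]);
    first [now apply KO | now apply KI].
Qed.

(** The supremum of the times up to which [A] holds is reached, and is [b]. *)
Lemma real_induction (A : R -> Prop) a b : a <= b -> A a ->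
  (forall t, a <= t < b -> A t -> exists eta, 0 < eta /\ forall s, t < s < t + eta -> s <= b -> A s) ->
  (forall t, a < t <= b -> (forall s, a <= s < t -> A s) -> A t) ->
  forall t, a <= t <= b -> A t.
Proof.
  intros Hab Ha Hr Hl.
  pose (E := fun t => a <= t <= b /\ forall s, a <= s <= t -> A s).
  assert (Ea : E a).
  { split; [lra|]. intros s Hs. replace s with a by lra. exact Ha. }
  destruct (completeness E) as [m [Hm1 Hm2]].
  - exists b. intros t [Ht _]; lra.
  - now exists a.
  - assert (Hma : a <= m) by (apply Hm1, Ea).
    assert (Hmb : m <= b) by (apply Hm2; intros t [Ht _]; lra).
    assert (Am : forall s, a <= s < m -> A s).
    { intros s Hs. destruct (classic (exists t, E t /\ s < t)) as [(t & [_ Ht] & Hst)|N].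
      - apply Ht; lra.
      - exfalso. apply (Rlt_not_le m s); [lra|]. apply Hm2. intros t Ht.
        destruct (Rle_or_lt t s); [assumption|]. exfalso; apply N; now exists t. }
    assert (Em : E m).
    { split; [lra|]. intros s Hs. destruct (Rle_lt_or_eq_dec s m) as [H|H]; [lra|apply Am; lra|].
      subst s. destruct (Rle_lt_or_eq_dec a m Hma) as [H| <-]; [apply Hl; auto; lra|exact Ha]. }
    destruct (Rle_lt_or_eq_dec m b Hmb) as [H| <-].
    + exfalso. destruct Em as [_ Em]. destruct (Hr m) as (eta & Heta & K); [lra|apply Em; lra|].
      pose (s := Rmin b (m + eta / 2)).
      assert (Hs : m < s) by (apply Rmin_glb_lt; lra).
      assert (S1 : s <= b) by apply Rmin_l. assert (S2 : s <= m + eta / 2) by apply Rmin_r.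
      apply (Rlt_not_le s m Hs). apply Hm1. split; [lra|].
      intros s' Hs'. destruct (Rle_or_lt s' m); [apply Em; lra|apply K; lra].
    + intros t Ht. apply Em; lra.
Qed.

Lemma germ_at chart shift g T t x eta :
  (forall x, shift 0 x = x) -> 0 <= t <= T -> 0 < eta ->
  (forall s, 0 <= s <= T -> Rabs (s - t) < eta -> rep (g s) (chart (shift (s - t) x))) ->
  rep (g t) (chart x).
Proof.
  intros H0 Ht He H. rewrite <- (H0 x). replace 0 with (t - t) by ring. apply H; auto.
  rewrite Rminus_diag, Rabs_R0. exact He.
Qed.

Lemma follow_Outside T g t x : Reeb_trajectory T g -> 0 <= t <= T -> rep (g t) (Outside x) ->
  exists eta, 0 < eta /\ forall s, 0 <= s <= T -> Rabs (s - t) < eta ->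
    rep (g s) (Outside (lift_z (s - t) x)).
Proof.
  rewrite trajectory_vertical. intros H Ht Hx.
  destruct (H t Ht) as [(x' & eta & He & K)|(i & y & eta & He & K)].
  - assert (E := germ_at lift_0 Ht He K). rewrite (rep_Outside_inj Hx E). now exists eta.
  - assert (E := germ_at raise_0 Ht He K).
    destruct (transition_local Hx E) as (e' & He' & K').
    exists (Rmin eta e'). split; [now apply Rmin_glb_lt|]. intros s Hs1 Hs2.
    apply K'; [eapply Rlt_le_trans; [exact Hs2|apply Rmin_r]|].
    apply K; [exact Hs1|eapply Rlt_le_trans; [exact Hs2|apply Rmin_l]].
Qed.

Lemma follow_Inside T g t i y : Reeb_trajectory T g -> 0 <= t <= T -> rep (g t) (Inside i y) ->
  exists eta, 0 < eta /\ forall s, 0 <= s <= T -> Rabs (s - t) < eta ->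
    rep (g s) (Inside i (raise (s - t) y)).
Proof.
  rewrite trajectory_vertical. intros H Ht Hy.
  destruct (H t Ht) as [(x' & eta & He & K)|(i' & y' & eta & He & K)].
  - assert (E := germ_at lift_0 Ht He K).
    destruct (transition_local E Hy) as (e' & He' & K').
    exists (Rmin eta e'). split; [now apply Rmin_glb_lt|]. intros s Hs1 Hs2.
    apply K'; [eapply Rlt_le_trans; [exact Hs2|apply Rmin_r]|].
    apply K; [exact Hs1|eapply Rlt_le_trans; [exact Hs2|apply Rmin_l]].
  - assert (E := germ_at raise_0 Ht He K). destruct (rep_glued E Hy) as [-> M].
    exists eta. split; [exact He|]. intros s Hs1 Hs2.
    apply rep_Inside_mod with (raise (s - t) y'); [now apply eq_mod_Z_raise|]. now apply K.
Qed.

(** Continuation in time.  At a limit time the trajectory cannot be in the outside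
    chart only, as [transition_limit] would put a point of the core outside. *)
Lemma inside_run T g t0 t1 i y : Reeb_trajectory T g -> 0 <= t0 -> t0 <= t1 <= T ->
  rep (g t0) (Inside i y) -> (forall s, 0 <= s <= t1 - t0 -> handle_chart i (raise s y)) ->
  forall t, t0 <= t <= t1 -> rep (g t) (Inside i (raise (t - t0) y)).
Proof.
  intros HT H0 H1 Hy HC.
  apply (@real_induction (fun t => rep (g t) (Inside i (raise (t - t0) y))) t0 t1).
  - lra.
  - now rewrite Rminus_diag, raise_0.
  - intros t Ht Et. destruct (follow_Inside HT (t := t) (y := raise (t - t0) y)
      ltac:(lra) Et) as (eta & He & K).
    exists eta. split; [exact He|]. intros s Hs1 Hs2.
    replace (s - t0) with ((t - t0) + (s - t)) by ring. rewrite <- raise_raise.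
    apply K; [lra|]. rewrite Rabs_right; lra.
  - intros t Ht Hs. assert (HC' : handle_chart i (raise (t - t0) y)) by (apply HC; lra).
    assert (HV := HT). rewrite trajectory_vertical in HV.
    destruct (HV t ltac:(lra)) as [(x' & eta & He & K)|(i' & y' & eta & He & K)].
    + pose (d := Rmin eta (t - t0)).
      assert (Hd : 0 < d) by (apply Rmin_glb_lt; lra).
      assert (D1 : d <= eta) by apply Rmin_l. assert (D2 : d <= t - t0) by apply Rmin_r.
      assert (Ex := germ_at lift_0 (ltac:(lra) : 0 <= t <= T) He K).
      destruct (transition_limit (x := x') Hd HC') as [[N E]|(E1 & E2 & E)].
      * intros s Hs'. rewrite raise_raise.
        assert (A : rep (g (t + s)) (Inside i (raise (t - t0 + s) y))).
        { replace (t - t0 + s) with (t + s - t0) by ring. apply Hs; lra. }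
        assert (B : rep (g (t + s)) (Outside (lift_z s x'))).
        { replace s with (t + s - t) at 2 by ring. apply K; [lra|].
          rewrite Rabs_left; lra. }
        exact (rep_mixed A B).
      * apply rep_Inside_glue; auto. now rewrite <- E.
      * exfalso. assert (O := rep_in_chart Ex). simpl in O.
        apply (O i (raise (t - t0) y)); [|split|exact E].
        -- apply HC'.
        -- rewrite E1, Rabs_Ropp, Rabs_right; generalize (eps_pos (S := S)); lra.
        -- exact E2.
    + pose (d := Rmin eta (t - t0)).
      assert (Hd : 0 < d) by (apply Rmin_glb_lt; lra).
      assert (D1 : d <= eta) by apply Rmin_l. assert (D2 : d <= t - t0) by apply Rmin_r.
      assert (Ey := germ_at raise_0 (ltac:(lra) : 0 <= t <= T) He K).
      assert (A := K (t - d / 2) ltac:(lra)).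
      replace (t - d / 2 - t) with (- (d / 2)) in A by ring.
      rewrite Rabs_Ropp, Rabs_right in A by lra. specialize (A ltac:(lra)).
      destruct (rep_glued A (Hs (t - d / 2) ltac:(lra))) as [-> M].
      apply rep_Inside_mod with y'; [|exact Ey].
      apply (eq_mod_Z_raise (d / 2)) in M. rewrite !raise_raise in M.
      replace (- (d / 2) + d / 2) with 0 in M by ring. rewrite raise_0 in M.
      replace (t - d / 2 - t0 + d / 2) with (t - t0) in M by ring. exact M.
Qed.

(** Continuation in time; by [transition_limit] it stops only at the bottom of a
    core. *)
Lemma outside_run T g t0 t1 x : Reeb_trajectory T g -> 0 <= t0 < t1 -> t1 <= T ->
  (forall t, t0 < t <= t1 -> rep (g t) (Outside (lift_z (t - t0) x))) ->
  (forall t, t0 < t <= T -> rep (g t) (Outside (lift_z (t - t0) x))) \/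
  exists t i p q, t1 < t <= T /\
    (forall s, t0 < s < t -> rep (g s) (Outside (lift_z (s - t0) x))) /\
    rep (g t) (Inside i (- e, p, q)) /\ Rabs p <= e /\
    lift_z (t - t0) x = Phi i (- e, p, q).
Proof.
  intros HT H0 H1 Hx.
  match goal with |- _ \/ ?B => destruct (classic B) as [HB|HB]; [now right|left] end.
  intros t Ht. destruct (Rle_or_lt t t1) as [H|H]; [apply Hx; lra|].
  revert t Ht H.
  cut (forall t, t1 <= t <= T -> rep (g t) (Outside (lift_z (t - t0) x))).
  { intros K t Ht H. apply K; lra. }
  apply real_induction.
  - exact H1.
  - apply Hx; lra.
  - intros t Ht Et. destruct (follow_Outside HT (t := t) (x := lift_z (t - t0) x)
      ltac:(lra) Et) as (eta & He & K).
    exists eta. split; [exact He|]. intros s Hs1 Hs2.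
    replace (s - t0) with ((t - t0) + (s - t)) by ring. rewrite <- lift_lift.
    apply K; [lra|]. rewrite Rabs_right; lra.
  - intros t Ht Hs. assert (HV := HT). rewrite trajectory_vertical in HV.
    pose (x' := lift_z (t - t0) x).
    destruct (HV t ltac:(lra)) as [(x2 & eta & He & K)|(i & y & eta & He & K)].
    + pose (d := Rmin eta (t - t1)).
      assert (Hd : 0 < d) by (apply Rmin_glb_lt; lra).
      assert (D1 : d <= eta) by apply Rmin_l. assert (D2 : d <= t - t1) by apply Rmin_r.
      assert (Ex := germ_at lift_0 (ltac:(lra) : 0 <= t <= T) He K).
      assert (A := K (t - d / 2) ltac:(lra)).
      replace (t - d / 2 - t) with (- (d / 2)) in A by ring.
      rewrite Rabs_Ropp, Rabs_right in A by lra. specialize (A ltac:(lra)).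
      assert (M := rep_Outside_inj A (Hs (t - d / 2) ltac:(lra))).
      apply lift_swap in M. rewrite lift_lift in M.
      replace (t - d / 2 - t0 + - - (d / 2)) with (t - t0) in M by ring.
      rewrite <- M. exact Ex.
    + pose (d := Rmin eta (t - t1)).
      assert (Hd : 0 < d) by (apply Rmin_glb_lt; lra).
      assert (D1 : d <= eta) by apply Rmin_l. assert (D2 : d <= t - t1) by apply Rmin_r.
      assert (Ey := germ_at raise_0 (ltac:(lra) : 0 <= t <= T) He K).
      assert (HC := rep_in_chart Ey). simpl in HC.
      destruct (transition_limit (x := x') Hd HC) as [[N E]|(E1 & E2 & E)].
      * intros s Hs'. unfold x'. rewrite lift_lift.
        assert (A : rep (g (t + s)) (Outside (lift_z (t - t0 + s) x))).
        { replace (t - t0 + s) with (t + s - t0) by ring. apply Hs; lra. }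
        assert (B : rep (g (t + s)) (Inside i (raise s y))).
        { replace s with (t + s - t) at 2 by ring. apply K; [lra|].
          rewrite Rabs_left; lra. }
        exact (rep_mixed B A).
      * fold x'. rewrite E. now apply rep_Outside_glue.
      * exfalso. apply HB. destruct y as [[z p] q]. unfold c1, c2 in E1, E2; simpl in E1, E2.
        subst z. exists t, i, p, q. repeat split; try lra; auto.
        intros s Hs'. destruct (Rle_or_lt s t1); [apply Hx; lra|apply Hs; lra].
Qed.

Definition join_at (T1 : R) (g1 g2 : R -> surgered S) : R -> surgered S :=
  fun t => if Rle_dec t T1 then g1 t else g2 (t - T1).

Lemma join_left T1 g1 g2 t : t <= T1 -> join_at T1 g1 g2 t = g1 t.
Proof. intros H. unfold join_at. destruct Rle_dec; [reflexivity|contradiction]. Qed.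

Lemma join_right T1 g1 g2 t : g1 T1 = g2 0 -> T1 <= t -> join_at T1 g1 g2 t = g2 (t - T1).
Proof.
  intros E H. unfold join_at. destruct Rle_dec as [H'|]; [|reflexivity].
  replace t with T1 by lra. now rewrite Rminus_diag.
Qed.

(** At the junction both paths are read in the chart of the first one. *)
Lemma join_trajectory T1 T2 g1 g2 : 0 <= T1 -> 0 <= T2 ->
  Reeb_trajectory T1 g1 -> Reeb_trajectory T2 g2 ->
  g1 T1 = g2 0 -> Reeb_trajectory (T1 + T2) (join_at T1 g1 g2).
Proof.
  intros P1 P2 H1 H2 E. apply trajectory_vertical. intros t Ht.
  assert (V1 := proj1 (trajectory_vertical _ _) H1).
  assert (V2 := proj1 (trajectory_vertical _ _) H2).
  assert (KG : forall chart shift, t < T1 -> germ chart shift g1 T1 t ->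
    germ chart shift (join_at T1 g1 g2) (T1 + T2) t).
  { intros chart shift H (x & eta & He & K). exists x, (Rmin eta (T1 - t)).
    split; [apply Rmin_glb_lt; lra|]. intros s Hs1 Hs2.
    destruct (Rmin_lt Hs2) as [A B]. apply Rabs_lt_between in B.
    rewrite join_left by lra. apply K; [lra|exact A]. }
  assert (KG2 : forall chart shift, T1 < t -> germ chart shift g2 T2 (t - T1) ->
    germ chart shift (join_at T1 g1 g2) (T1 + T2) t).
  { intros chart shift H (x & eta & He & K). exists x, (Rmin eta (t - T1)).
    split; [apply Rmin_glb_lt; lra|]. intros s Hs1 Hs2.
    destruct (Rmin_lt Hs2) as [A B]. apply Rabs_lt_between in B.
    rewrite join_right by (auto; lra). replace (s - t) with (s - T1 - (t - T1)) by ring.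
    apply K; [lra|]. replace (s - T1 - (t - T1)) with (s - t) by ring. exact A. }
  destruct (Rtotal_order t T1) as [H|[H|H]].
  - destruct (V1 t ltac:(lra)) as [K|[i K]]; [left|right; exists i]; auto.
  - subst t.
    assert (KM : forall chart shift eta1 eta2 x, 0 < eta1 -> 0 < eta2 ->
      (forall s, 0 <= s <= T1 -> Rabs (s - T1) < eta1 -> rep (g1 s) (chart (shift (s - T1) x))) ->
      (forall s, 0 <= s <= T2 -> Rabs (s - 0) < eta2 -> rep (g2 s) (chart (shift (s - 0) x))) ->
      germ chart shift (join_at T1 g1 g2) (T1 + T2) T1).
    { intros chart shift eta1 eta2 x He1 He2 K1 K2. exists x, (Rmin eta1 eta2).
      split; [now apply Rmin_glb_lt|]. intros s Hs1 Hs2.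
      destruct (Rmin_lt Hs2) as [A B].
      destruct (Rle_or_lt s T1).
      - rewrite join_left by lra. apply K1; [lra|exact A].
      - rewrite join_right by (auto; lra). replace (s - T1) with (s - T1 - 0) at 2 by ring.
        apply K2; [lra|]. now rewrite Rminus_0_r. }
    destruct (V1 T1 ltac:(lra)) as [(x & eta & He & K)|(i & y & eta & He & K)].
    + left. assert (Ex := germ_at lift_0 (ltac:(lra) : 0 <= T1 <= T1) He K). rewrite E in Ex.
      destruct (follow_Outside H2 (ltac:(lra) : 0 <= 0 <= T2) Ex) as (eta2 & He2 & K2).
      eapply KM; [| |exact K|exact K2]; assumption.
    + right; exists i. assert (Ex := germ_at raise_0 (ltac:(lra) : 0 <= T1 <= T1) He K). rewrite E in Ex.
      destruct (follow_Inside H2 (ltac:(lra) : 0 <= 0 <= T2) Ex) as (eta2 & He2 & K2).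
      eapply KM; [| |exact K|exact K2]; assumption.
  - destruct (V2 (t - T1) ltac:(lra)) as [K|[i K]]; [left|right; exists i]; auto.
Qed.

Lemma Reeb_flow_trans T1 T2 P Q Q' : 0 <= T1 -> 0 <= T2 ->
  Reeb_flow T1 P Q -> Reeb_flow T2 Q Q' -> Reeb_flow (T1 + T2) P Q'.
Proof.
  intros H1 H2 (g1 & K1 & A1 & B1) (g2 & K2 & A2 & B2).
  assert (E : g1 T1 = g2 0) by congruence.
  exists (join_at T1 g1 g2). split; [|split].
  - now apply join_trajectory.
  - now rewrite join_left.
  - rewrite join_right by (auto; lra). now replace (T1 + T2 - T1) with T2 by ring.
Qed.

End Trajectories.

(** * Words and their orbits in the plane *)

Section Orbits.
Context {S : surgery} {G : good_surgery S}.
Implicit Types (r : vchord S) (b : bool) (X : R * R) (p q t u v : R) (i : comp S)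
  (w : list (vchord S)).

Local Notation e := (eps S).

(** The passage from the upper strand of [r] through the handle to the lower strand
    of [r'], in the coordinates of the rectangles; q is a circle coordinate,
    whence the integer. *)
Definition hop r X r' X' : Prop :=
  comp_hi r = comp_lo r' /\ offp r' false X' = offp r true X /\
  exists n : Z, par_end r' false + offq r' false X' =
    par_end r true + offq r true X + IZR (coef (comp_hi r)) * feps S (offp r true X) + IZR n.

(** The plane points over which a trajectory with a given word runs.  The end on
    Lambda^0 is part of the definition, the start is not: this makes tails of
    orbits orbits. *)
Inductive orbit : list (vchord S) -> list (R * R) -> Prop :=
| orbit_last r X : is_chord r -> over e r X -> coef (comp_hi r) = 0%Z ->
    offp r true X = 0 -> orbit (r :: nil) (X :: nil)
| orbit_hop r X r' X' w Xs : is_chord r -> over e r X -> coef (comp_hi r) <> 0%Z ->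
    hop r X r' X' -> orbit (r' :: w) (X' :: Xs) -> orbit (r :: r' :: w) (X :: X' :: Xs).

(** Nonempty suffixes of words, for inductions over the word. *)
Inductive tail_word : list (vchord S) -> Prop :=
| tail_last r : is_chord r -> coef (comp_hi r) = 0%Z -> tail_word (r :: nil)
| tail_cons r r' w : is_chord r -> coef (comp_hi r) <> 0%Z -> comp_hi r = comp_lo r' ->
    tail_word (r' :: w) -> tail_word (r :: r' :: w).

Lemma orbit_tail_word w Xs : orbit w Xs -> tail_word w.
Proof.
  induction 1; [now constructor|]. constructor; auto. apply H2.
Qed.

Lemma tail_word_chord r w : tail_word (r :: w) -> is_chord r.
Proof. intros H; inversion H; assumption. Qed.

Lemma orbit_over r w X Xs : orbit (r :: w) (X :: Xs) -> over e r X.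
Proof. intros H; inversion H; assumption. Qed.

Lemma tail_word_nth w : tail_word w -> forall k r, nth_error w k = Some r ->
  is_chord r /\ ((0 < k)%nat -> coef (comp_lo r) <> 0%Z) /\
  (coef (comp_hi r) = 0%Z <-> Datatypes.S k = length w) /\
  forall r', nth_error w (Datatypes.S k) = Some r' -> comp_hi r = comp_lo r'.
Proof.
  induction 1 as [r Hr Hc|r r' w Hr Hc E Hw IH]; intros k s Hk.
  - destruct k as [|[|k]]; simpl in Hk; try discriminate. injection Hk as <-.
    split; [exact Hr|split; [lia|split; [now split|discriminate]]].
  - destruct k as [|k].
    + injection Hk as <-. split; [exact Hr|split; [lia|split]].
      * split; [intros F; contradiction|simpl; lia].
      * intros s Hs. injection Hs as <-. exact E.
    + destruct (IH k s Hk) as (A & B & C & D).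
      split; [exact A|split; [|split]].
      * intros _. destruct k as [|k]; [|apply B; lia].
        injection Hk as <-. now rewrite <- E.
      * rewrite C. simpl. lia.
      * exact D.
Qed.

Lemma is_word_tail_word w : is_word w <->
  exists r w', w = r :: w' /\ coef (comp_lo r) = 0%Z /\ tail_word w.
Proof.
  split.
  - intros [Hne H].
    assert (K : forall w0 n, w = n ++ w0 -> w0 <> nil -> tail_word w0).
    { induction w0 as [|r w0 IH]; intros n E Hn; [congruence|].
      assert (Hk : nth_error w (length n) = Some r).
      { rewrite E, nth_error_app2, Nat.sub_diag by lia. reflexivity. }
      destruct (H _ _ Hk) as (A & B & C & D).
      destruct w0 as [|r' w0].
      - constructor; [exact A|]. apply C. rewrite E, length_app. simpl. lia.
      - constructor.
        + exact A.
        + intros F. apply C in F. rewrite E, length_app in F. simpl in F. lia.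
        + apply D. rewrite E, nth_error_app2 by lia.
          replace (Datatypes.S (length n) - length n)%nat with 1%nat by lia. reflexivity.
        + apply (IH (n ++ r :: nil)); [|discriminate]. rewrite E, <- app_assoc. reflexivity. }
    destruct w as [|r w]; [congruence|]. exists r, w. split; [reflexivity|]. split.
    + apply (H 0%nat r eq_refl). reflexivity.
    + apply (K _ nil); [reflexivity|discriminate].
  - intros (r & w' & -> & Hc & Hw). split; [discriminate|]. intros k s Hk.
    destruct (tail_word_nth Hw Hk) as (A & B & C & D).
    split; [exact A|split; [|split; [exact C|exact D]]].
    split; [|intros ->; injection Hk as <-; exact Hc].
    intros F. destruct k; [reflexivity|]. exfalso. apply B; [lia|exact F].
Qed.

Lemma eps_lt_half r : is_chord r -> e < 1 / 2.
Proof. intros Hr. generalize (eps0_lt_half Hr) (eps_lt (S := S)). lra. Qed.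

Lemma eps_range : 0 < e < eps0 S.
Proof. apply gs_eps. Qed.

(** Otherwise the midpoint lies in the rectangles of both ends, against
    [rect_unique]. *)
Lemma par_apart r r' (n : Z) : is_chord r -> is_chord r' -> comp_hi r = comp_lo r' ->
  2 * e < Rabs (par_end r' false - par_end r true + IZR n).
Proof.
  intros Hr Hr' E.
  destruct (Rlt_or_le (2 * e) (Rabs (par_end r' false - par_end r true + IZR n))) as [H|H]; [exact H|].
  exfalso.
  pose (q := (par_end r' false + IZR n + par_end r true) / 2).
  assert (I1 : in_rect e r true (comp_hi r) 0 q).
  { split; [exact Hr|split; [reflexivity|split]].
    - apply Rabs0_le; generalize eps_range; lra.
    - exists 0%Z. unfold q. rewrite Rplus_0_r.
      unfold Rabs in *; repeat destruct Rcase_abs; lra. }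
  assert (I2 : in_rect e r' false (comp_hi r) 0 q).
  { split; [exact Hr'|split; [exact E|split]].
    - apply Rabs0_le; generalize eps_range; lra.
    - exists (- n)%Z. rewrite opp_IZR. unfold q.
      unfold Rabs in *; repeat destruct Rcase_abs; lra. }
  destruct (rect_unique eps_range I1 I2) as [_ F]. discriminate F.
Qed.

Lemma Rabs_div_eps x : Rabs (x / e) = Rabs x / e.
Proof.
  generalize eps_range; intros He. unfold Rdiv. rewrite Rabs_mult, (Rabs_right (/ e)); [reflexivity|].
  apply Rle_ge, Rlt_le, Rinv_0_lt_compat. lra.
Qed.

Lemma coef_cases i : coef i <> 0%Z -> IZR (coef i) = 1 \/ IZR (coef i) = -1.
Proof.
  intros H. destruct (@gs_leg S G) as (Hc & _).
  destruct (Hc i) as [-> |[E| ->]]; [now left|contradiction|now right].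
Qed.

Lemma offq_true r X : is_chord r -> offq r true X = kap r false * offp r false X.
Proof. intros Hr. exact (offq_offp false X Hr). Qed.

Lemma offq_false r X : is_chord r -> offq r false X = kap r true * offp r true X.
Proof. intros Hr. exact (offq_offp true X Hr). Qed.

Lemma over_intro a r X : is_chord r -> Rabs (offp r false X) <= a -> Rabs (offp r true X) <= a ->
  over a r X.
Proof.
  intros Hr H1 H2 [|].
  - change true with (negb false). now rewrite <- Rabs_offp.
  - change false with (negb true). now rewrite <- Rabs_offp.
Qed.

Definition pt_of r u v : R * R :=
  (fst (ctr r) + kap r true * v * fst (dir r false) + u * snd (dir r false),
   snd (ctr r) + kap r true * v * snd (dir r false) - u * fst (dir r false)).

Lemma pt_of_off r u v : is_chord r ->
  offp r false (pt_of r u v) = u /\ offp r true (pt_of r u v) = v.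
Proof.
  intros Hr. destruct (offpq_eq r false u (kap r true * v)) as [A B].
  fold (pt_of r u v) in A, B. split; [exact A|].
  rewrite offp_offq by exact Hr. simpl. rewrite B, <- Rmult_assoc, kap_sqr by exact Hr. ring.
Qed.

Lemma point_eq r X Y : is_chord r -> offp r false X = offp r false Y ->
  offp r true X = offp r true Y -> X = Y.
Proof.
  intros Hr H1 H2. apply plane_point_eq with r false; [exact H1|].
  now rewrite !offq_false, H2.
Qed.

Lemma sign_abs c : c = 1 \/ c = -1 -> forall x, Rabs (c * x) = Rabs x.
Proof.
  intros [-> | ->] x; rewrite Rabs_mult.
  - rewrite Rabs_R1; ring.
  - rewrite (Rabs_left (-1)) by lra. ring.
Qed.

Lemma feps_surj t : 0 <= t <= 1 -> exists p, feps S p = t.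
Proof.
  intros Ht. destruct (IVT_gen_consistent (feps S) (- e) e t) as [p [_ Hp]].
  - apply feps_continuous.
  - rewrite feps_left, feps_right by lra. rewrite Rmin_left, Rmax_right; lra.
  - now exists p.
Qed.

(** The shear of a handle in the coordinates of the rectangles is affine, with a
    constant [beta] that depends on the two chords only.  The offsets at which the
    shear carries one edge of the first rectangle to the opposite edge of the second
    lie in the affine range by [small_delta]; so does everything between them.  The
    value [beta] keeps the distance 2 eps from 0 and 1, hence no other integer can
    occur in [hop]. *)
Lemma turning r r' : is_chord r -> is_chord r' -> comp_hi r = comp_lo r' ->
  coef (comp_hi r) <> 0%Z ->
  exists beta, 2 * e < beta < 1 - 2 * e /\
  (forall X X', over e r X -> over e r' X' -> hop r X r' X' ->
     Rabs (offp r true X) < e / 2 /\ Derive (feps S) (offp r true X) = / e /\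
     1 / 2 + offp r true X / e = beta +
       IZR (coef (comp_hi r)) * (offq r' false X' - offq r true X)) /\
  (forall X X', over e r X -> over e r' X' -> offp r' false X' = offp r true X ->
     1 / 2 + offp r true X / e = beta +
       IZR (coef (comp_hi r)) * (offq r' false X' - offq r true X) -> hop r X r' X').
Proof.
  intros Hr Hr' E Hc.
  destruct (@gs_twist S G) as (delta & Hd & Htw & Hsm).
  generalize eps_range; intros He.
  set (c := IZR (coef (comp_hi r))).
  assert (Ec : c = 1 \/ c = -1) by now apply coef_cases.
  assert (Ecc : c * c = 1) by (destruct Ec as [-> | ->]; ring).
  pose (d := c * (par_end r' false - par_end r true)).
  pose (m := (up d - 1)%Z).
  assert (Hm : IZR m <= d < IZR m + 1).
  { unfold m. rewrite minus_IZR. destruct (archimed d). lra. }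
  pose (n0 := (- coef (comp_hi r) * m)%Z).
  assert (En0 : IZR n0 = - c * IZR m) by (unfold n0; rewrite mult_IZR, opp_IZR; reflexivity).
  pose (beta := c * (par_end r' false - par_end r true + IZR n0)).
  assert (Eb : beta = d - IZR m).
  { unfold beta, d. rewrite En0. replace (c * (par_end r' false - par_end r true + - c * IZR m)) with
     (c * (par_end r' false - par_end r true) - (c * c) * IZR m) by ring. rewrite Ecc; ring. }
  assert (Hb : 2 * e < beta < 1 - 2 * e).
  { assert (A := par_apart n0 Hr Hr' E). rewrite <- (sign_abs Ec) in A. fold beta in A.
    assert (B := par_apart (n0 - coef (comp_hi r)) Hr Hr' E). rewrite minus_IZR in B. fold c in B.
    rewrite <- (sign_abs Ec) in B.
    replace (c * (par_end r' false - par_end r true + (IZR n0 - c))) with (beta - c * c) in B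
      by (unfold beta; ring). rewrite Ecc in B.
    rewrite Rabs_right in A by lra. rewrite Rabs_left in B; lra. }
  (* [HA] restates the smallness of delta in the coordinates of the rectangles. *)
  assert (HA : forall p s s' (n : Z), Rabs p <= e -> Rabs s <= e -> Rabs s' <= e ->
    par_end r' false + s' = par_end r true + s + c * feps S p + IZR n ->
    Rabs (p / e) <= (1 - delta) / 2).
  { intros p s s' n Hp Hs Hs' En.
    apply (Hsm (comp_hi r) r r' true false p (par_end r true + s) Hc).
    - intros F; discriminate F.
    - split; [exact Hr|split; [reflexivity|split; [exact Hp|]]]. exists 0%Z.
      replace (par_end r true + s + 0 - par_end r true) with s by ring. exact Hs.
    - split; [exact Hr'|split; [exact E|split; [exact Hp|]]]. exists n.
      fold (feps S p). fold c. rewrite <- En.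
      replace (par_end r' false + s' - par_end r' false) with s' by ring. exact Hs'. }
  assert (HI : forall p, 0 < feps S p < 1 -> Rabs p <= e).
  { intros p Hp. apply Rabs_le. split.
    - destruct (Rle_or_lt p (- e)) as [H|H]; [|lra]. rewrite feps_left in Hp; lra.
    - destruct (Rle_or_lt e p) as [H|H]; [|lra]. rewrite feps_right in Hp; lra. }
  (* The extreme offsets: from edge to opposite edge of the two rectangles. *)
  assert (HE : forall s, Rabs s = e -> exists p, feps S p = beta + 2 * s /\ Rabs (p / e) <= (1 - delta) / 2).
  { intros s Hs.
    assert (Hs' : - e <= s <= e) by (apply Rabs_le_between; lra).
    destruct (@feps_surj (beta + 2 * s)) as [p Hp]; [lra|].
    exists p. split; [exact Hp|].
    apply (HA p (- (c * s)) (c * s) (- n0)%Z).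
    - apply HI. rewrite Hp. split; [lra|]. lra.
    - rewrite Rabs_Ropp, (sign_abs Ec). lra.
    - rewrite (sign_abs Ec). lra.
    - rewrite Hp, opp_IZR. unfold beta.
      transitivity (par_end r true - c * s + (c * c) * (par_end r' false - par_end r true + IZR n0)
        + 2 * (c * s) - IZR n0); [rewrite Ecc|]; ring. }
  assert (HF : forall p, beta - 2 * e <= 1 / 2 + p / e <= beta + 2 * e -> feps S p = 1 / 2 + p / e).
  { intros p Hp.
    destruct (HE e) as (p1 & E1 & A1); [apply Rabs_right; lra|].
    destruct (HE (- e)) as (p2 & E2 & A2); [rewrite Rabs_Ropp; apply Rabs_right; lra|].
    rewrite (feps_affine Htw A1) in E1. rewrite (feps_affine Htw A2) in E2.
    apply (feps_affine Htw). apply Rabs_le. apply Rabs_le_between in A1. apply Rabs_le_between in A2. lra. }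
  exists beta. split; [exact Hb|]. split.
  - intros X X' HX HX' (_ & Ep & n & En). fold c in En |- *.
    set (p := offp r true X) in *. set (s := offq r true X) in *. set (s' := offq r' false X') in *.
    assert (Hs : Rabs s <= e) by apply HX. assert (Hs' : Rabs s' <= e) by apply HX'.
    assert (Hp : Rabs p <= e) by now apply over_offp.
    assert (A := HA p s s' n Hp Hs Hs' En).
    rewrite <- (feps_affine Htw A).
    split.
    { assert (B : Rabs p = e * Rabs (p / e)).
      { rewrite <- (Rabs_right e) at 1 by lra. rewrite <- Rabs_mult. f_equal. field. lra. }
      rewrite B. nra. }
    split.
    { rewrite Derive_feps. destruct Htw as (_ & _ & _ & _ & _ & _ & H1). rewrite H1 by exact A.
      unfold Rdiv. ring. }
    (* The distance of beta from 0 and 1 excludes every integer but - n0. *)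
    assert (F : feps S p = beta + c * (s' - s) - c * IZR (n + n0)).
    { rewrite plus_IZR. unfold beta.
      transitivity ((c * c) * feps S p); [rewrite Ecc; ring|].
      transitivity (c * (c * feps S p)); [ring|].
      replace (c * feps S p) with (par_end r' false + s' - par_end r true - s - IZR n) by lra. ring. }
    assert (B := feps_bounds (S := S) p).
    assert (D : Rabs (c * (s' - s)) <= 2 * e).
    { rewrite (sign_abs Ec). revert Hs Hs'. unfold Rabs; repeat destruct Rcase_abs; lra. }
    apply Rabs_le_between in D.
    assert (N : (n + n0 = 0)%Z).
    { assert (-1 < IZR (n + n0) < 1) by (destruct Ec as [-> | ->]; lra).
      assert (-1 < n + n0 < 1)%Z by (split; apply lt_IZR; simpl; lra). lia. }
    rewrite N in F. lra.
  - intros X X' HX HX' Ep Eq. fold c in Eq. split; [exact E|split; [exact Ep|]].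
    exists (- n0)%Z. fold c.
    set (p := offp r true X) in *. set (s := offq r true X) in *. set (s' := offq r' false X') in *.
    assert (Hs : Rabs s <= e) by apply HX. assert (Hs' : Rabs s' <= e) by apply HX'.
    assert (D : Rabs (c * (s' - s)) <= 2 * e).
    { rewrite (sign_abs Ec). revert Hs Hs'. unfold Rabs; repeat destruct Rcase_abs; lra. }
    apply Rabs_le_between in D.
    rewrite HF, Eq, opp_IZR by lra. unfold beta.
    transitivity (par_end r true + s + (c * c) * (par_end r' false - par_end r true + IZR n0 + s' - s)
      - IZR n0); [rewrite Ecc|]; ring.
Qed.

(** The difference of the two affine relations of [turning]: the offset at the handle
    is multiplied by 1/eps, all others by 1 or -1. *)
Lemma hop_growth r r' X X' Y Y' : is_chord r -> is_chord r' -> coef (comp_hi r) <> 0%Z ->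
  over e r X -> over e r' X' -> over e r Y -> over e r' Y' -> hop r X r' X' -> hop r Y r' Y' ->
  Rabs (offp r true X - offp r true Y) / e - Rabs (offp r false X - offp r false Y) <=
  Rabs (offp r' true X' - offp r' true Y').
Proof.
  intros Hr Hr' Hc OX OX' OY OY' HX HY.
  destruct (turning Hr Hr' (proj1 HX) Hc) as (beta & _ & K & _).
  destruct (K _ _ OX OX' HX) as (_ & _ & EX). destruct (K _ _ OY OY' HY) as (_ & _ & EY).
  rewrite !offq_true, !offq_false in EX, EY by assumption.
  set (c := IZR (coef (comp_hi r))) in *.
  assert (Ec : c = 1 \/ c = -1) by now apply coef_cases.
  generalize eps_range; intros He.
  assert (E : (offp r true X - offp r true Y) / e =
    c * (kap r' true * (offp r' true X' - offp r' true Y')) -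
    c * (kap r false * (offp r false X - offp r false Y))) by (unfold Rdiv in *; lra).
  rewrite <- Rabs_div_eps, E.
  assert (B := Rabs_triang (c * (kap r' true * (offp r' true X' - offp r' true Y')))
     (- (c * (kap r false * (offp r false X - offp r false Y))))).
  rewrite Rabs_Ropp, !(sign_abs Ec), (sign_abs (kap_cases true Hr')), (sign_abs (kap_cases false Hr)) in B.
  unfold Rminus in *. lra.
Qed.

Lemma inv_eps_gt2 r : is_chord r -> forall x, 0 <= x -> 2 * x <= x / e.
Proof.
  intros Hr x Hx. generalize eps_range (eps_lt_half Hr). intros A B.
  apply Rmult_le_reg_r with e; [lra|]. replace (x / e * e) with x by (field; lra). nra.
Qed.

(** By growth the final offsets, which are both 0, bound all previous differences. *)
Lemma orbit_unique_aux w Xs : orbit w Xs -> forall Ys, orbit w Ys ->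
  match w, Xs, Ys with
  | r :: _, X :: _, Y :: _ =>
     Rabs (offp r false X - offp r false Y) <= Rabs (offp r true X - offp r true Y) -> Xs = Ys
  | _, _, _ => True
  end.
Proof.
  induction 1 as [r X Hr HX Hc E|r X r' X' w Xs Hr HX Hc Hop Horb IH]; intros Ys HYs.
  - inversion HYs as [r0 Y _ HY _ EY|]; subst. intros H.
    rewrite E, EY, Rminus_diag, Rabs_R0 in H.
    assert (D : offp r false X - offp r false Y = 0).
    { revert H. unfold Rabs. destruct Rcase_abs; lra. }
    f_equal. apply point_eq with r; [exact Hr|lra|congruence].
  - inversion HYs as [|r0 Y r0' Y' w0 Ys' _ HY _ HopY HorbY]; subst. intros H.
    specialize (IH _ HorbY). simpl in IH.
    assert (Hr' := tail_word_chord (orbit_tail_word Horb)).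
    assert (Gr := hop_growth Hr Hr' Hc HX (orbit_over Horb) HY (orbit_over HorbY) Hop HopY).
    assert (T := inv_eps_gt2 Hr (Rabs_pos (offp r true X - offp r true Y))).
    assert (E1 := proj1 (proj2 Hop)). assert (E2 := proj1 (proj2 HopY)).
    assert (E : X' :: Xs = Y' :: Ys').
    { apply IH. rewrite E1, E2. lra. }
    injection E as EX' EXs. subst Y' Ys'.
    rewrite Rminus_diag, Rabs_R0 in Gr.
    assert (D : Rabs (offp r true X - offp r true Y) = 0).
    { generalize (Rabs_pos (offp r true X - offp r true Y)). lra. }
    assert (D1 : offp r true X - offp r true Y = 0).
    { revert D. unfold Rabs. destruct Rcase_abs; lra. }
    assert (D2 : offp r false X - offp r false Y = 0).
    { revert H. rewrite D. unfold Rabs. destruct Rcase_abs; lra. }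
    f_equal. apply point_eq with r; [exact Hr|lra|lra].
Qed.

Lemma orbit_unique r w X Xs Y Ys : orbit (r :: w) (X :: Xs) -> orbit (r :: w) (Y :: Ys) ->
  offp r false X = offp r false Y -> X :: Xs = Y :: Ys.
Proof.
  intros HX HY E. apply (orbit_unique_aux HX HY).
  rewrite E, Rminus_diag, Rabs_R0. apply Rabs_pos.
Qed.

(** With the initial offsets [u], [v] as unknowns, the equation for the final offset
    is affine, and its coefficient of [v] dominates.  The third clause says that an
    offset beyond eps/2 that is not smaller than its predecessor overshoots: then
    all later ones are at least as large.  This confines the solution to the
    rectangles, where the affine recurrence is the true one. *)
Lemma orbit_shooting r w : tail_word (r :: w) ->
  exists al be ga, 0 < Rabs be /\ Rabs al <= Rabs be /\
  (forall u v, e / 2 < Rabs v -> Rabs u <= Rabs v -> al * u + be * v + ga <> 0) /\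
  (forall u v, Rabs u <= e / 2 -> al * u + be * v + ga = 0 ->
    exists Xs, orbit (r :: w) (pt_of r u v :: Xs)).
Proof.
  generalize eps_range; intros He.
  revert r. induction w as [|r' w IH]; intros r Hw.
  - inversion Hw as [r0 Hr Hc|]; subst. exists 0, 1, 0.
    rewrite Rabs_R0, Rabs_R1. split; [lra|split; [lra|split]].
    + intros u v Hv _ F. replace v with 0 in Hv by lra. rewrite Rabs_R0 in Hv. lra.
    + intros u v Hu F. replace v with 0 by lra. exists nil.
      destruct (pt_of_off u 0 Hr) as [A B].
      constructor; auto. apply over_intro; auto.
      * rewrite A; lra.
      * rewrite B, Rabs_R0; lra.
  - inversion Hw as [|r0 r0' w0 Hr Hc E Hw']; subst.
    assert (Hr' := tail_word_chord Hw').
    destruct (IH r' Hw') as (al & be & ga & Hbe & Hal & HG & HO).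
    destruct (turning Hr Hr' E Hc) as (beta & Hb & _ & K).
    set (c := IZR (coef (comp_hi r))) in *.
    assert (Ec : c = 1 \/ c = -1) by now apply coef_cases.
    assert (Ecc : c * c = 1) by (destruct Ec as [-> | ->]; ring).
    set (k' := kap r' true) in *. set (k := kap r false) in *.
    assert (Ek' : k' = 1 \/ k' = -1) by now apply kap_cases.
    assert (Ek : k = 1 \/ k = -1) by now apply kap_cases.
    assert (Ekk : k' * k' = 1) by (destruct Ek' as [-> | ->]; ring).
    (* The offset after [u] and [v], by [turning]. *)
    pose (next := fun u v => k' * (k * u + c * (v / e + (1 / 2 - beta)))).
    assert (HN : forall u v, e / 2 < Rabs v -> Rabs u <= Rabs v -> Rabs v <= Rabs (next u v)).
    { intros u v Hv Hu. unfold next. rewrite (sign_abs Ek').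
      assert (T : Rabs (v / e) <= Rabs (k * u + c * (v / e + (1 / 2 - beta))) + Rabs u + Rabs (1 / 2 - beta)).
      { rewrite <- (sign_abs Ec (v / e)).
        replace (c * (v / e)) with ((k * u + c * (v / e + (1 / 2 - beta))) + - (k * u) + - (c * (1 / 2 - beta))) by ring.
        eapply Rle_trans; [apply Rabs_triang|]. rewrite Rabs_Ropp, (sign_abs Ec).
        apply Rplus_le_compat_r. eapply Rle_trans; [apply Rabs_triang|].
        rewrite Rabs_Ropp, (sign_abs Ek). lra. }
      assert (B : Rabs (1 / 2 - beta) < 1 / 2 - 2 * e) by (apply Rabs_lt_between; lra).
      assert (F : Rabs v / e - 2 * Rabs v >= 1 / 2 - e).
      { apply Rle_ge, Rmult_le_reg_r with e; [lra|].
        replace ((Rabs v / e - 2 * Rabs v) * e) with (Rabs v * (1 - 2 * e)) by (field; lra).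
        replace ((1 / 2 - e) * e) with (e / 2 * (1 - 2 * e)) by field.
        generalize (eps_lt_half Hr). intros. apply Rmult_le_compat_r; lra. }
      rewrite Rabs_div_eps in T. lra. }
    exists (be * (k' * k)), (al + be * (k' * c) / e), (ga + be * (k' * c * (1 / 2 - beta))).
    assert (EQ : forall u v, be * (k' * k) * u + (al + be * (k' * c) / e) * v +
       (ga + be * (k' * c * (1 / 2 - beta))) = al * v + be * next u v + ga).
    { intros u v. unfold next. field. lra. }
    assert (NB : Rabs (be * (k' * k)) = Rabs be).
    { rewrite Rabs_mult, (sign_abs Ek'), <- (Rmult_1_r k), (sign_abs Ek), Rabs_R1. ring. }
    assert (NB2 : Rabs be <= Rabs (al + be * (k' * c) / e)).
    { assert (T : Rabs (be * (k' * c) / e) <= Rabs (al + be * (k' * c) / e) + Rabs al).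
      { replace (be * (k' * c) / e) with (al + be * (k' * c) / e + - al) at 1 by ring.
        eapply Rle_trans; [apply Rabs_triang|]. rewrite Rabs_Ropp. lra. }
      assert (F : Rabs (be * (k' * c) / e) = Rabs be / e).
      { rewrite Rabs_div_eps, Rabs_mult, (sign_abs Ek'), <- (Rmult_1_r c), (sign_abs Ec), Rabs_R1. f_equal; ring. }
      assert (D := inv_eps_gt2 Hr (Rabs_pos be)). lra. }
    split; [lra|split; [rewrite NB; exact NB2|split]].
    + intros u v Hv Hu. rewrite EQ. assert (A := HN u v Hv Hu). apply HG; lra.
    + intros u v Hu F.
      assert (Hv : Rabs v <= e / 2).
      { destruct (Rle_or_lt (Rabs v) (e / 2)) as [H|H]; [exact H|]. exfalso.
        assert (A := HN u v H ltac:(lra)). rewrite EQ in F. revert F. apply HG; lra. }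
      rewrite EQ in F. destruct (HO v (next u v) Hv F) as [Xs HXs].
      destruct (pt_of_off u v Hr) as [A B]. destruct (pt_of_off v (next u v) Hr') as [A' B'].
      assert (OX : over e r (pt_of r u v)).
      { apply over_intro; [exact Hr|rewrite A|rewrite B]; lra. }
      exists (pt_of r' v (next u v) :: Xs). constructor; auto.
      apply K; auto.
      * now apply orbit_over in HXs.
      * congruence.
      * rewrite offq_true, offq_false, A, B, B' by assumption. fold k k'. unfold next.
        transitivity (beta + ((c * c) * (k' * k') * (v / e + (1 / 2 - beta)) + c * ((k' * k') * (k * u) - k * u)));
          [rewrite Ecc, Ekk; ring|ring].
Qed.

Lemma orbit_exists r w : tail_word (r :: w) ->
  exists X Xs, orbit (r :: w) (X :: Xs) /\ offp r false X = 0.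
Proof.
  intros Hw. destruct (orbit_shooting Hw) as (al & be & ga & Hbe & _ & _ & H).
  assert (be <> 0) by (intros ->; rewrite Rabs_R0 in Hbe; lra).
  destruct (H 0 (- ga / be)) as [Xs HXs].
  - rewrite Rabs_R0. generalize eps_range; lra.
  - field. assumption.
  - exists (pt_of r 0 (- ga / be)), Xs. split; [exact HXs|].
    apply pt_of_off. now apply tail_word_chord with w.
Qed.

End Orbits.

(** * From trajectories to orbits *)

Local Opaque glue_map.

Section Columns.
Context {S : surgery} {G : good_surgery S}.
Implicit Types (r : vchord S) (b : bool) (X : R * R) (p q t h T : R) (i : comp S)
  (w : list (vchord S)) (P Q : surgered S) (g : R -> surgered S).

Local Notation e := (eps S).

(** Half the thickness of the piece that is removed around a strand; nothing is
    removed around Lambda^0. *)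
Definition collar i : R := if Z.eq_dec (coef i) 0 then 0 else e.
Definition base r X : R := height r false X + collar (comp_lo r).
Definition roof r X : R := height r true X - collar (comp_hi r).
Definition rise r X : R := roof r X - base r X.
Definition dwell r X : R := e + ceil (comp_hi r) (offp r true X).

(** The points of the handles at which a segment over [X] leaves the handle of the
    lower strand and enters that of the upper strand. *)
Definition source_pt r X : R3 :=
  (ceil (comp_lo r) (offp r false X), offp r false X,
   par_end r false + offq r false X - IZR (coef (comp_lo r)) * feps S (offp r false X)).
Definition target_pt r X : R3 :=
  (- e, offp r true X, par_end r true + offq r true X).

Definition above_base r X h := coef (comp_lo r) <> 0%Z -> base r X < h.
Definition below_roof r X h := coef (comp_hi r) <> 0%Z -> h < roof r X.
Definition in_range r X h :=
  (coef (comp_lo r) <> 0%Z -> base r X <= h) /\ (coef (comp_hi r) <> 0%Z -> h <= roof r X).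

(** The point at height [h] over [X] between the two strands of [r].  The ends of the
    segment belong to the cores of the handles, which the outside chart does not
    meet. *)
Definition in_column r X h P : Prop :=
  (above_base r X h -> below_roof r X h -> rep P (Outside (X, h))) /\
  (coef (comp_lo r) <> 0%Z -> h = base r X -> rep P (Inside (comp_lo r) (source_pt r X))) /\
  (coef (comp_hi r) <> 0%Z -> h = roof r X -> rep P (Inside (comp_hi r) (target_pt r X))).

Lemma collar_0 i : coef i = 0%Z -> collar i = 0.
Proof. intros H. unfold collar. destruct Z.eq_dec; [reflexivity|contradiction]. Qed.

Lemma collar_eps i : coef i <> 0%Z -> collar i = e.
Proof. intros H. unfold collar. destruct Z.eq_dec; [contradiction|reflexivity]. Qed.

Lemma collar_bounds i : 0 <= collar i <= e.
Proof. unfold collar. generalize (eps_range (S := S)). destruct Z.eq_dec; lra. Qed.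

Lemma over_eps0 r X : over e r X -> over (eps0 S) r X.
Proof. intros H b. generalize (H b) (eps_range (S := S)). lra. Qed.

Lemma rise_pos r X : is_chord r -> over e r X -> 0 < rise r X.
Proof.
  intros Hr HX. generalize (gap eps_range Hr HX) (collar_bounds (comp_lo r)) (collar_bounds (comp_hi r)).
  unfold rise, roof, base. lra.
Qed.

Lemma dwell_gt r X : e < dwell r X.
Proof. unfold dwell. generalize (ceil_bounds (comp_hi r) (offp r true X)). lra. Qed.

(** Only the two strands of [r] lie over [X], and the segment keeps clear of both. *)
Lemma column_outside r X h : is_chord r -> over e r X -> above_base r X h -> below_roof r X h ->
  outside S (X, h).
Proof.
  intros Hr HX Ha Hb i y Hc [Hz Hp] E.
  destruct y as [[z p] q]. unfold c1, c2 in Hz, Hp; simpl in Hz, Hp.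
  generalize (eps_range (S := S)); intros He.
  assert (EX : pi_xy (Phi i (0, p, q)) = X).
  { rewrite Phi_lift in E by lra. destruct (Phi i (0, p, q)) as [[a c] d].
    unfold lift_z, c1, c2, c3 in E; simpl in E. injection E as E _. now rewrite E. }
  destruct (overlap_pair eps_range Hr HX Hp EX) as (b & Ei & Ep & n & En).
  subst i p.
  rewrite <- (Phi_period _ q n) in E by lra.
  rewrite <- En, Phi_over in E; [|exact Hr|now apply over_eps0|lra].
  injection E as Eh. apply Rabs_le_between in Hz.
  destruct b; unfold comp_end in Hc.
  - specialize (Hb Hc). unfold roof in Hb. rewrite collar_eps in Hb by exact Hc. lra.
  - specialize (Ha Hc). unfold base in Ha. rewrite collar_eps in Ha by exact Hc. lra.
Qed.

Lemma source_collar r X t : is_chord r -> over e r X -> coef (comp_lo r) <> 0%Z ->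
  0 <= t < eps0 S - e -> handle_chart (comp_lo r) (raise t (source_pt r X)) /\
  (0 < t -> ~ handle_core (comp_lo r) (raise t (source_pt r X)) /\
    Phi (comp_lo r) (glue_map (comp_lo r) (raise t (source_pt r X))) = (X, base r X + t)).
Proof.
  intros Hr HX Hc Ht. generalize (eps_range (S := S)); intros He.
  set (i := comp_lo r) in *. set (p := offp r false X).
  assert (Hp : Rabs p <= e) by now apply over_offp.
  assert (B := ceil_bounds i p).
  assert (C : handle_chart i (raise t (source_pt r X))).
  { unfold source_pt, raise, c1, c2, c3; simpl. fold i p. rewrite handle_chartE.
    repeat split; auto; lra. }
  split; [exact C|]. intros Ht0.
  assert (N : ~ handle_core i (raise t (source_pt r X))).
  { unfold source_pt, raise, c1, c2, c3; simpl. fold i p. rewrite not_core. lra. }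
  split; [exact N|].
  revert C N. unfold source_pt, raise, c1, c2, c3; simpl. fold i p. intros C N.
  rewrite Phi_glue_high; [|exact C|exact N|lra].
  match goal with |- lift_z _ (Phi i (0, p, ?q)) = _ =>
    replace q with (par_end r false + offq r false X) by (simpl; ring) end.
  unfold p, i. change (comp_lo r) with (comp_end r false).
  rewrite (@Phi_over S G _ _ _ 0); [|exact Hr|now apply over_eps0|rewrite Rabs_R0; lra].
  unfold lift_z, c1, c2, c3; simpl. unfold base, ceil. rewrite collar_eps by exact Hc.
  destruct X as [X1 X2]; simpl. f_equal. simpl. ring.
Qed.

Lemma target_collar r X t : is_chord r -> over e r X -> coef (comp_hi r) <> 0%Z ->
  0 <= t < eps0 S - e -> handle_chart (comp_hi r) (raise (- t) (target_pt r X)) /\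
  (0 < t -> ~ handle_core (comp_hi r) (raise (- t) (target_pt r X)) /\
    Phi (comp_hi r) (glue_map (comp_hi r) (raise (- t) (target_pt r X))) = (X, roof r X - t)).
Proof.
  intros Hr HX Hc Ht. generalize (eps_range (S := S)); intros He.
  set (i := comp_hi r) in *. set (p := offp r true X).
  assert (Hp : Rabs p <= e) by now apply over_offp.
  assert (B := ceil_bounds i p).
  assert (C : handle_chart i (raise (- t) (target_pt r X))).
  { unfold target_pt, raise, c1, c2, c3; simpl. fold i p. rewrite handle_chartE.
    repeat split; auto; lra. }
  split; [exact C|]. intros Ht0.
  assert (N : ~ handle_core i (raise (- t) (target_pt r X))).
  { unfold target_pt, raise, c1, c2, c3; simpl. fold i p. rewrite not_core. lra. }
  split; [exact N|].
  revert C N. unfold target_pt, raise, c1, c2, c3; simpl. fold i p. intros C N.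
  rewrite Phi_glue_low; [|exact C|lra].
  unfold p, i. change (comp_hi r) with (comp_end r true). change (par_hi r) with (par_end r true).
  rewrite (@Phi_over S G _ _ _ 0); [|exact Hr|now apply over_eps0|rewrite Rabs_R0; lra].
  unfold lift_z, c1, c2, c3; simpl. unfold roof. rewrite collar_eps by exact Hc.
  destruct X as [X1 X2]; simpl. f_equal. simpl. ring.
Qed.

Lemma column_cases r X h : in_range r X h ->
  (above_base r X h /\ below_roof r X h) \/
  (coef (comp_lo r) <> 0%Z /\ h = base r X) \/ (coef (comp_hi r) <> 0%Z /\ h = roof r X).
Proof.
  intros [Ha Hb]. unfold above_base, below_roof.
  destruct (Z.eq_dec (coef (comp_lo r)) 0) as [H|H], (Z.eq_dec (coef (comp_hi r)) 0) as [H'|H'].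
  - left; split; intros F; contradiction.
  - destruct (Rle_lt_or_eq_dec _ _ (Hb H')); [left; split; auto; contradiction|auto].
  - destruct (Rle_lt_or_eq_dec _ _ (Ha H)); [left; split; auto; contradiction|auto].
  - destruct (Rle_lt_or_eq_dec _ _ (Hb H')); [|auto].
    destruct (Rle_lt_or_eq_dec _ _ (Ha H)); [left; split; auto|auto].
Qed.

Lemma in_column_exists r X h : is_chord r -> over e r X -> in_range r X h ->
  exists P, in_column r X h P.
Proof.
  intros Hr HX HR. assert (Hrise := rise_pos Hr HX). unfold rise in Hrise.
  destruct (column_cases HR) as [[Ha Hb]|[[Hc E]|[Hc E]]].
  - destruct (@rep_exists S (Outside (X, h))) as [P HP]; [now apply column_outside with r|].
    exists P. split; [auto|split; intros Hc E; exfalso].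
    + specialize (Ha Hc). lra.
    + specialize (Hb Hc). lra.
  - destruct (@rep_exists S (Inside (comp_lo r) (source_pt r X))) as [P HP].
    + rewrite <- (raise_0 (source_pt r X)).
      apply (source_collar (t := 0) Hr HX Hc). generalize (eps_range (S := S)); lra.
    + exists P. split; [|split; auto].
      * intros Ha _. specialize (Ha Hc). lra.
      * intros _ E'. lra.
  - destruct (@rep_exists S (Inside (comp_hi r) (target_pt r X))) as [P HP].
    + rewrite <- (raise_0 (target_pt r X)). rewrite <- Ropp_0.
      apply (target_collar (t := 0) Hr HX Hc). generalize (eps_range (S := S)); lra.
    + exists P. split; [|split; auto].
      * intros _ Hb. specialize (Hb Hc). lra.
      * intros _ E'. lra.
Qed.

Lemma in_column_unique r X h P Q : in_range r X h -> in_column r X h P -> in_column r X h Q -> P = Q.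
Proof.
  intros HR (A1 & A2 & A3) (B1 & B2 & B3).
  destruct (column_cases HR) as [[Ha Hb]|[[Hc E]|[Hc E]]]; eapply rep_eq; eauto.
Qed.

Lemma in_range_between r X h1 h2 h : in_range r X h1 -> in_range r X h2 -> h1 <= h <= h2 ->
  in_range r X h.
Proof.
  intros [A1 A2] [B1 B2] H. split; intros Hc.
  - specialize (A1 Hc); lra.
  - specialize (B2 Hc); lra.
Qed.

Lemma in_range_base r X : is_chord r -> over e r X -> in_range r X (base r X).
Proof.
  intros Hr HX. generalize (rise_pos Hr HX). unfold rise. split; intros _; lra.
Qed.

Lemma in_range_roof r X : is_chord r -> over e r X -> in_range r X (roof r X).
Proof.
  intros Hr HX. generalize (rise_pos Hr HX). unfold rise. split; intros _; lra.
Qed.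

(** The column is vertical in the outside chart, and its ends are read in the collars
    of the handles. *)
Lemma column_trajectory r X h T g : is_chord r -> over e r X ->
  in_range r X h -> in_range r X (h + T) ->
  (forall t, 0 <= t <= T -> in_column r X (h + t) (g t)) -> Reeb_trajectory T g.
Proof.
  intros Hr HX HR1 HR2 H. apply trajectory_vertical. intros t Ht.
  generalize (eps_range (S := S)); intros He.
  assert (Hrise := rise_pos Hr HX). unfold rise in Hrise.
  assert (HR : in_range r X (h + t)) by (apply in_range_between with h (h + T); auto; lra).
  assert (HRs : forall s, 0 <= s <= T -> in_range r X (h + s)).
  { intros s Hs. apply in_range_between with h (h + T); auto; lra. }
  destruct (H t Ht) as (C1 & C2 & C3).
  destruct (column_cases HR) as [[Ha Hb]|[[Hc E]|[Hc E]]].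
  - left.
    assert (D1 : exists d1, 0 < d1 /\ (coef (comp_lo r) <> 0%Z -> d1 <= h + t - base r X)).
    { destruct (Z.eq_dec (coef (comp_lo r)) 0) as [F|N].
      - exists 1. split; [lra|contradiction].
      - exists (h + t - base r X). specialize (Ha N). split; lra. }
    assert (D2 : exists d2, 0 < d2 /\ (coef (comp_hi r) <> 0%Z -> d2 <= roof r X - (h + t))).
    { destruct (Z.eq_dec (coef (comp_hi r)) 0) as [F|N].
      - exists 1. split; [lra|contradiction].
      - exists (roof r X - (h + t)). specialize (Hb N). split; lra. }
    destruct D1 as (d1 & D1 & L1), D2 as (d2 & D2 & L2).
    exists (X, h + t), (Rmin d1 d2). split; [now apply Rmin_glb_lt|]. intros s Hs1 Hs2.
    destruct (Rmin_lt Hs2) as [A B]. apply Rabs_lt_between in A. apply Rabs_lt_between in B.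
    replace (lift_z (s - t) (X, h + t)) with (X, h + s).
    + apply (H s Hs1).
      * intros N. specialize (L1 N). lra.
      * intros N. specialize (L2 N). lra.
    + unfold lift_z, c1, c2, c3; destruct X; simpl. f_equal. ring.
  - right; exists (comp_lo r).
    exists (source_pt r X), (Rmin (eps0 S - e) (roof r X - base r X)).
    split; [apply Rmin_glb_lt; lra|]. intros s Hs1 Hs2.
    destruct (Rmin_lt Hs2) as [A B]. apply Rabs_lt_between in A. apply Rabs_lt_between in B.
    assert (Hge := proj1 (HRs s Hs1) Hc).
    destruct (Req_dec s t) as [-> |Hne].
    + rewrite Rminus_diag, raise_0. now apply C2.
    + destruct (source_collar (t := s - t) Hr HX Hc) as [K1 K2]; [lra|].
      destruct K2 as [K2 K3]; [lra|].
      apply rep_Inside_glue; auto. rewrite K3. replace (base r X + (s - t)) with (h + s) by lra.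
      apply (H s Hs1); intros _; lra.
  - right; exists (comp_hi r).
    exists (target_pt r X), (Rmin (eps0 S - e) (roof r X - base r X)).
    split; [apply Rmin_glb_lt; lra|]. intros s Hs1 Hs2.
    destruct (Rmin_lt Hs2) as [A B]. apply Rabs_lt_between in A. apply Rabs_lt_between in B.
    assert (Hle := proj2 (HRs s Hs1) Hc).
    destruct (Req_dec s t) as [-> |Hne].
    + rewrite Rminus_diag, raise_0. now apply C3.
    + destruct (target_collar (t := t - s) Hr HX Hc) as [K1 K2]; [lra|].
      destruct K2 as [K2 K3]; [lra|].
      replace (- (t - s)) with (s - t) in * by ring.
      apply rep_Inside_glue; auto. rewrite K3. replace (roof r X - (t - s)) with (h + s) by lra.
      apply (H s Hs1); intros _; lra.
Qed.

Lemma inside_trajectory i (y : R3) T g :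
  (forall t, 0 <= t <= T -> rep (g t) (Inside i (raise t y))) -> Reeb_trajectory T g.
Proof.
  intros H. apply trajectory_vertical. intros t Ht. right. exists i, (raise t y), 1.
  split; [lra|]. intros s Hs _. rewrite raise_raise. replace (t + (s - t)) with s by ring.
  now apply H.
Qed.

Lemma choice_on (A : R -> surgered S -> Prop) T : 0 <= T ->
  (forall t, 0 <= t <= T -> exists P, A t P) -> exists g, forall t, 0 <= t <= T -> A t (g t).
Proof.
  intros HT H. destruct (H 0 ltac:(lra)) as [P0 _].
  destruct (functional_choice (fun t P => 0 <= t <= T -> A t P)) as [g Hg].
  - intros t. destruct (classic (0 <= t <= T)) as [Ht|Ht].
    + destruct (H t Ht) as [P HP]. now exists P.
    + exists P0. contradiction.
  - now exists g.
Qed.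

Lemma column_path r X h T : is_chord r -> over e r X -> 0 <= T ->
  in_range r X h -> in_range r X (h + T) ->
  exists g, Reeb_trajectory T g /\ forall t, 0 <= t <= T -> in_column r X (h + t) (g t).
Proof.
  intros Hr HX HT H1 H2.
  destruct (@choice_on (fun t P => in_column r X (h + t) P) T HT) as [g Hg].
  - intros t Ht. apply in_column_exists; auto. apply in_range_between with h (h + T); auto; lra.
  - exists g. split; [|exact Hg]. now apply column_trajectory with r X h.
Qed.

Lemma core_point r X t : is_chord r -> over e r X -> coef (comp_hi r) <> 0%Z ->
  0 <= t <= dwell r X ->
  handle_chart (comp_hi r) (raise t (target_pt r X)) /\
  handle_core (comp_hi r) (raise t (target_pt r X)).
Proof.
  intros Hr HX Hc Ht. generalize (eps_range (S := S)); intros He.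
  assert (Hp : Rabs (offp r true X) <= e) by now apply over_offp.
  unfold dwell in Ht. unfold target_pt, raise, c1, c2, c3; simpl.
  rewrite handle_chartE, handle_coreE. repeat split; auto; lra.
Qed.

Lemma core_path r X : is_chord r -> over e r X -> coef (comp_hi r) <> 0%Z ->
  exists g, Reeb_trajectory (dwell r X) g /\
    forall t, 0 <= t <= dwell r X -> rep (g t) (Inside (comp_hi r) (raise t (target_pt r X))).
Proof.
  intros Hr HX Hc. generalize (eps_range (S := S)) (dwell_gt r X); intros He Hd.
  destruct (@choice_on (fun t P => rep P (Inside (comp_hi r) (raise t (target_pt r X))))
    (dwell r X)) as [g Hg]; [lra| |].
  - intros t Ht. apply rep_exists. apply (core_point Hr HX Hc Ht).
  - exists g. split; [|exact Hg]. now apply inside_trajectory with (comp_hi r) (target_pt r X).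
Qed.

(** [source_pt] undoes the shear in [hop], up to the integer. *)
Lemma hop_point r X r' X' : hop r X r' X' ->
  eq_mod_Z (raise (dwell r X) (target_pt r X)) (source_pt r' X').
Proof.
  intros (E & Ep & n & En). unfold eq_mod_Z, dwell, target_pt, source_pt, raise, c1, c2, c3; simpl.
  rewrite <- E, Ep. split; [ring|split; [reflexivity|]]. exists n. simpl in En. lra.
Qed.

(** The times are forced by the points: a trajectory needs the time [rise] between
    two strands and the time [dwell] in a core. *)
Inductive follows g T : list (vchord S) -> list (R * R) -> R -> Prop :=
| follows_last r X t0 : T = t0 + rise r X ->
    (forall t, t0 <= t <= T -> in_column r X (base r X + (t - t0)) (g t)) ->
    follows g T (r :: nil) (X :: nil) t0
| follows_hop r X r' X' w Xs t0 :
    (forall t, t0 <= t <= t0 + rise r X -> in_column r X (base r X + (t - t0)) (g t)) ->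
    (forall t, 0 <= t <= dwell r X ->
       rep (g (t0 + rise r X + t)) (Inside (comp_hi r) (raise t (target_pt r X)))) ->
    follows g T (r' :: w) (X' :: Xs) (t0 + rise r X + dwell r X) ->
    follows g T (r :: r' :: w) (X :: X' :: Xs) t0.

Lemma pi_lift t (x : R3) : pi_xy (lift_z t x) = pi_xy x.
Proof. destruct x as [[x1 x2] x3]. reflexivity. Qed.

Lemma in_rect_Phi r b i p q : in_rect e r b i p q ->
  exists X, Phi i (0, p, q) = (X, height r b X) /\ over e r X /\ i = comp_end r b /\
   offp r b X = p /\ exists n : Z, par_end r b + offq r b X = q + IZR n.
Proof.
  intros H. generalize (eps_range (S := S)); intros He.
  destruct (in_rect_over (Rlt_le _ _ eps_lt) H) as (Ei & HX & Ep & n & En).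
  set (X := pi_xy (Phi i (0, p, q))) in *.
  exists X. split; [|split; [exact HX|split; [exact Ei|split; [exact Ep|now exists n]]]].
  destruct H as (Hr & _ & Hp & _).
  rewrite <- (Phi_period i q n) by (rewrite ?Rabs_R0; lra).
  rewrite <- En, <- Ep, Ei.
  rewrite Phi_over; [f_equal; ring|exact Hr|now apply over_eps0|rewrite Rabs_R0; lra].
Qed.

(** The strands lie over a common point, hence over a rectangle, and by [gap] the one
    that is above is the upper strand of the chord. *)
Lemma climb i i' p p' q q' a : 0 < a -> Rabs p <= e -> Rabs p' <= e ->
  Phi i' (0, p', q') = lift_z a (Phi i (0, p, q)) ->
  exists r X, is_chord r /\ over e r X /\ comp_lo r = i /\ comp_hi r = i' /\
   offp r false X = p /\ offp r true X = p' /\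
   (exists n : Z, par_end r false + offq r false X = q + IZR n) /\
   (exists n : Z, par_end r true + offq r true X = q' + IZR n) /\
   Phi i (0, p, q) = (X, height r false X) /\ a = height r true X - height r false X.
Proof.
  intros Ha Hp Hp' E.
  destruct (@strands_meet S G e i i' p p' q q') as [[Ei M]|(r & b & I1 & I2)]; auto using eps_range.
  - rewrite E. symmetry. apply pi_lift.
  - exfalso. subst i'.
    destruct M as (_ & Ep & n & En). unfold c2, c3 in Ep, En; simpl in Ep, En. subst p' q'.
    rewrite Phi_period in E by (rewrite ?Rabs_R0; generalize (eps_range (S := S)); lra).
    apply (f_equal c3) in E. unfold lift_z, c3 at 2 in E; simpl in E. lra.
  - destruct (in_rect_Phi I1) as (X & EX & OX & Ei & Ep & En).
    destruct (in_rect_Phi I2) as (X' & EX' & OX' & Ei' & Ep' & En').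
    rewrite EX, EX' in E. unfold lift_z, c1, c2, c3 in E; simpl in E.
    assert (E1 : X' = X) by (destruct X; now injection E). subst X'.
    assert (E2 : height r (negb b) X = height r b X + a) by (destruct X; now injection E).
    destruct I1 as (Hr & _).
    assert (Gp := gap eps_range Hr OX). assert (Hpos := proj1 (eps_range (S := S))).
    destruct b; [change (negb true) with false in E2; lra|].
    change (negb false) with true in *.
    exists r, X. do 9 (split; [assumption || (symmetry; assumption)|]). lra.
Qed.

Definition leaves P i p q : Prop :=
  coef i = 0%Z /\ p = 0 /\ rep P (Outside (Phi i (0, p, q))) \/
  coef i <> 0%Z /\ rep P (Inside i (ceil i p, p, q - IZR (coef i) * feps S p)).

(** The points of the column and of the strand are the same modulo Z. *)
Lemma leaves_column P i p q r X (n : Z) : leaves P i p q -> is_chord r -> over e r X ->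
  comp_lo r = i -> offp r false X = p -> par_end r false + offq r false X = q + IZR n ->
  Phi i (0, p, q) = (X, height r false X) -> in_column r X (base r X) P.
Proof.
  intros Hs Hr HX Ei Ep En EPhi. assert (Hp := rise_pos Hr HX). unfold rise in Hp.
  split; [|split].
  - intros Hab _. destruct Hs as [(Hc & _ & Hs)|(Hc & _)].
    + revert Hs. rewrite EPhi. unfold base. rewrite Ei, collar_0, Rplus_0_r by exact Hc. auto.
    + exfalso. rewrite <- Ei in Hc. specialize (Hab Hc). lra.
  - intros Hc _. destruct Hs as [(Hc0 & _)|(_ & Hs)]; [rewrite Ei in Hc; contradiction|].
    rewrite Ei. apply rep_Inside_mod with (2 := Hs).
    unfold source_pt. rewrite Ei, Ep. unfold eq_mod_Z, c1, c2, c3; simpl.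
    split; [reflexivity|split; [reflexivity|]]. exists n. simpl in En. lra.
  - intros _ E. lra.
Qed.

(** The trajectory climbs from its strand to Lambda^0 or to the bottom of a handle
    ([outside_run], [climb]) and in the second case leaves the handle through the
    top, because the core does not meet Lambda^0.  Each handle takes more than time
    eps, which bounds their number by [N]. *)
Lemma trajectory_follows T g : Reeb_trajectory T g -> on_Lambda0 (g T) ->
  forall N t0 i p q, 0 <= t0 < T -> T - t0 <= INR N * e -> Rabs p <= e ->
  leaves (g t0) i p q ->
  exists r w X Xs, orbit (r :: w) (X :: Xs) /\ follows g T (r :: w) (X :: Xs) t0 /\
    comp_lo r = i /\ offp r false X = p /\
    exists n : Z, par_end r false + offq r false X = q + IZR n.
Proof.
  intros HT HL N. generalize (eps_range (S := S)); intros He.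
  induction N as [|N IH]; intros t0 i p q Ht0 HN Hp Hsrc.
  { simpl in HN. lra. }
  rewrite S_INR in HN.
  assert (Hp0 : Rabs p <= eps0 S) by lra.
  pose (x := lift_z (collar i) (Phi i (0, p, q))).
  assert (Hstart : exists t1, t0 < t1 <= T /\
    forall t, t0 < t <= t1 -> rep (g t) (Outside (lift_z (t - t0) x))).
  { destruct Hsrc as [(Hc & _ & Hs)|(Hc & Hs)].
    - unfold x. rewrite collar_0, lift_0 by exact Hc.
      destruct (follow_Outside HT (ltac:(lra) : 0 <= t0 <= T) Hs) as (eta & Heta & K).
      exists (Rmin T (t0 + eta / 2)). split; [split; [apply Rmin_glb_lt; lra|apply Rmin_l]|].
      intros t Ht. generalize (Rmin_l T (t0 + eta / 2)) (Rmin_r T (t0 + eta / 2)). intros.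
      apply K; [lra|]. rewrite Rabs_right; lra.
    - unfold x. rewrite collar_eps by exact Hc.
      destruct (follow_Inside HT (ltac:(lra) : 0 <= t0 <= T) Hs) as (eta & Heta & K).
      exists (Rmin T (t0 + eta / 2)). split; [split; [apply Rmin_glb_lt; lra|apply Rmin_l]|].
      intros t Ht. generalize (Rmin_l T (t0 + eta / 2)) (Rmin_r T (t0 + eta / 2)). intros.
      assert (A : rep (g t) (Inside i (raise (t - t0) (ceil i p, p, q - IZR (coef i) * feps S p)))).
      { apply K; [lra|]. rewrite Rabs_right; lra. }
      revert A. unfold raise, c1, c2, c3; simpl. intros A.
      assert (B := ceil_bounds i p).
      assert (Nc : ~ handle_core i (ceil i p + (t - t0), p, q - IZR (coef i) * feps S p))
        by (rewrite not_core; lra).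
      assert (Cc := rep_in_chart A). simpl in Cc.
      apply rep_Outside_glue in A; [|exact Nc].
      rewrite Phi_glue_high in A; [|exact Cc|exact Nc|lra].
      rewrite lift_lift.
      replace (e + (t - t0)) with (ceil i p + (t - t0) - IZR (coef i) * heps S p) by (unfold ceil; ring).
      replace q with (q - IZR (coef i) * feps S p + IZR (coef i) * feps S p) by ring. exact A. }
  destruct Hstart as (t1 & Ht1 & Hstart).
  assert (Hcol := collar_bounds i).
  destruct (outside_run HT (ltac:(lra) : 0 <= t0 < t1) (proj2 Ht1) Hstart)
    as [Hall|(t & i' & p' & q' & Ht & Hpath & Hin & Hp' & Ehit)].
  - destruct HL as (i' & q' & Hc' & Hend).
    assert (E := rep_Outside_inj Hend (Hall T ltac:(lra))).
    unfold x in E. rewrite lift_lift, <- Phi_core in E.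
    destruct (@climb i i' p 0 q q' (collar i + (T - t0))) as
      (r & X & Hr & HX & Ei & Ei' & Ep & Ep' & En & _ & EPhi & Eh).
    + lra.
    + exact Hp.
    + rewrite Rabs_R0; lra.
    + exact E.
    + assert (Erise : T = t0 + rise r X).
      { unfold rise, roof, base. rewrite Ei, Ei', (collar_0 (i := i')) by exact Hc'. lra. }
      assert (Ex : x = (X, base r X)).
      { unfold x, base. rewrite EPhi, Ei. destruct X; reflexivity. }
      exists r, nil, X, nil. split; [|split; [|split; [exact Ei|split; [exact Ep|exact En]]]].
      * constructor; auto. now rewrite Ei'.
      * constructor; [exact Erise|]. intros t Ht. destruct (Req_dec t t0) as [-> |Hne].
        -- rewrite Rminus_diag, Rplus_0_r. destruct En as [n En].
           now apply (leaves_column Hsrc Hr HX Ei Ep En).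
        -- split; [|split].
           ++ intros _ _. assert (A := Hall t ltac:(lra)). rewrite Ex in A. destruct X; exact A.
           ++ intros _ Eb. lra.
           ++ intros Hc. rewrite Ei' in Hc. contradiction.
  - assert (Cin := rep_in_chart Hin). simpl in Cin.
    assert (Hc' : coef i' <> 0%Z) by apply Cin.
    unfold x in Ehit. rewrite lift_lift, (Phi_lift _ (z := - e)) in Ehit;
      [|rewrite Rabs_Ropp, Rabs_right; lra|lra].
    symmetry in Ehit. apply lift_swap in Ehit. rewrite lift_lift in Ehit.
    destruct (@climb i i' p p' q q' (collar i + (t - t0) + - - e)) as
      (r & X & Hr & HX & Ei & Ei' & Ep & Ep' & En & En' & EPhi & Eh); auto.
    + lra.
    + assert (Erise : t = t0 + rise r X).
      { unfold rise, roof, base. rewrite Ei, Ei', (collar_eps (i := i')) by exact Hc'. lra. }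
      assert (Ex : x = (X, base r X)).
      { unfold x, base. rewrite EPhi, Ei. destruct X; reflexivity. }
      assert (Hd := dwell_gt r X).
      assert (Htarget : rep (g t) (Inside i' (target_pt r X))).
      { destruct En' as [n En']. apply rep_Inside_mod with (2 := Hin).
        unfold target_pt. rewrite Ep'. unfold eq_mod_Z, c1, c2, c3; simpl.
        split; [reflexivity|split; [reflexivity|]]. exists n. exact En'. }
      assert (Hrun : forall t2, t <= t2 <= T -> t2 <= t + dwell r X -> forall s, t <= s <= t2 ->
        rep (g s) (Inside i' (raise (s - t) (target_pt r X)))).
      { intros t2 H1 H2. apply (inside_run HT); auto; [lra|].
        intros s Hs. rewrite <- Ei'. apply core_point; auto; [now rewrite Ei'|]. lra. }
      assert (HTd : t + dwell r X < T).
      { destruct (Rlt_or_le (t + dwell r X) T) as [H|H]; [exact H|exfalso].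
        assert (A := Hrun T ltac:(lra) H T ltac:(lra)).
        destruct HL as (i2 & q2 & Hc2 & Hend).
        destruct (rep_mixed A Hend) as [Nc _]. apply Nc. rewrite <- Ei'.
        apply core_point; auto; [now rewrite Ei'|]. lra. }
      assert (Hcore : forall s, 0 <= s <= dwell r X ->
        rep (g (t0 + rise r X + s)) (Inside (comp_hi r) (raise s (target_pt r X)))).
      { intros s Hs. rewrite Ei', <- Erise. replace s with (t + s - t) at 2 by ring.
        apply (Hrun (t + dwell r X)); lra. }
      destruct (IH (t + dwell r X) i' p'
        (par_end r true + offq r true X + IZR (coef i') * feps S p')) as
        (r' & w & X' & Xs & Horb & Hfol & Ci & Cp & Cn).
      * lra.
      * lra.
      * exact Hp'.
      * right. split; [exact Hc'|].
        assert (A := Hcore (dwell r X) ltac:(lra)). rewrite <- Erise, Ei' in A.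
        revert A. unfold target_pt, raise, dwell, c1, c2, c3; simpl. rewrite Ei', Ep'.
        replace (- e + (e + ceil i' p')) with (ceil i' p') by ring.
        replace (par_hi r + offq r true X + IZR (coef i') * feps S p' - IZR (coef i') * feps S p')
          with (par_hi r + offq r true X) by ring. auto.
      * exists r, (r' :: w), X, (X' :: Xs). split; [|split; [|split; [exact Ei|split; [exact Ep|exact En]]]].
        -- constructor; auto; [now rewrite Ei'|]. split; [congruence|split; [congruence|]].
           destruct Cn as [n Cn]. exists n. rewrite Ei', Ep'. exact Cn.
        -- constructor; [|exact Hcore|now rewrite <- Erise].
           intros s Hs. destruct (Req_dec s t0) as [-> |Hne].
           { rewrite Rminus_diag, Rplus_0_r. destruct En as [n En].
             now apply (leaves_column Hsrc Hr HX Ei Ep En). }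
           split; [|split].
           ++ intros _ Hbe. assert (Hst : s < t).
              { unfold below_roof in Hbe. rewrite Ei' in Hbe. specialize (Hbe Hc').
                unfold rise in Erise. lra. }
              assert (A := Hpath s ltac:(lra)). rewrite Ex in A. destruct X; exact A.
           ++ intros _ Eb. lra.
           ++ intros _ Eb. assert (s = t) by (unfold rise in Erise; lra). subst s.
              rewrite Ei'. exact Htarget.
Qed.

End Columns.

(** * The correspondence between words and chords *)

Section Words.
Context {S : surgery} {G : good_surgery S}.
Implicit Types (r : vchord S) (b : bool) (X : R * R) (p q t h T : R) (i : comp S)
  (w : list (vchord S)) (P Q : surgered S) (g : R -> surgered S) (k : Reeb_chord S).

Local Notation e := (eps S).

Definition runs_along g r t1 t2 : Prop :=
  forall t, t1 < t < t2 -> exists x, rep (g t) (Outside x) /\ along r x.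
Definition runs_in_core g t1 t2 : Prop :=
  forall t, t1 <= t <= t2 -> exists i y, handle_core i y /\ rep (g t) (Inside i y).

(** The recursive form of [has_word], in which the times are determined one after
    the other. *)
Inductive itinerary g T : list (vchord S) -> R -> Prop :=
| itinerary_last r t0 : t0 < T -> runs_along g r t0 T -> itinerary g T (r :: nil) t0
| itinerary_cons r r' w t0 t1 t2 : t0 < t1 -> runs_along g r t0 t1 -> t1 < t2 ->
    runs_in_core g t1 t2 -> itinerary g T (r' :: w) t2 -> itinerary g T (r :: r' :: w) t0.

Lemma itinerary_times g T w t0 : itinerary g T w t0 <->
  w <> nil /\ exists s f : nat -> R, s 0%nat = t0 /\ f (pred (length w)) = T /\
    forall j r, nth_error w j = Some r ->
      s j < f j /\ runs_along g r (s j) (f j) /\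
      ((Datatypes.S j < length w)%nat ->
         f j < s (Datatypes.S j) /\ runs_in_core g (f j) (s (Datatypes.S j))).
Proof.
  split.
  - induction 1 as [r t0 H0 H1|r r' w t0 t1 t2 H0 H1 H2 H3 _ [_ (s & f & Es & Ef & IH)]].
    + split; [discriminate|]. exists (fun _ => t0), (fun _ => T).
      split; [reflexivity|split; [reflexivity|]]. intros [|[|j]] r' Hj; try discriminate.
      injection Hj as <-. split; [exact H0|split; [exact H1|simpl; lia]].
    + split; [discriminate|].
      exists (fun j => match j with O => t0 | Datatypes.S j => s j end),
        (fun j => match j with O => t1 | Datatypes.S j => f j end).
      split; [reflexivity|split; [exact Ef|]]. intros [|j] r0 Hj.
      * injection Hj as <-. split; [exact H0|split; [exact H1|]]. rewrite Es. auto.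
      * destruct (IH j r0 Hj) as (A & B & C). split; [exact A|split; [exact B|]].
        intros Hl. apply C. simpl in *. lia.
  - intros [Hne (s & f & Es & Ef & H)]. revert t0 s f Es Ef H.
    induction w as [|r w IH]; intros t0 s f Es Ef H; [congruence|].
    destruct w as [|r' w].
    + destruct (H 0%nat r eq_refl) as (A & B & _). simpl in Ef.
      rewrite Es, Ef in A, B. now constructor.
    + destruct (H 0%nat r eq_refl) as (A & B & C). rewrite Es in A, B.
      destruct C as [C D]; [simpl; lia|].
      apply itinerary_cons with (f 0%nat) (s 1%nat); auto.
      apply (IH ltac:(discriminate) _ (fun j => s (Datatypes.S j)) (fun j => f (Datatypes.S j)));
        [reflexivity|exact Ef|].
      intros j r0 Hj. destruct (H (Datatypes.S j) r0 Hj) as (A' & B' & C').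
      split; [exact A'|split; [exact B'|]]. intros Hl. apply C'. simpl in *. lia.
Qed.

Lemma has_word_itinerary k w : has_word k w <-> itinerary (traj k) (len k) w 0.
Proof.
  rewrite itinerary_times. unfold has_word.
  split; intros [Hne (s & f & A & B & H)]; (split; [exact Hne|]); exists s, f; auto.
Qed.

Lemma along_over r x : along r x -> is_chord r /\ over e r (pi_xy x).
Proof.
  intros [(p & q & h & HI & _ & E) _].
  destruct (in_rect_Phi HI) as (X & EX & HX & _). split; [apply HI|].
  rewrite E, pi_lift, EX. exact HX.
Qed.

Lemma along_unique r r' x : along r x -> along r' x -> r = r'.
Proof.
  intros H H'. destruct (along_over H) as [A B]. destruct (along_over H') as [A' B'].
  exact (over_unique eps_range A A' B B').
Qed.

Lemma runs_along_not_core g r t1 t2 t i y : runs_along g r t1 t2 -> t1 < t < t2 ->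
  handle_core i y -> rep (g t) (Inside i y) -> False.
Proof.
  intros H Ht Hy HP. destruct (H t Ht) as (x & Hx & _).
  destruct (rep_mixed HP Hx) as [N _]. contradiction.
Qed.

Lemma runs_disjoint g r t1 t2 t3 t4 t : runs_along g r t1 t2 -> runs_in_core g t3 t4 ->
  t1 < t < t2 -> t3 <= t <= t4 -> False.
Proof.
  intros H1 H2 Ht Ht'. destruct (H2 t Ht') as (i & y & Hy & HP).
  eapply runs_along_not_core; eauto.
Qed.

Lemma runs_along_unique g r r' t0 t1 t1' : t0 < t1 -> t0 < t1' ->
  runs_along g r t0 t1 -> runs_along g r' t0 t1' -> r = r'.
Proof.
  intros H H' A A'. pose (t := t0 + (Rmin t1 t1' - t0) / 2).
  assert (M : t0 < Rmin t1 t1') by now apply Rmin_glb_lt.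
  assert (M1 := Rmin_l t1 t1'). assert (M2 := Rmin_r t1 t1').
  destruct (A t) as (x & Hx & Hr); [unfold t; lra|].
  destruct (A' t) as (x' & Hx' & Hr'); [unfold t; lra|].
  rewrite <- (rep_Outside_inj Hx Hx') in Hr'. exact (along_unique Hr Hr').
Qed.

Lemma itinerary_start g T w t0 : itinerary g T w t0 ->
  exists r t1, t0 < t1 <= T /\ runs_along g r t0 t1.
Proof.
  induction 1 as [r t0 H0 H1|r r' w t0 t1 t2 H0 H1 H2 H3 _ (r2 & t3 & IH & _)].
  - exists r, T. split; [lra|exact H1].
  - exists r, t1. split; [lra|exact H1].
Qed.

(** The cores and the outside chart are disjoint, so the path determines the times of
    entry and exit; a point between them determines the chord by [over_unique]. *)
Lemma itinerary_unique g T w t0 : itinerary g T w t0 -> forall w', itinerary g T w' t0 -> w = w'.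
Proof.
  induction 1 as [r t0 H0 H1|r r' w t0 t1 t2 H0 H1 H2 H3 Hit IH]; intros w' H'.
  - inversion H' as [r2 ? A B|r2 r2' w2 ? t1 t2 A B C D Hit]; subst.
    + f_equal. exact (runs_along_unique H0 A H1 B).
    + exfalso. destruct (itinerary_start Hit) as (_ & t3 & Ht3 & _).
      apply (runs_disjoint (t := t1) H1 D); lra.
  - inversion H' as [r2 ? A B|r2 r2' w2 ? t1' t2' A B C D Hit']; subst.
    + exfalso. destruct (itinerary_start Hit) as (_ & t3 & Ht3 & _).
      apply (runs_disjoint (t := t1) B H3); lra.
    + assert (Er := runs_along_unique H0 A H1 B). subst r2.
      assert (E1 : t1 = t1').
      { destruct (Rtotal_order t1 t1') as [F|[F|F]]; [exfalso|exact F|exfalso].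
        - apply (runs_disjoint (t := t1) B H3); lra.
        - apply (runs_disjoint (t := t1') H1 D); lra. }
      subst t1'.
      assert (E2 : t2 = t2').
      { destruct (itinerary_start Hit) as (ra & ta & Hta & Ka).
        destruct (itinerary_start Hit') as (rb & tb & Htb & Kb).
        destruct (Rtotal_order t2 t2') as [F|[F|F]]; [exfalso|exact F|exfalso].
        - pose (t := t2 + (Rmin ta t2' - t2) / 2).
          assert (M : t2 < Rmin ta t2') by (apply Rmin_glb_lt; lra).
          assert (M1 := Rmin_l ta t2'). assert (M2 := Rmin_r ta t2').
          apply (runs_disjoint (t := t) Ka D); unfold t; lra.
        - pose (t := t2' + (Rmin tb t2 - t2') / 2).
          assert (M : t2' < Rmin tb t2) by (apply Rmin_glb_lt; lra).
          assert (M1 := Rmin_l tb t2). assert (M2 := Rmin_r tb t2).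
          apply (runs_disjoint (t := t) Kb H3); unfold t; lra. }
      subst t2'. f_equal. now apply IH.
Qed.

Lemma follows_runs_along g r X t0 t1 : is_chord r -> over e r X -> t1 <= t0 + rise r X ->
  (forall t, t0 <= t <= t1 -> in_column r X (base r X + (t - t0)) (g t)) -> runs_along g r t0 t1.
Proof.
  intros Hr HX H1 H t Ht. unfold rise in H1.
  exists (X, base r X + (t - t0)). split.
  - apply (H t ltac:(lra)); intros _; lra.
  - assert (H0 := zero_le_eps0 (S := S)).
    assert (K : forall b, in_rect e r b (comp_end r b) (offp r b X) (par_end r b + offq r b X)).
    { intros b. apply over_in_rect with 0%Z; auto. ring. }
    assert (E : forall b, Phi (comp_end r b) (0, offp r b X, par_end r b + offq r b X) =
      (X, height r b X)).
    { intros b. rewrite Phi_over; auto using over_eps0. f_equal; ring. }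
    split.
    + exists (offp r false X), (par_end r false + offq r false X), (collar (comp_lo r) + (t - t0)).
      split; [exact (K false)|split].
      * generalize (collar_bounds (comp_lo r)). lra.
      * change (comp_lo r) with (comp_end r false) at 2. rewrite (E false). unfold base, lift_z, c1, c2, c3; destruct X; simpl. f_equal. ring.
    + exists (offp r true X), (par_end r true + offq r true X), (height r true X - (base r X + (t - t0))).
      split; [exact (K true)|split].
      * generalize (collar_bounds (comp_hi r)). unfold roof in H1. lra.
      * change (comp_hi r) with (comp_end r true). rewrite (E true). unfold lift_z, c1, c2, c3; destruct X; simpl. f_equal. ring.
Qed.

Lemma follows_itinerary g T w Xs t0 : orbit w Xs -> follows g T w Xs t0 -> itinerary g T w t0.
Proof.
  intros Ho. revert t0. induction Ho as [r X Hr HX Hc E|r X r' X' w Xs Hr HX Hc Hop Ho IH]; intros t0 Hf.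
  - inversion Hf as [? ? ? ET HF|]; subst.
    assert (Hp := rise_pos Hr HX). constructor; [lra|].
    apply follows_runs_along with X; auto. lra.
  - inversion Hf as [|? ? ? ? ? ? ? HF HC Hf']; subst.
    assert (Hp := rise_pos Hr HX). assert (Hd := dwell_gt r X).
    generalize (eps_range (S := S)); intros He.
    apply itinerary_cons with (t0 + rise r X) (t0 + rise r X + dwell r X); try lra.
    + apply follows_runs_along with X; auto. lra.
    + intros t Ht. exists (comp_hi r), (raise (t - (t0 + rise r X)) (target_pt r X)). split.
      * apply core_point; auto. lra.
      * replace t with (t0 + rise r X + (t - (t0 + rise r X))) at 1 by ring. apply HC. lra.
    + now apply IH.
Qed.

(** All times in [follows] are computed from the points of the orbit. *)
Lemma follows_unique w Xs : orbit w Xs -> forall g g' T T' t0,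
  follows g T w Xs t0 -> follows g' T' w Xs t0 ->
  T = T' /\ t0 <= T /\ forall t, t0 <= t <= T -> g t = g' t.
Proof.
  induction 1 as [r X Hr HX Hc E|r X r' X' w Xs Hr HX Hc Hop Ho IH]; intros g g' T T' t0 Hf Hf'.
  - inversion Hf as [? ? ? ET HF|]; subst. inversion Hf' as [? ? ? ET' HF'|]; subst.
    assert (Hp := rise_pos Hr HX).
    split; [reflexivity|split; [lra|]]. intros t Ht.
    apply in_column_unique with r X (base r X + (t - t0)); auto.
    apply in_range_between with (base r X) (roof r X);
      auto using in_range_base, in_range_roof. unfold rise in Ht; lra.
  - inversion Hf as [|? ? ? ? ? ? ? HF HC Hf1]; subst.
    inversion Hf' as [|? ? ? ? ? ? ? HF' HC' Hf1']; subst.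
    assert (Hp := rise_pos Hr HX). assert (Hd := dwell_gt r X).
    generalize (eps_range (S := S)); intros He.
    destruct (IH _ _ _ _ _ Hf1 Hf1') as (ET & Hle & Hg).
    split; [exact ET|split; [lra|]]. intros t Ht.
    destruct (Rle_or_lt t (t0 + rise r X)) as [H1|H1].
    + apply in_column_unique with r X (base r X + (t - t0)); auto.
      * apply in_range_between with (base r X) (roof r X);
          auto using in_range_base, in_range_roof. unfold rise in H1; lra.
      * apply HF; lra.
      * apply HF'; lra.
    + destruct (Rle_or_lt t (t0 + rise r X + dwell r X)) as [H2|H2].
      * replace t with (t0 + rise r X + (t - (t0 + rise r X))) by ring.
        eapply rep_eq; [apply HC|apply HC']; lra.
      * apply Hg. lra.
Qed.

Lemma Phi_end r b X : is_chord r -> over e r X -> offp r b X = 0 ->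
  lam (comp_end r b) (par_end r b + offq r b X) = (X, height r b X).
Proof.
  intros Hr HX E. rewrite <- Phi_core.
  rewrite <- E at 2. rewrite Phi_over; [f_equal; ring|exact Hr|now apply over_eps0|].
  apply zero_le_eps0.
Qed.

Lemma follows_start g T r w X Xs t0 : orbit (r :: w) (X :: Xs) -> follows g T (r :: w) (X :: Xs) t0 ->
  in_column r X (base r X) (g t0).
Proof.
  intros Ho Hf. replace (base r X) with (base r X + (t0 - t0)) by ring.
  assert (Hp := rise_pos (tail_word_chord (orbit_tail_word Ho)) (orbit_over Ho)).
  inversion Hf as [? ? ? ET HF|? ? ? ? ? ? ? HF HC Hf1]; subst; apply HF; lra.
Qed.

Lemma start_on_Lambda0 g T r w X Xs t0 : orbit (r :: w) (X :: Xs) -> follows g T (r :: w) (X :: Xs) t0 ->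
  coef (comp_lo r) = 0%Z -> offp r false X = 0 ->
  rep (g t0) (Outside (X, height r false X)) /\
  lam (comp_lo r) (par_end r false + offq r false X) = (X, height r false X).
Proof.
  intros Ho Hf Hc E.
  assert (Hr := tail_word_chord (orbit_tail_word Ho)). assert (HX := orbit_over Ho).
  assert (Eb : base r X = height r false X) by (unfold base; rewrite collar_0 by exact Hc; ring).
  split.
  - destruct (follows_start Ho Hf) as [K _]. rewrite <- Eb. apply K.
    + intros F; contradiction.
    + intros _. generalize (rise_pos Hr HX). unfold rise. lra.
  - exact (Phi_end Hr HX E).
Qed.

Lemma end_on_Lambda0 w Xs : orbit w Xs -> forall g T t0, follows g T w Xs t0 -> on_Lambda0 (g T).
Proof.
  induction 1 as [r X Hr HX Hc E|r X r' X' w Xs Hr HX Hc Hop Ho IH]; intros g T t0 Hf.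
  - inversion Hf as [? ? ? ET HF|]; subst. assert (Hp := rise_pos Hr HX).
    exists (comp_hi r), (par_end r true + offq r true X). split; [exact Hc|].
    change (comp_hi r) with (comp_end r true). rewrite (Phi_end Hr HX E).
    destruct (HF (t0 + rise r X)) as [K _]; [lra|].
    replace (base r X + (t0 + rise r X - t0)) with (height r true X) in K.
    + apply K.
      * intros _. unfold rise, roof in Hp. rewrite collar_0 in Hp by exact Hc. lra.
      * intros F; contradiction.
    + unfold rise, roof. rewrite (collar_0 (i := comp_hi r)) by exact Hc. ring.
  - inversion Hf as [|? ? ? ? ? ? ? HF HC Hf1]; subst. now apply IH with (1 := Hf1).
Qed.

Lemma follows_shift w Xs : orbit w Xs -> forall g g' T t0 a, follows g T w Xs t0 ->
  (forall t, t0 <= t -> g' (t + a) = g t) -> follows g' (T + a) w Xs (t0 + a).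
Proof.
  induction 1 as [r X Hr HX Hc E|r X r' X' w Xs Hr HX Hc Hop Ho IH]; intros g g' T t0 a Hf Hg.
  - inversion Hf as [? ? ? ET HF|]; subst. constructor; [ring|]. intros t Ht.
    replace t with (t - a + a) at 2 by ring. rewrite Hg by lra.
    replace (t - (t0 + a)) with (t - a - t0) by ring. apply HF. lra.
  - inversion Hf as [|? ? ? ? ? ? ? HF HC Hf1]; subst.
    assert (Hp := rise_pos Hr HX). assert (Hd := dwell_gt r X).
    generalize (eps_range (S := S)); intros He. constructor.
    + intros t Ht. replace t with (t - a + a) at 2 by ring. rewrite Hg by lra.
      replace (t - (t0 + a)) with (t - a - t0) by ring. apply HF. lra.
    + intros t Ht. replace (t0 + a + rise r X + t) with (t0 + rise r X + t + a) by ring.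
      rewrite Hg by lra. apply HC. lra.
    + replace (t0 + a + rise r X + dwell r X) with (t0 + rise r X + dwell r X + a) by ring.
      apply IH with g; [exact Hf1|]. intros t Ht. apply Hg. lra.
Qed.

(** Columns and cores are trajectories and fit together by [hop_point]. *)
Lemma orbit_trajectory w Xs : orbit w Xs -> exists T g, 0 < T /\ Reeb_trajectory T g /\ follows g T w Xs 0.
Proof.
  induction 1 as [r X Hr HX Hc E|r X r' X' w Xs Hr HX Hc Hop Ho (T2 & g2 & HT2 & Hg2 & Hf2)];
    assert (Hp := rise_pos Hr HX);
    destruct (@column_path S G r X (base r X) (rise r X)) as (g1 & Hg1 & K1); auto using in_range_base;
    try lra;
    try (replace (base r X + rise r X) with (roof r X) by (unfold rise; ring); now apply in_range_roof).
  - exists (rise r X), g1. split; [exact Hp|split; [exact Hg1|]]. constructor; [ring|].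
    intros t Ht. rewrite Rminus_0_r. now apply K1.
  - destruct (core_path Hr HX Hc) as (gc & Hgc & Kc).
    assert (Hd := dwell_gt r X). generalize (eps_range (S := S)); intros He.
    assert (E1 : g1 (rise r X) = gc 0).
    { assert (A := Kc 0 ltac:(lra)). rewrite raise_0 in A.
      apply rep_eq with (2 := A). apply (K1 (rise r X) ltac:(lra)); [exact Hc|]. unfold rise; ring. }
    assert (E2 : gc (dwell r X) = g2 0).
    { assert (A := Kc (dwell r X) ltac:(lra)).
      destruct (follows_start Ho Hf2) as (_ & B & _).
      destruct Hop as (Ec & Hop').
      assert (Hc' : coef (comp_lo r') <> 0%Z) by now rewrite <- Ec.
      specialize (B Hc' eq_refl). rewrite <- Ec in B.
      apply rep_eq with (2 := B). apply rep_Inside_mod with (2 := A).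
      apply hop_point. split; [exact Ec|exact Hop']. }
    pose (gd := join_at (dwell r X) gc g2).
    assert (Hgd : Reeb_trajectory (dwell r X + T2) gd) by (apply join_trajectory; auto; lra).
    assert (E3 : g1 (rise r X) = gd 0) by (unfold gd; rewrite join_left; [exact E1|lra]).
    exists (rise r X + (dwell r X + T2)), (join_at (rise r X) g1 gd).
    split; [lra|split; [apply join_trajectory; auto; lra|]]. constructor.
    + intros t Ht. rewrite join_left by lra. rewrite Rminus_0_r. apply K1. lra.
    + intros t Ht. rewrite join_right by (auto; lra).
      replace (0 + rise r X + t - rise r X) with t by ring.
      unfold gd. rewrite join_left by lra. now apply Kc.
    + replace (rise r X + (dwell r X + T2)) with (T2 + (rise r X + dwell r X)) by ring.
      replace (0 + rise r X + dwell r X) with (0 + (rise r X + dwell r X)) by ring.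
      apply (follows_shift Ho Hf2). intros t Ht.
      rewrite join_right by (auto; lra).
      replace (t + (rise r X + dwell r X) - rise r X) with (t + dwell r X) by ring.
      unfold gd. rewrite join_right by (auto; lra). f_equal. ring.
Qed.

Lemma chord_follows k : exists r w X Xs,
  orbit (r :: w) (X :: Xs) /\ follows (traj k) (len k) (r :: w) (X :: Xs) 0 /\
  coef (comp_lo r) = 0%Z /\ offp r false X = 0.
Proof.
  destruct (traj_start k) as (i & q & Hc & Hs).
  generalize (eps_range (S := S)) (len_pos k); intros He Hl.
  destruct (nfloor_ex (len k / e)) as [N HN].
  { apply Rdiv_le_0_compat; lra. }
  destruct (trajectory_follows (@traj_Reeb S k) (traj_end k) (N := Datatypes.S N) (t0 := 0) (i := i) (p := 0) (q := q))
    as (r & w & X & Xs & Ho & Hf & Ei & Ep & _).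
  - lra.
  - rewrite S_INR. apply Rmult_le_reg_r with (/ e); [apply Rinv_0_lt_compat; lra|].
    replace ((INR N + 1) * e * / e) with (INR N + 1) by (field; lra). unfold Rdiv in HN. lra.
  - rewrite Rabs_R0; lra.
  - left. split; [exact Hc|split; [reflexivity|]]. now rewrite Phi_core.
  - exists r, w, X, Xs. repeat split; auto. now rewrite Ei.
Qed.

Lemma chord_word_unique k w w' : has_word k w -> has_word k w' -> w = w'.
Proof. rewrite !has_word_itinerary. intros H H'. exact (itinerary_unique H H'). Qed.

Lemma chord_has_word k : exists w, has_word k w /\ is_word w.
Proof.
  destruct (chord_follows k) as (r & w & X & Xs & Ho & Hf & Hc & E).
  exists (r :: w). split.
  - apply has_word_itinerary. now apply follows_itinerary with (X :: Xs).
  - apply is_word_tail_word. exists r, w. split; [reflexivity|split; [exact Hc|]].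
    exact (orbit_tail_word Ho).
Qed.

(** The word determines the orbit, by [orbit_unique]. *)
Lemma has_word_follows k r w X Xs : has_word k (r :: w) -> orbit (r :: w) (X :: Xs) ->
  offp r false X = 0 -> follows (traj k) (len k) (r :: w) (X :: Xs) 0.
Proof.
  intros Hw Ho E.
  destruct (chord_follows k) as (r' & w' & X' & Xs' & Ho' & Hf' & Hc' & E').
  assert (Hw' : has_word k (r' :: w')).
  { apply has_word_itinerary. now apply follows_itinerary with (X' :: Xs'). }
  assert (Ew := chord_word_unique Hw Hw'). injection Ew as <- <-.
  assert (EX := orbit_unique Ho Ho' (eq_trans E (eq_sym E'))). rewrite EX. exact Hf'.
Qed.

Lemma chord_unique k k' w : has_word k w -> has_word k' w -> same_chord k k'.
Proof.
  intros Hw Hw'.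
  destruct (chord_follows k) as (r & w0 & X & Xs & Ho & Hf & Hc & E).
  assert (Hw0 : has_word k (r :: w0)).
  { apply has_word_itinerary. now apply follows_itinerary with (X :: Xs). }
  rewrite (chord_word_unique Hw Hw0) in Hw'.
  destruct (follows_unique Ho Hf (has_word_follows Hw' Ho E)) as (A & _ & B).
  split; assumption.
Qed.

Lemma word_has_chord w : is_word w -> exists k, has_word k w.
Proof.
  intros Hw. apply is_word_tail_word in Hw. destruct Hw as (r & w' & -> & Hc & Hw).
  destruct (orbit_exists Hw) as (X & Xs & Ho & E).
  destruct (orbit_trajectory Ho) as (T & g & HT & Hg & Hf).
  assert (Hs : on_Lambda0 (g 0)).
  { destruct (start_on_Lambda0 Ho Hf Hc E) as [A B].
    exists (comp_lo r), (par_end r false + offq r false X). split; [exact Hc|]. now rewrite B. }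
  exists (ReebChord HT Hg Hs (end_on_Lambda0 Ho Hf)).
  apply has_word_itinerary. simpl. now apply follows_itinerary with (X :: Xs).
Qed.

End Words.

(** * The linearized flow *)

Section Nondegeneracy.
Context {S : surgery} {G : good_surgery S}.
Implicit Types (r : vchord S) (b : bool) (X Y : R * R) (p q t h T : R) (i : comp S)
  (w : list (vchord S)) (P Q : surgered S) (g : R -> surgered S) (k : Reeb_chord S).

Local Notation e := (eps S).

Lemma column_flow r Y h T P : is_chord r -> over e r Y -> 0 <= T ->
  in_range r Y h -> in_range r Y (h + T) -> in_column r Y h P ->
  exists Q, in_column r Y (h + T) Q /\ Reeb_flow T P Q.
Proof.
  intros Hr HY HT H1 H2 HP.
  destruct (column_path Hr HY HT H1 H2) as (g & Hg & K).
  exists (g T). split; [apply K; lra|]. exists g. split; [exact Hg|split; [|reflexivity]].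
  apply in_column_unique with r Y h; auto. rewrite <- (Rplus_0_r h) at 1. apply K; lra.
Qed.

Lemma in_column_interior r Y h P : is_chord r -> over e r Y -> above_base r Y h -> below_roof r Y h ->
  rep P (Outside (Y, h)) -> in_column r Y h P.
Proof.
  intros Hr HY Ha Hb HP. split; [auto|split; intros Hc E; exfalso].
  - specialize (Ha Hc). lra.
  - specialize (Hb Hc). lra.
Qed.

Lemma in_range_interior r Y h : above_base r Y h -> below_roof r Y h -> in_range r Y h.
Proof. intros Ha Hb. split; intros Hc; [specialize (Ha Hc)|specialize (Hb Hc)]; lra. Qed.

(** The duration depends on the initial and the final height; with it, nearby points
    can be compared at a common time. *)
Lemma handle_flow r r' Y Y' h h' P : is_chord r -> is_chord r' -> over e r Y -> over e r' Y' ->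
  hop r Y r' Y' -> coef (comp_hi r) <> 0%Z -> above_base r Y h -> h < roof r Y ->
  base r' Y' < h' -> below_roof r' Y' h' -> rep P (Outside (Y, h)) ->
  exists Q, rep Q (Outside (Y', h')) /\
    Reeb_flow (roof r Y - h + dwell r Y + (h' - base r' Y')) P Q.
Proof.
  intros Hr Hr' HY HY' Hop Hc Ha Hb Ha' Hb' HP.
  generalize (dwell_gt r Y) (eps_range (S := S)); intros Hd He.
  assert (Eb : comp_hi r = comp_lo r') by apply Hop.
  assert (Hc' : coef (comp_lo r') <> 0%Z) by now rewrite <- Eb.
  destruct (@column_flow r Y h (roof r Y - h) P) as (Q1 & K1 & F1); auto; try lra.
  - apply in_range_interior; [exact Ha|intros _; exact Hb].
  - replace (h + (roof r Y - h)) with (roof r Y) by ring. now apply in_range_roof.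
  - apply in_column_interior; auto. intros _; exact Hb.
  - replace (h + (roof r Y - h)) with (roof r Y) in K1 by ring.
    destruct K1 as (_ & _ & K1). specialize (K1 Hc eq_refl).
    destruct (core_path Hr HY Hc) as (gc & Hgc & Kc).
    assert (F2 : Reeb_flow (dwell r Y) Q1 (gc (dwell r Y))).
    { exists gc. split; [exact Hgc|split; [|reflexivity]].
      assert (A := Kc 0 ltac:(lra)). rewrite raise_0 in A. exact (rep_eq A K1). }
    assert (A := Kc (dwell r Y) ltac:(lra)).
    assert (A' := rep_Inside_mod (hop_point Hop) A). rewrite Eb in A'.
    destruct (@column_flow r' Y' (base r' Y') (h' - base r' Y') (gc (dwell r Y))) as (Q3 & K3 & F3);
      auto using in_range_base; try lra.
    + replace (base r' Y' + (h' - base r' Y')) with h' by ring.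
      apply in_range_interior; [intros _; exact Ha'|exact Hb'].
    + assert (Hp := rise_pos Hr' HY'). unfold rise in Hp.
      split; [|split; auto].
      * intros F _. specialize (F Hc'). lra.
      * intros _ F. lra.
    + replace (base r' Y' + (h' - base r' Y')) with h' in K3 by ring.
      exists Q3. split; [apply K3; [intros _; exact Ha'|exact Hb']|].
      apply Reeb_flow_trans with (gc (dwell r Y)); [lra|lra| |exact F3].
      apply Reeb_flow_trans with Q1; [lra|lra|exact F1|exact F2].
Qed.

Section OneHandle.
Context (r r' : vchord S) (n : Z) (tau : R).

Let c := IZR (coef (comp_hi r)).

(** For a fixed integer [n] the passage through a handle is an explicit map of the
    plane.  With the change [hop_jump] of the height, [hop_flow] is the flow for the
    time [tau]. *)
Definition hop_q Y : R :=
  par_end r true + offq r true Y + c * feps S (offp r true Y) + IZR n - par_end r' false.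
Definition hop_map Y : R * R :=
  (fst (ctr r') + hop_q Y * fst (dir r' false) + offp r true Y * snd (dir r' false),
   snd (ctr r') + hop_q Y * snd (dir r' false) - offp r true Y * fst (dir r' false)).
Definition hop_jump Y : R :=
  height r' false (hop_map Y) - height r true Y - c * heps S (offp r true Y).
Definition hop_flow (x : R3) : R3 := (hop_map (fst x), snd x + tau + hop_jump (fst x)).

Definition hop_dq X (v : R * R) : R :=
  lq r true v + c * (Derive (feps S) (offp r true X) * lp r true v).
Definition hop_dmap X (v : R * R) : R * R :=
  (hop_dq X v * fst (dir r' false) + lp r true v * snd (dir r' false),
   hop_dq X v * snd (dir r' false) - lp r true v * fst (dir r' false)).
Definition hop_dflow X (v : R3) : R3 :=
  (hop_dmap X (fst v),
   snd v + (snd (hop_map X) * fst (hop_dmap X (fst v)) - snd X * fst (fst v))).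

Lemma hop_map_off Y : offp r' false (hop_map Y) = offp r true Y /\ offq r' false (hop_map Y) = hop_q Y.
Proof. exact (offpq_eq r' false (offp r true Y) (hop_q Y)). Qed.

Lemma hop_map_hop Y : comp_hi r = comp_lo r' -> hop r Y r' (hop_map Y).
Proof.
  intros E. destruct (hop_map_off Y) as [A B].
  split; [exact E|split; [exact A|]]. exists n. rewrite B. unfold hop_q. fold c. ring.
Qed.

Lemma hop_dmap_off X v : lp r' false (hop_dmap X v) = lp r true v /\
  lq r' false (hop_dmap X v) = hop_dq X v.
Proof.
  generalize (dir_unit r' false). unfold lp at 1, lq at 1, hop_dmap, J0, dot2.
  destruct (dir r' false) as [a d]; simpl. intros U. split.
  - transitivity (lp r true v * (a * a + d * d)); [ring|rewrite U; ring].
  - transitivity (hop_dq X v * (a * a + d * d)); [ring|rewrite U; ring].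
Qed.

Lemma sdiff_hop_q (X : R2m) : sdiff (fun Y : R2m => hop_q Y) X (hop_dq X).
Proof.
  unfold hop_q. apply sdiff_ext_lin with (fun v : R2m => 0 + lq r true v +
     c * (Derive (feps S) (offp r true X) * lp r true v) + 0 - 0).
  - apply sdiff_minus; [|apply sdiff_const]. apply sdiff_plus; [|apply sdiff_const].
    apply sdiff_plus.
    + apply sdiff_plus; [apply sdiff_const|apply sdiff_offq].
    + apply sdiff_scal. apply sdiff_chain; [|apply sdiff_offp].
      rewrite Derive_feps. apply feps_derive.
  - intros v. unfold hop_dq. ring.
Qed.

Lemma filterdiff_hop_map (X : R2m) :
  @filterdiff R_AbsRing R2m R2m hop_map (locally X) (hop_dmap X).
Proof.
  apply (@sdiff_pair R2m R_NormedModule R_NormedModule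
    (fun Y => fst (ctr r') + hop_q Y * fst (dir r' false) + offp r true Y * snd (dir r' false))
    (fun Y => snd (ctr r') + hop_q Y * snd (dir r' false) - offp r true Y * fst (dir r' false)) X
    (fun v => hop_dq X v * fst (dir r' false) + lp r true v * snd (dir r' false))
    (fun v => hop_dq X v * snd (dir r' false) - lp r true v * fst (dir r' false))).
  - apply (@sdiff_ext R2m (fun Y => fst (ctr r') + fst (dir r' false) * hop_q Y + snd (dir r' false) * offp r true Y)).
    { intros Y; ring. }
    apply sdiff_ext_lin with (fun v : R2m => 0 + fst (dir r' false) * hop_dq X v + snd (dir r' false) * lp r true v).
    + apply sdiff_plus; [apply sdiff_plus; [apply sdiff_const|]|]; apply sdiff_scal.
      * apply sdiff_hop_q.
      * apply sdiff_offp.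
    + intros v; ring.
  - apply (@sdiff_ext R2m (fun Y => snd (ctr r') + snd (dir r' false) * hop_q Y - fst (dir r' false) * offp r true Y)).
    { intros Y; ring. }
    apply sdiff_ext_lin with (fun v : R2m => 0 + snd (dir r' false) * hop_dq X v - fst (dir r' false) * lp r true v).
    + apply sdiff_minus; [apply sdiff_plus; [apply sdiff_const|]|]; apply sdiff_scal.
      * apply sdiff_hop_q.
      * apply sdiff_offp.
    + intros v; ring.
Qed.

(** The terms p dq of the two strands and of the twist cancel: the flow preserves the
    contact form. *)
Lemma sdiff_hop_jump (X : R2m) : is_chord r -> is_chord r' -> over e r X -> over e r' (hop_map X) ->
  sdiff (fun Y : R2m => hop_jump Y) X
    (fun v => snd (hop_map X) * fst (hop_dmap X v) - snd X * fst v).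
Proof.
  intros Hr Hr' HX HX'. unfold hop_jump.
  assert (H1 := height_differential true eps_lt Hr HX).
  assert (H2 := height_differential false eps_lt Hr' HX').
  assert (H3 := @filterdiff_comp' R_AbsRing R2m R2m R_NormedModule hop_map
    (fun Y => height r' false Y) X _ _ (filterdiff_hop_map X) H2).
  apply sdiff_ext_lin with (fun v : R2m =>
    (offp r' false (hop_map X) * lq r' false (hop_dmap X v) + snd (hop_map X) * fst (hop_dmap X v))
    - (offp r true X * lq r true v + snd X * fst v)
    - c * ((offp r true X * Derive (feps S) (offp r true X)) * lp r true v)).
  - apply sdiff_minus; [apply sdiff_minus; [exact H3|exact H1]|].
    apply sdiff_scal. apply sdiff_chain; [apply heps_derive|apply sdiff_offp].
  - intros v. destruct (hop_map_off X) as [A _]. destruct (hop_dmap_off X v) as [_ B].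
    rewrite A, B. unfold hop_dq. ring.
Qed.

Lemma sdiff_on_fst (f : R2m -> R) (X : R2m) h l : sdiff f X l ->
  sdiff (fun x : R3m => f (fst x)) ((X, h) : R3m) (fun v => l (fst v)).
Proof.
  intros Hf. apply (@filterdiff_comp' R_AbsRing R3m R2m R_NormedModule fst f (X, h) fst l); [|exact Hf].
  apply filterdiff_linear, is_linear_fst.
Qed.

Lemma sdiff_height_coord (x : R3m) : sdiff (fun y : R3m => snd y : R) x (fun v => snd v).
Proof. apply (@filterdiff_linear R_AbsRing R3m R_NormedModule), is_linear_snd. Qed.

Lemma filterdiff_hop_flow (X : R2m) h : is_chord r -> is_chord r' -> over e r X -> over e r' (hop_map X) ->
  @filterdiff R_AbsRing R3m R3m hop_flow (locally ((X, h) : R3m)) (hop_dflow X).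
Proof.
  intros Hr Hr' HX HX'.
  apply (@sdiff_pair R3m R2m R_NormedModule (fun x => hop_map (fst x))
    (fun x => snd x + tau + hop_jump (fst x)) (X, h) (fun v => hop_dmap X (fst v))
    (fun v => snd v + (snd (hop_map X) * fst (hop_dmap X (fst v)) - snd X * fst (fst v)))).
  - apply (@filterdiff_comp' R_AbsRing R3m R2m R2m fst hop_map (X, h) fst (hop_dmap X)).
    + apply filterdiff_linear, is_linear_fst.
    + apply filterdiff_hop_map.
  - apply sdiff_ext_lin with (fun v : R3m => snd v + 0 +
      (snd (hop_map X) * fst (hop_dmap X (fst v)) - snd X * fst (fst v))).
    + apply sdiff_plus; [apply sdiff_plus; [apply sdiff_height_coord|apply sdiff_const]|].
      apply (@sdiff_on_fst (fun Y => hop_jump Y) X h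
        (fun v => snd (hop_map X) * fst (hop_dmap X v) - snd X * fst v)).
      now apply sdiff_hop_jump.
    + intros v. ring.
Qed.

Lemma hop_dflow_contact X h h' v :
  alpha_std (hop_map X, h') (hop_dflow X v) = alpha_std (X, h) v.
Proof.
  unfold alpha_std, c1, c2, c3, hop_dflow; simpl. ring.
Qed.

End OneHandle.

Lemma orbit_true_small r w X Xs : orbit (r :: w) (X :: Xs) -> Rabs (offp r true X) < e / 2.
Proof.
  intros H. generalize (eps_range (S := S)); intros He.
  inversion H as [? ? Hr HX Hc E|? ? r' X' w' Xs' Hr HX Hc Hop Ho]; subst.
  - rewrite E, Rabs_R0. lra.
  - destruct (turning Hr (tail_word_chord (orbit_tail_word Ho)) (proj1 Hop) Hc) as (beta & _ & K & _).
    apply (K X X' HX (orbit_over Ho) Hop).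
Qed.

Lemma follows_duration g T r w X Xs t0 : orbit (r :: w) (X :: Xs) ->
  follows g T (r :: w) (X :: Xs) t0 -> t0 + rise r X <= T.
Proof.
  intros Ho Hf. inversion Hf as [? ? ? ET HF|? ? ? ? ? ? ? HF HC Hf1]; subst; [lra|].
  inversion Ho; subst.
  match goal with K : orbit _ _ |- _ => destruct (follows_unique K Hf1 Hf1) as (_ & A & _) end.
  generalize (dwell_gt r X) (eps_range (S := S)). lra.
Qed.

Lemma strict_over r X : is_chord r -> Rabs (offp r false X) < e -> Rabs (offp r true X) < e ->
  forall b, Rabs (offq r b X) < e.
Proof.
  intros Hr H1 H2 [|].
  - change true with (negb false). now rewrite <- Rabs_offp.
  - change false with (negb true). now rewrite <- Rabs_offp.
Qed.

Lemma locally_fst (A : R * R -> Prop) (X : R2m) h : locally X (fun Y => A Y) ->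
  locally ((X, h) : R3m) (fun x : R3m => A (fst x)).
Proof.
  intros [d H]. exists d. intros x [Hx _]. apply H. exact Hx.
Qed.

Lemma base_continuous r (X : R2m) : is_chord r -> over e r X -> continuous (fun Y : R2m => base r Y) X.
Proof.
  intros Hr HX. apply sdiff_continuous with (fun v => (offp r false X * lq r false v + snd X * fst v) + 0).
  apply sdiff_plus; [|apply sdiff_const]. exact (height_differential false eps_lt Hr HX).
Qed.

Lemma roof_continuous r (X : R2m) : is_chord r -> over e r X -> continuous (fun Y : R2m => roof r Y) X.
Proof.
  intros Hr HX. apply sdiff_continuous with (fun v => (offp r true X * lq r true v + snd X * fst v) - 0).
  apply sdiff_minus; [|apply sdiff_const]. exact (height_differential true eps_lt Hr HX).
Qed.

Lemma continuous_locally_lt (U : UniformSpace) (f h : U -> R) (x : U) :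
  continuous f x -> continuous h x -> f x < h x -> locally x (fun y => f y < h y).
Proof.
  intros Hf Hh Hlt. pose (m := (f x + h x) / 2).
  assert (A := continuous_lt (c := m) Hf ltac:(unfold m; lra)).
  assert (B := continuous_gt (c := m) Hh ltac:(unfold m; lra)).
  generalize (filter_and _ _ A B). apply filter_imp. intros y [C D]. lra.
Qed.

Lemma continuous_on_fst (f : R2m -> R) (X : R2m) h : continuous f X ->
  continuous (fun x : R3m => f (fst x)) ((X, h) : R3m).
Proof.
  intros Hf. apply (@continuous_comp R3m R2m R_UniformSpace fst f); [|exact Hf].
  apply (@continuous_fst R2m R_UniformSpace).
Qed.

Lemma height_coord_continuous (x : R3m) : continuous (fun y : R3m => snd y : R) x.
Proof. exact (sdiff_continuous (sdiff_height_coord x)). Qed.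

Lemma above_base_locally r (X : R2m) h : is_chord r -> over e r X -> above_base r X h ->
  locally ((X, h) : R3m) (fun x : R3m => above_base r (fst x) (snd x)).
Proof.
  intros Hr HX Ha. destruct (Z.eq_dec (coef (comp_lo r)) 0) as [E|N].
  - apply filter_forall. intros x F. contradiction.
  - generalize (@continuous_locally_lt R3m (fun x => base r (fst x)) (fun x => snd x) (X, h)
      (@continuous_on_fst (fun Y : R2m => base r Y) X h (base_continuous Hr HX)) (@height_coord_continuous (X, h)) (Ha N)).
    apply filter_imp. intros x Hx _. exact Hx.
Qed.

Lemma below_roof_locally r (X : R2m) h : is_chord r -> over e r X -> below_roof r X h ->
  locally ((X, h) : R3m) (fun x : R3m => below_roof r (fst x) (snd x)).
Proof.
  intros Hr HX Ha. destruct (Z.eq_dec (coef (comp_hi r)) 0) as [E|N].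
  - apply filter_forall. intros x F. contradiction.
  - generalize (@continuous_locally_lt R3m (fun x => snd x) (fun x => roof r (fst x)) (X, h)
      (@height_coord_continuous (X, h)) (@continuous_on_fst (fun Y : R2m => roof r Y) X h (roof_continuous Hr HX)) (Ha N)).
    apply filter_imp. intros x Hx _. exact Hx.
Qed.

(** Columns contain a neighborhood of the orbit, so nearby points pass the same
    handles and the flow is a composition of the maps [hop_flow].  The last clause is
    the growth of [hop_growth] for the differential. *)
Lemma orbit_local_flow w Xs : orbit w Xs -> forall g T t0, follows g T w Xs t0 ->
  match w, Xs with
  | r :: _, X :: _ => forall h, above_base r X h -> below_roof r X h -> h <= roof r X ->
     Rabs (offp r false X) < e ->
     exists (rl : vchord S) Xl, is_chord rl /\ over e rl Xl /\ coef (comp_hi rl) = 0%Z /\ offp rl true Xl = 0 /\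
     rep (g T) (Outside (Xl, height rl true Xl)) /\
     exists F D : R3 -> R3, F (X, h) = (Xl, height rl true Xl) /\
       locally ((X, h) : R3m) (fun x => forall P, rep P (Outside x) ->
         exists Q, rep Q (Outside (F x)) /\ Reeb_flow (T - t0 - (h - base r X)) P Q) /\
       @filterdiff R_AbsRing R3m R3m F (locally ((X, h) : R3m)) D /\
       (forall v, alpha_std (F (X, h)) (D v) = alpha_std (X, h) v) /\
       (forall v, lp r true (fst v) <> 0 ->
          Rabs (lp r false (fst v)) <= Rabs (lp r true (fst v)) ->
          lp rl true (fst (D v)) <> 0)
  | _, _ => True
  end.
Proof.
  induction 1 as [r X Hr HX Hc E|r X r' X' w Xs Hr HX Hc Hop Ho IH];
    intros g T t0 Hf h Ha Hb Hh Hsmall; generalize (eps_range (S := S)); intros He.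
  - inversion Hf as [? ? ? ET HF|]; subst. assert (Hp := rise_pos Hr HX).
    assert (Er : roof r X = height r true X).
    { unfold roof. rewrite collar_0 by exact Hc. ring. }
    exists r, X. split; [exact Hr|split; [exact HX|split; [exact Hc|split; [exact E|split]]]].
    { assert (K := HF (t0 + rise r X) ltac:(lra)).
      replace (base r X + (t0 + rise r X - t0)) with (roof r X) in K by (unfold rise; ring).
      rewrite <- Er. apply K; [|intros F; contradiction]. intros _. unfold rise in Hp; lra. }
    pose (a := roof r X - h).
    replace (t0 + rise r X - t0 - (h - base r X)) with a by (unfold a, rise; ring).
    exists (fun x => (fst x, snd x + a)), (fun v => (fst v, snd v)).
    split; [|split; [|split; [|split]]].
    + simpl. f_equal. unfold a. lra.
    + assert (HX1 : locally X (fun Y : R2m => forall b, Rabs (offq r b Y) < e)).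
      { apply over_locally, strict_over; auto. rewrite E, Rabs_R0. lra. }
      generalize (filter_and _ _ (locally_fst h HX1) (above_base_locally Hr HX Ha)).
      apply filter_imp. intros [Y h1] [HY HaY] P HP. simpl in HY, HaY.
      assert (HY' : over e r Y) by (intros b; apply Rlt_le, HY).
      assert (HbY : forall h2, below_roof r Y h2) by (intros h2 F; contradiction).
      assert (HaY' : above_base r Y (h1 + a)).
      { intros F. specialize (HaY F). unfold a; lra. }
      destruct (@column_flow r Y h1 a P Hr HY') as (Q & HQ & HFQ); auto.
      * unfold a; lra.
      * now apply in_range_interior.
      * now apply in_range_interior.
      * now apply in_column_interior.
      * exists Q. split; [now apply HQ|exact HFQ].
    + apply (@sdiff_pair R3m R2m R_NormedModule (fun x => fst x) (fun x => snd x + a) (X, h) fst snd).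
      * apply filterdiff_linear, is_linear_fst.
      * apply sdiff_ext_lin with (fun v : R3m => snd v + 0); [|intros; apply Rplus_0_r].
        apply sdiff_plus; [apply sdiff_height_coord|apply sdiff_const].
    + intros v. unfold alpha_std, c1, c2, c3; simpl. ring.
    + intros v Hv _. exact Hv.
  - inversion Hf as [|? ? ? ? ? ? ? HF HC Hf']; subst.
    assert (Hr' := tail_word_chord (orbit_tail_word Ho)). assert (HX' := orbit_over Ho).
    assert (Hp' := rise_pos Hr' HX'). unfold rise in Hp'.
    destruct (turning Hr Hr' (proj1 Hop) Hc) as (beta & _ & Kt & _).
    destruct (Kt X X' HX HX' Hop) as (Hv & Hde & _). clear Kt.
    destruct Hop as (Ec & Ep & n & En).
    pose (h' := (base r' X' + roof r' X') / 2).
    pose (tau := roof r X - h + dwell r X + (h' - base r' X')).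
    assert (Ha' : above_base r' X' h') by (intros _; unfold h'; lra).
    assert (Hb' : below_roof r' X' h') by (intros _; unfold h'; lra).
    assert (Hsmall' : Rabs (offp r' false X') < e) by (rewrite Ep; lra).
    destruct (IH _ _ _ Hf' h' Ha' Hb' ltac:(unfold h'; lra) Hsmall') as
      (rl & Xl & Hrl & HXl & Hcl & Epl & HTl & F & D & EF & HL & HD & HA & HG). clear IH.
    assert (EB : hop_map r r' n X = X').
    { destruct (hop_map_off r r' n X) as [A B]. apply plane_point_eq with r' false; [congruence|].
      rewrite B. unfold hop_q. lra. }
    assert (HBX : over e r' (hop_map r r' n X)) by now rewrite EB.
    assert (Hc' : coef (comp_lo r') <> 0%Z) by now rewrite <- Ec.
    assert (EJ : forall Y, hop_jump r r' n Y = base r' (hop_map r r' n Y) - roof r Y - dwell r Y).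
    { intros Y. unfold hop_jump, base, roof, dwell, ceil. rewrite !collar_eps by assumption. ring. }
    assert (EG : hop_flow r r' n tau (X, h) = (X', h')).
    { unfold hop_flow. simpl. rewrite EJ, EB. f_equal. unfold tau. ring. }
    assert (HdG := @filterdiff_hop_flow r r' n tau X h Hr Hr' HX HBX).
    assert (HcG : continuous (hop_flow r r' n tau : R3m -> R3m) ((X, h) : R3m)).
    { apply (@filterdiff_continuous R_AbsRing R3m R3m). now exists (hop_dflow r r' n X). }
    exists rl, Xl. do 5 (split; [assumption|]).
    exists (fun x => F (hop_flow r r' n tau x)), (fun v => D (hop_dflow r r' n X v)).
    split; [|split; [|split; [|split]]].
    + now rewrite EG.
    +
      assert (Lback : forall A : R3 -> Prop, locally ((X', h') : R3m) (fun y => A y) ->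
        locally ((X, h) : R3m) (fun x : R3m => A (hop_flow r r' n tau x))).
      { intros A HA'. apply HcG. change (locally (hop_flow r r' n tau (X, h) : R3m) (fun y => A y)).
        rewrite EG. exact HA'. }
      assert (L1 : locally X (fun Y : R2m => forall b, Rabs (offq r b Y) < e)).
      { apply over_locally, strict_over; auto. lra. }
      assert (L2 : locally X' (fun Y : R2m => forall b, Rabs (offq r' b Y) < e)).
      { apply over_locally, strict_over; auto. generalize (orbit_true_small Ho); lra. }
      generalize (filter_and _ _ (locally_fst h L1)
        (filter_and _ _ (Lback _ (locally_fst h' L2))
        (filter_and _ _ (above_base_locally Hr HX Ha)
        (filter_and _ _ (below_roof_locally Hr HX Hb)
        (filter_and _ _ (Lback _ (above_base_locally Hr' HX' Ha'))
        (filter_and _ _ (Lback _ (below_roof_locally Hr' HX' Hb')) (Lback _ HL))))))).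
      apply filter_imp. intros [Y h1] (M1 & M2 & M3 & M4 & M5 & M6 & M7) P HP.
      unfold fst, snd in M1, M3, M4. fold (fst Y) (snd Y) in *.
      set (Y' := hop_map r r' n Y) in *. 
      pose (h2 := h1 + tau + hop_jump r r' n Y).
      change (hop_flow r r' n tau (Y, h1)) with (Y', h2) in *.
      change (fst (Y', h2)) with Y' in *. change (snd (Y', h2)) with h2 in *.
      destruct (@handle_flow r r' Y Y' h1 h2 P) as (Q1 & HQ1 & HF1); auto.
      * intros b; apply Rlt_le, M1.
      * intros b; apply Rlt_le, M2.
      * now apply hop_map_hop.
      * destruct (M7 Q1 HQ1) as (Q2 & HQ2 & HF2). exists Q2. split; [exact HQ2|].
        replace (roof r Y - h1 + dwell r Y + (h2 - base r' Y')) with tau in HF1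
          by (unfold h2; rewrite EJ; unfold Y'; ring).
        replace (T - t0 - (h - base r X)) with
          (tau + (T - (t0 + rise r X + dwell r X) - (h' - base r' X')))
          by (unfold tau, rise; ring).
        apply Reeb_flow_trans with Q1; auto.
        -- specialize (Hb Hc). generalize (dwell_gt r X). unfold tau, h'. lra.
        -- assert (A := follows_duration Ho Hf'). unfold rise, h' in *. lra.
    + apply (@filterdiff_comp' R_AbsRing R3m R3m R3m (hop_flow r r' n tau) F (X, h)
        (hop_dflow r r' n X) D); [exact HdG|].
      change (filterdiff F (locally (hop_flow r r' n tau (X, h) : R3m)) D). now rewrite EG.
    + intros v. rewrite EG, HA, <- EB. apply hop_dflow_contact.
    + intros v Hv1 Hv2. destruct (hop_dmap_off r r' X (fst v)) as [A B].
      assert (Hc1 := coef_cases Hc).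
      assert (K : Rabs (lp r true (fst v)) <= Rabs (lp r' true (fst (hop_dflow r r' n X v)))).
      { simpl. rewrite (lp_lq true (hop_dmap r r' X (fst v)) Hr'). change (negb true) with false. rewrite B.
        rewrite (sign_abs (kap_cases true Hr')). unfold hop_dq. rewrite Hde.
        assert (Elq : lq r true (fst v) = kap r false * lp r false (fst v)).
        { rewrite lp_lq, <- Rmult_assoc, kap_sqr by exact Hr. simpl. ring. }
        rewrite Elq.
        assert (T1 := inv_eps_gt2 Hr (Rabs_pos (lp r true (fst v)))).
        assert (T2 : Rabs (lp r true (fst v)) / e <= Rabs (kap r false * lp r false (fst v) +
           IZR (coef (comp_hi r)) * (/ e * lp r true (fst v))) + Rabs (lp r false (fst v))).
        { replace (Rabs (lp r true (fst v)) / e) with (Rabs (IZR (coef (comp_hi r)) * (/ e * lp r true (fst v)))).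
          - rewrite <- (sign_abs (kap_cases false Hr) (lp r false (fst v))).
            replace (IZR (coef (comp_hi r)) * (/ e * lp r true (fst v))) with
              ((kap r false * lp r false (fst v) + IZR (coef (comp_hi r)) * (/ e * lp r true (fst v)))
               + - (kap r false * lp r false (fst v))) at 1 by ring.
            eapply Rle_trans; [apply Rabs_triang|]. rewrite Rabs_Ropp. lra.
          - rewrite (sign_abs Hc1), <- Rabs_div_eps. f_equal. unfold Rdiv; ring. }
        lra. }
      apply HG.
      * intros F0. rewrite F0, Rabs_R0 in K. apply Hv1.
        generalize (Rabs_pos (lp r true (fst v))). intros K2.
        destruct (Req_dec (lp r true (fst v)) 0) as [|N0]; [assumption|].
        apply Rabs_pos_lt in N0. lra.
      * simpl in K |- *. rewrite A. exact K.
Qed.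

Lemma strand_velocity r b q : is_chord r -> Rabs (q - par_end r b) < eps0 S ->
  pi_xy (velocity (lam (comp_end r b)) q) = dir r b.
Proof.
  intros Hr Hq.
  assert (N : locally q (fun s => pi_xy (lam (comp_end r b) s) =
    (fst (ctr r) + (s - par_end r b) * fst (dir r b), snd (ctr r) + (s - par_end r b) * snd (dir r b)))).
  { exists (mkposreal _ (proj2 (Rlt_0_minus _ _) Hq)). intros s Hs.
    assert (Hs' : Rabs (s - q) < eps0 S - Rabs (q - par_end r b)) by exact Hs.
    assert (H0 := zero_le_eps0 (S := S)).
    rewrite <- Phi_core, Phi_normal_form by (auto;
      replace (s - par_end r b) with ((s - q) + (q - par_end r b)) by ring;
      generalize (Rabs_triang (s - q) (q - par_end r b)); lra).
    f_equal; ring. }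
  apply pair_eq;
    [change (Derive (fun s => c1 (lam (comp_end r b) s)) q = fst (dir r b))
    |change (Derive (fun s => c2 (lam (comp_end r b) s)) q = snd (dir r b))].
  - rewrite (Derive_ext_loc _ (fun s => fst (ctr r) + (s - par_end r b) * fst (dir r b))).
    + generalize (fst (ctr r)) (fst (dir r b)). intros a d.
      apply is_derive_unique. auto_derive; [exact I|ring].
    + revert N. apply filter_imp. intros s Es. exact (f_equal fst Es).
  - rewrite (Derive_ext_loc _ (fun s => snd (ctr r) + (s - par_end r b) * snd (dir r b))).
    + generalize (snd (ctr r)) (snd (dir r b)). intros a d.
      apply is_derive_unique. auto_derive; [exact I|ring].
    + revert N. apply filter_imp. intros s Es. exact (f_equal snd Es).
Qed.

Lemma lp_dir r b : lp r b (dir r b) = 0.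
Proof. unfold lp, J0, dot2; simpl. ring. Qed.

Lemma lp_dir_cross r b : is_chord r -> lp r b (dir r (negb b)) <> 0.
Proof.
  intros Hr. rewrite lp_lq by exact Hr. unfold lq. rewrite dir_unit.
  destruct (kap_cases b Hr) as [-> | ->]; lra.
Qed.

(** The p-component of the transported tangent in the final strand is nonzero, that
    of the tangent of Lambda^0 is zero. *)
Lemma chord_nondegenerate k : nondegenerate k.
Proof.
  destruct (chord_follows k) as (r & w & X & Xs & Ho & Hf & Hc & E).
  generalize (eps_range (S := S)); intros He.
  assert (Hr := tail_word_chord (orbit_tail_word Ho)). assert (HX := orbit_over Ho).
  assert (Hp := rise_pos Hr HX). unfold rise in Hp.
  destruct (start_on_Lambda0 Ho Hf Hc E) as [Hs Elam].
  assert (Eb : height r false X = base r X) by (unfold base; rewrite collar_0 by exact Hc; ring).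
  assert (Hflow := orbit_local_flow Ho Hf). simpl in Hflow.
  destruct (Hflow (height r false X)) as
    (rl & Xl & Hrl & HXl & Hcl & Epl & HTl & F & D & EF & HL & HD & HA & HG).
  - intros N; contradiction.
  - intros _; lra.
  - lra.
  - rewrite E, Rabs_R0; lra.
  - rewrite Eb in HL. replace (len k - 0 - (base r X - base r X)) with (len k) in HL by ring.
    rewrite <- Eb in HL.
    assert (Elam' := Phi_end Hrl HXl Epl). change (comp_end rl true) with (comp_hi rl) in Elam'.
    assert (Hv : pi_xy (velocity (lam (comp_lo r)) (par_end r false + offq r false X)) = dir r false).
    { change (comp_lo r) with (comp_end r false). apply strand_velocity; [exact Hr|].
      replace (par_end r false + offq r false X - par_end r false) with (offq r false X) by ring.
      generalize (HX false); lra. }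
    assert (Hv' : pi_xy (velocity (lam (comp_hi rl)) (par_end rl true + offq rl true Xl)) = dir rl true).
    { change (comp_hi rl) with (comp_end rl true). apply strand_velocity; [exact Hrl|].
      replace (par_end rl true + offq rl true Xl - par_end rl true) with (offq rl true Xl) by ring.
      generalize (HXl true); lra. }
    set (q := par_end r false + offq r false X) in *.
    set (q' := par_end rl true + offq rl true Xl) in *.
    set (v := velocity (lam (comp_lo r)) q) in *.
    set (v' := velocity (lam (comp_hi rl)) q') in *.
    assert (HD1 : lp rl true (fst (D v)) <> 0).
    { apply HG; change (fst v) with (pi_xy v); rewrite Hv.
      - exact (lp_dir_cross (b := true) Hr).
      - rewrite lp_dir, Rabs_R0. apply Rabs_pos. }
    exists (comp_lo r), (comp_hi rl), q, q'. split; [exact Hc|split; [exact Hcl|]].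
    rewrite Elam, Elam'. split; [exact Hs|split; [exact HTl|]].
    exists F, D. split; [exact EF|split; [exact HL|split; [exact HD|]]].
    cbv zeta. fold v. split; [|split].
    + intros Z. apply HD1. rewrite Z. unfold lp, dot2. simpl. to_R. ring.
    + assert (A := HA v). rewrite EF in A. rewrite A, <- Elam.
      apply (proj1 (proj2 (proj2 (proj2 (proj2 (@gs_leg S G))))) (comp_lo r) q).
    + intros [a Ea]. apply HD1. rewrite Ea.
      transitivity (a * lp rl true (pi_xy v')).
      * unfold lp, dot2, pi_xy. simpl. to_R. ring.
      * rewrite Hv', lp_dir. ring.
Qed.

End Nondegeneracy.

(** * The word map *)

Theorem theorem5p10 :
  forall (L : link) (eps0 : R) (Phi : comp L -> R3 -> R3)
         (eps delta : R) (f : R -> R),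
    legendrian_link L ->
    nondegenerate_chords L ->
    disjoint_chords L ->
    good_position L ->
    tubular_neighborhoods eps0 Phi ->
    0 < eps < eps0 ->
    0 < delta ->
    twist_profile delta f ->
    small_delta L eps delta f ->
    let M := Surgery Phi eps0 eps f in
    exists word_of : Reeb_chord M -> list (vchord L),
      (forall k w, has_word k w <-> word_of k = w) /\
      (forall k, is_word (word_of k)) /\
      (forall k k', word_of k = word_of k' -> same_chord k k') /\
      (forall w, is_word w -> exists k, word_of k = w) /\
      (forall w k, is_word w -> word_of k = w -> nondegenerate k).
Proof.
  intros L eps0 Phi eps delta f HL Hn Hd Hg Ht He Hdel Htw Hsm M.
  assert (G : good_surgery M).
  { constructor; simpl; auto. exists delta. auto. }
  destruct (functional_choice (fun (k : Reeb_chord M) w => has_word k w /\ is_word w))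
    as [word_of Hw].
  { intros k. apply chord_has_word. }
  assert (HW : forall k w, has_word k w <-> word_of k = w).
  { intros k w. split.
    - intros H. exact (chord_word_unique (proj1 (Hw k)) H).
    - intros <-. apply Hw. }
  exists word_of. split; [exact HW|split; [|split; [|split]]].
  - intros k. apply Hw.
  - intros k k' E. apply chord_unique with (word_of k); [apply Hw|]. rewrite E. apply Hw.
  - intros w H. destruct (@word_has_chord M G w H) as [k Hk]. exists k. now apply HW.
  - intros w k _ _. apply chord_nondegenerate.
Qed.
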